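(* Let $X$ be a geometric Brownian motion, $dX_t=\mu X_t\,dt+\sigma X_t\,dW_t$, with $\mu\in\mathbb R$, $\sigma>0$ constants and $W$ a standard Brownian motion, with state space $\mathbb X=(0,\infty)$; let $f(x)=(K-x)^+$ on $\mathbb X$ with $K>0$, and $\delta(t)=\frac1{1+\beta t}$ with $\beta>0$. Let $\nu:=\frac{\mu}{\sigma^2}-\frac12$ and $$\lambda:=\int_0^\infty e^{-s}\Big(\sqrt{\nu^2+2\beta s/\sigma^2}+\nu\Big)ds>0 .$$ Then $R^*:=\bigcap_{R\in\mathcal E,\ R\text{ closed}}R$ equals $\big(0,\frac{\lambda}{1+\lambda}K\big]$, and it is the unique closed optimal equilibrium.
   Context: $\mathcal B(\mathbb X)$ is the collection of Borel subsets of $\mathbb X$; $\mathbb P^x,\mathbb E^x$ denote probability and expectation given $X_0=x$, and $X^x$ denotes $X$ started at $x\in\mathbb X$. For $x\in\mathbb X$, $R\in\mathcal B(\mathbb X)$: $\rho(x,R):=\inf\{t>0: X^x_t\in R\}$ ($\inf\emptyset=\infty$) and $J(x,R):=\mathbb E^x[\delta(\rho(x,R))f(X_{\rho(x,R)})]$, where on $\{\rho(x,R)=\infty\}$ the integrand is taken to be $\limsup_{t\to\infty}\delta(t)f(X^x_t)$. Put $S_R:=\{x: f(x)>J(x,R)\}$, $I_R:=\{x: f(x)=J(x,R)\}$, and $\Theta(R):=S_R\cup(I_R\cap R)$. $R\in\mathcal B(\mathbb X)$ is an equilibrium if $\Theta(R)=R$; $\mathcal E$ is the set of all equilibria. $V(x,R):=\max\{f(x),J(x,R)\}$.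 $\hat R\in\mathcal E$ is an optimal equilibrium if $V(x,\hat R)\ge V(x,R)$ for all $x\in\mathbb X$ and all $R\in\mathcal E$. ''Closed'' means closed relative to $\mathbb X$. *)

(* Defs.v *)
From HB Require Import structures.
From mathcomp Require Import all_boot all_order all_algebra.
From mathcomp Require Import all_classical all_reals all_analysis.

Set Implicit Arguments.
Unset Strict Implicit.
Unset Printing Implicit Defensive.

Import Order.TTheory GRing.Theory Num.Theory.
Import numFieldNormedType.Exports.

Local Open Scope classical_set_scope.
Local Open Scope ring_scope.

(* Processes and filtrations are indexed by real times, of which only the
   nonnegative ones matter. *)

Definition measurable_wrt (Om : Type) (R : realType)
    (G : set (set Om)) (Z : Om -> R) : Prop :=
  forall B : set R, measurable B -> G (Z @^-1` B).

Definition filtration d (Om : measurableType d) (R : realType)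
    (F : R -> set (set Om)) : Prop :=
  [/\ forall t : R, 0 <= t -> sigma_algebra setT (F t),
      forall t : R, 0 <= t -> F t `<=` measurable
    & forall s t : R, 0 <= s -> s <= t -> F s `<=` F t].

Definition adapted (Om : Type) (R : realType)
    (F : R -> set (set Om)) (Y : R -> Om -> R) : Prop :=
  forall t : R, 0 <= t -> measurable_wrt (F t) (Y t).

Definition continuous_paths (Om : Type) (R : realType)
    (Y : R -> Om -> R) : Prop :=
  forall w, {within `[0, +oo[, continuous (fun t => Y t w)}.

(* [normal_prob m s] is the normal law with mean [m] and standard deviation
   [s], hence variance [t - s] below. *)
Definition brownian_motion d (Om : measurableType d) (R : realType)
    (P : probability Om R) (F : R -> set (set Om)) (W : R -> Om -> R) : Prop :=
  [/\ adapted F W,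
      continuous_paths W,
      forall w, W 0 w = 0,
      forall s t : R, 0 <= s -> s < t -> forall B : set R, measurable B ->
        P [set w | B (W t w - W s w)] = normal_prob 0 (Num.sqrt (t - s)) B
    & forall s t : R, 0 <= s -> s < t ->
        forall (A : set Om) (B : set R), F s A -> measurable B ->
        P (A `&` [set w | B (W t w - W s w)]) =
        (P A * P [set w | B (W t w - W s w)%R])%E].

(* The data of the simple process equal to [sp_val i] on the time interval
   [ ]sp_time i, sp_time i.+1] ] for [i < sp_size]; it is an admissible
   integrand on [[0, t]] when [simple_process_on] holds. *)
Record simple_process (Om : Type) (R : Type) := SimpleProcess {
  sp_size : nat;
  sp_time : nat -> R;
  sp_val : nat -> Om -> R }.

Definition simple_process_on (Om : Type) (R : realType)
    (F : R -> set (set Om)) (t : R) (phi : simple_process Om R) : Prop :=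
  [/\ sp_time phi 0%N = 0,
      sp_time phi (sp_size phi) = t,
      forall i, (i < sp_size phi)%N -> sp_time phi i <= sp_time phi i.+1,
      forall i, (i < sp_size phi)%N ->
        measurable_wrt (F (sp_time phi i)) (sp_val phi i)
    & forall i, (i < sp_size phi)%N ->
        exists M : R, forall w, `|sp_val phi i w| <= M].

Definition simple_value (Om : Type) (R : realType)
    (phi : simple_process Om R) (s : R) (w : Om) : R :=
  \sum_(i < sp_size phi)
     sp_val phi i w * \1_(`]sp_time phi i, sp_time phi i.+1]) s.

Definition simple_integral (Om : Type) (R : realType)
    (W : R -> Om -> R) (phi : simple_process Om R) (w : Om) : R :=
  \sum_(i < sp_size phi)
     sp_val phi i w * (W (sp_time phi i.+1) w - W (sp_time phi i) w).

(* [I] is (a version of) the Ito integral of [H] against [W] over [[0, t]]: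
   the limit in L^2(P) of the integrals of simple processes converging to [H]
   in L^2(ds x P).  In particular [H] is in L^2(ds x P). *)
Definition is_ito_integral d (Om : measurableType d) (R : realType)
    (P : probability Om R) (F : R -> set (set Om)) (W : R -> Om -> R)
    (H : R -> Om -> R) (t : R) (I : Om -> R) : Prop :=
  measurable_fun setT I /\
  exists phi : nat -> simple_process Om R,
    [/\ forall k, simple_process_on F t (phi k),
        (fun k => (\int[P]_w \int[lebesgue_measure]_(s in `[0%R, t])
           (((H s w - simple_value (phi k) s w) ^+ 2)%R)%:E)%E) @ \oo --> 0%E
      & (fun k => (\int[P]_w
           (((I w - simple_integral W (phi k) w) ^+ 2)%R)%:E)%E) @ \oo --> 0%E].

(* Solution with values in ]0, +oo[ of
   dY_t = mu Y_t dt + sigma Y_t dW_t, Y_0 = x. *)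
Definition geometric_brownian_motion d (Om : measurableType d) (R : realType)
    (P : probability Om R) (F : R -> set (set Om)) (W : R -> Om -> R)
    (mu sigma x : R) (Y : R -> Om -> R) : Prop :=
  [/\ adapted F Y,
      continuous_paths Y,
      forall (t : R) w, 0 <= t -> 0 < Y t w,
      forall w, Y 0 w = x
    & forall t : R, 0 <= t ->
        exists2 I : Om -> R,
          is_ito_integral P F W (fun s w => sigma * Y s w) t I
        & {ae P, forall w,
             Y t w = x + \int[lebesgue_measure]_(s in `[0, t]) (mu * Y s w)
                       + I w}].

(* In the sequel, the process is given as a family [X x] indexed by its starting
   point [x], all on the same probability space; [XX] is its state space, [f]
   the payoff and [delta] the discount function. *)

(* When the state space [XX] is Borel in the real line, a subset of [XX] is Borel
   in [XX] iff it is Borel in the real line. *)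
Definition region (R : realType) (XX A : set R) : Prop :=
  measurable A /\ A `<=` XX.

Definition closed_in (R : realType) (XX A : set R) : Prop :=
  exists2 C : set R, closed C & A = C `&` XX.

Definition rho (Om : Type) (R : realType) (X : R -> R -> Om -> R)
    (x : R) (A : set R) (w : Om) : \bar R :=
  ereal_inf [set t%:E | t in [set t : R | 0 < t /\ A (X x t w)]].

(* The value on [rho = +oo] is the limsup of the discounted payoff as time goes
   to infinity. The set [A] being merely Borel, measurability in [w] is not
   asserted: integrals are total, and for a nonnegative [f] and [delta] the one
   in [J] is the supremum of the integrals of the simple functions below. *)
Definition stopped_payoff (Om : Type) (R : realType) (X : R -> R -> Om -> R)
    (f delta : R -> R) (x : R) (A : set R) (w : Om) : \bar R :=
  if rho X x A w == +oo%E then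
    limf_esup (fun t => (delta t * f (X x t w))%:E) (pinfty_nbhs R)
  else let t := fine (rho X x A w) in (delta t * f (X x t w))%:E.

Definition J d (Om : measurableType d) (R : realType) (P : probability Om R)
    (X : R -> R -> Om -> R) (f delta : R -> R) (x : R) (A : set R) : \bar R :=
  (\int[P]_w stopped_payoff X f delta x A w)%E.

Definition stopping_set d (Om : measurableType d) (R : realType)
    (P : probability Om R) (X : R -> R -> Om -> R) (XX : set R)
    (f delta : R -> R) (A : set R) : set R :=
  [set x | XX x /\ (J P X f delta x A < (f x)%:E)%E].

Definition indifference_set d (Om : measurableType d) (R : realType)
    (P : probability Om R) (X : R -> R -> Om -> R) (XX : set R)
    (f delta : R -> R) (A : set R) : set R :=
  [set x | XX x /\ (f x)%:E = J P X f delta x A].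

Definition Theta d (Om : measurableType d) (R : realType)
    (P : probability Om R) (X : R -> R -> Om -> R) (XX : set R)
    (f delta : R -> R) (A : set R) : set R :=
  stopping_set P X XX f delta A `|` (indifference_set P X XX f delta A `&` A).

Definition equilibrium d (Om : measurableType d) (R : realType)
    (P : probability Om R) (X : R -> R -> Om -> R) (XX : set R)
    (f delta : R -> R) (A : set R) : Prop :=
  region XX A /\ Theta P X XX f delta A = A.

Definition V d (Om : measurableType d) (R : realType) (P : probability Om R)
    (X : R -> R -> Om -> R) (f delta : R -> R) (x : R) (A : set R) : \bar R :=
  maxe (f x)%:E (J P X f delta x A).

Definition optimal_equilibrium d (Om : measurableType d) (R : realType)
    (P : probability Om R) (X : R -> R -> Om -> R) (XX : set R)
    (f delta : R -> R) (A : set R) : Prop :=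
  equilibrium P X XX f delta A /\
  forall x B, XX x -> equilibrium P X XX f delta B ->
    (V P X f delta x B <= V P X f delta x A)%E.

Definition Rstar d (Om : measurableType d) (R : realType)
    (P : probability Om R) (X : R -> R -> Om -> R) (XX : set R)
    (f delta : R -> R) : set R :=
  \bigcap_(A in [set A | equilibrium P X XX f delta A /\ closed_in XX A]) A.

Definition put_payoff (R : realType) (K x : R) : R := Num.max (K - x) 0.

Definition hyperbolic_discount (R : realType) (beta t : R) : R :=
  1 / (1 + beta * t).

Definition nu (R : realType) (mu sigma : R) : R := mu / sigma ^+ 2 - 1 / 2.

Definition lambda (R : realType) (mu sigma beta : R) : R :=
  \int[lebesgue_measure]_(s in `[0, +oo[)
    (expR (- s) *
     (Num.sqrt (nu mu sigma ^+ 2 + 2 * beta * s / sigma ^+ 2) + nu mu sigma)).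

(* Main.v *)
Require Import Defs.
From HB Require Import structures.
From mathcomp Require Import all_boot all_order all_algebra.
From mathcomp Require Import all_classical all_reals all_analysis.
From mathcomp Require Import measurable_realfun ring lra.


(* By Gronwall, X^x_t = x exp(sigma W_t + (mu - sigma^2/2) t) almost surely, so that
   with Y = ln(X/x) and g(p) = sigma^2 (p^2 + 2 nu p)/2 each exp(p Y_t - g(p) t) is a
   martingale.  Stopping it at hitting times of open sets gives supermartingale
   bounds, the Laplace transform of one-sided hitting times, and the regularity of
   levels: a level is crossed as soon as it is reached.
   Averaging over an exponential variable s turns exp(-beta s t) into delta(t) and, with
   a_s the root of g(-a) = beta s, produces
     H_b(t, y) = E_s[exp(-beta s t) (y/b)^(-a_s)],     lambda = E_s[a_s].
   Jensen gives H_b(0, y) >= (y/b)^(-lambda); Chebyshev's correlation inequality gives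
   delta(t) (1 - lambda (y/b - 1))^+ <= H_b(t, y).  At b = lambda K/(1 + lambda) one has
   K - y = (K - b)(1 - lambda (y/b - 1)), hence J(x, (0, b]) = (K - b) H_b(0, x) > f(x)
   for x > b, and J(x, B) <= (K - b) H_b(0, x) off the closure of any equilibrium B.
   A gap of an equilibrium just above some l < b is impossible: there J(x, B) < f(x)
   for x close to l, by expanding both sides to second order in ln(x/l). *)

Set Implicit Arguments.
Unset Strict Implicit.
Unset Printing Implicit Defensive.

Import Order.TTheory GRing.Theory Num.Theory.
Import numFieldNormedType.Exports.

Local Open Scope classical_set_scope.
Local Open Scope ring_scope.

(** * Square-integrable functions and independence *)

(** A region B is only Borel, and measurability of its hitting time is not at hand. So every
    estimate of J is a domination, off a null set, by a functional of an open set; off the closure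
    of B this set is [beyond B x], which is hit at the same time almost surely. Open sets are the
    right class: their hitting times are limits from above of times read on finite grids. The Ito
    integral is given only as an L^2 limit of simple integrals. No Ito formula is used: the residual
    of the equation for the explicit solution is compared with simple integrals by computing
    Gaussian moments, and X is identified with the explicit solution at each fixed time. The
    discount is not multiplicative, so a majorant must remember the elapsed time; this is the role
    of the first argument of H_b. The value of b is a smooth fit: the slope of (K - b) H_b(0, y) at
    y = b is - lambda (K - b)/b, which equals -1, the slope of the payoff, when b/(K - b) = lambda.
    For l < b the ratio l/(K - l) is only a fraction q < 1 of lambda; the weight 1 - q is carried by
    a bound on the discount alone, and it is there that a gap loses strictly. *)

Lemma normrM_le_sqrD (R : realFieldType) (a b : R) : `|a * b| <= a ^+ 2 + b ^+ 2.
Proof.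
rewrite ler_norml; apply/andP; split.
  by have := sqr_ge0 (a + b); have := sqr_ge0 a; have := sqr_ge0 b; lra.
by have := sqr_ge0 (a - b); have := sqr_ge0 a; have := sqr_ge0 b; lra.
Qed.

Lemma sqrD_le2 (R : realFieldType) (a b : R) :
  (a + b) ^+ 2 <= 2 * a ^+ 2 + 2 * b ^+ 2.
Proof. by have := sqr_ge0 (a - b); lra. Qed.

Section real_integrals.
Context d (T : measurableType d) (R : realType).
Variable mu : {measure set T -> \bar R}.
Implicit Types f g h : T -> R.

Lemma integrable_dom f g : measurable_fun setT f ->
  (forall x, `|f x| <= g x) -> mu.-integrable setT (EFin \o g) ->
  mu.-integrable setT (EFin \o f).
Proof.
move=> mf fg ig; apply: le_integrable ig => //; first exact/measurable_EFinP.
by move=> x _; rewrite lee_fin (le_trans (fg x))// ler_norm.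
Qed.

Lemma integrable_measurable f :
  mu.-integrable setT (EFin \o f) -> measurable_fun setT f.
Proof. by move/measurable_int/measurable_EFinP. Qed.

Lemma integrableDr f g : mu.-integrable setT (EFin \o f) ->
  mu.-integrable setT (EFin \o g) ->
  mu.-integrable setT (EFin \o (fun x => f x + g x)).
Proof. by move=> fi gi; exact: (integrableD measurableT fi gi). Qed.

Lemma integrableBr f g : mu.-integrable setT (EFin \o f) ->
  mu.-integrable setT (EFin \o g) ->
  mu.-integrable setT (EFin \o (fun x => f x - g x)).
Proof. by move=> fi gi; exact: (integrableB measurableT fi gi). Qed.

Lemma integrableZr_ (k : R) f : mu.-integrable setT (EFin \o f) ->
  mu.-integrable setT (EFin \o (fun x => k * f x)).
Proof. by move=> fi; exact: (integrableZl measurableT k fi). Qed.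

Lemma Rintegral_EFin f : mu.-integrable setT (EFin \o f) ->
  (\int[mu]_x (f x)%:E)%E = (\int[mu]_x f x)%:E.
Proof. by move=> fi; rewrite fineK// integrable_fin_num. Qed.

Lemma ge0_integrable f (c : \bar R) : measurable_fun setT f ->
  (forall x, 0 <= f x) -> (\int[mu]_x (f x)%:E <= c)%E -> (c < +oo)%E ->
  mu.-integrable setT (EFin \o f).
Proof.
move=> mf f0 fc coo; apply/integrableP; split; first exact/measurable_EFinP.
under eq_integral do rewrite /= ger0_norm//.
exact: le_lt_trans fc coo.
Qed.

(** Membership in L^2. Measurability of [f] is required apart, since that of its square does not
    imply it. *)
Definition sqint f :=
  measurable_fun setT f /\ mu.-integrable setT (EFin \o (fun x => f x ^+ 2)).

Lemma sqintM f g : sqint f -> sqint g ->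
  mu.-integrable setT (EFin \o (fun x => f x * g x)).
Proof.
move=> [mf f2] [mg g2]; apply: integrable_dom (integrableDr f2 g2).
  exact: measurable_funM.
by move=> x; exact: normrM_le_sqrD.
Qed.

Lemma sqintZ (k : R) f : sqint f -> sqint (fun x => k * f x).
Proof.
move=> [mf f2]; split; first exact: measurable_funM.
have := integrableZr_ (k ^+ 2) f2; congr (mu.-integrable _ _).
by apply/funext => x /=; rewrite exprMn.
Qed.

Lemma sqintD f g : sqint f -> sqint g -> sqint (fun x => f x + g x).
Proof.
move=> f2 g2; split; first exact: measurable_funD f2.1 g2.1.
apply: integrable_dom (integrableDr (integrableZr_ 2 f2.2) (integrableZr_ 2 g2.2)).
  by apply: measurable_funX; exact: measurable_funD f2.1 g2.1.
by move=> x; rewrite ger0_norm ?sqr_ge0//; exact: sqrD_le2.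
Qed.

Lemma sqintB f g : sqint f -> sqint g -> sqint (fun x => f x - g x).
Proof.
move=> f2 g2; have := sqintD f2 (sqintZ (-1) g2); congr sqint.
by apply/funext => x; rewrite mulN1r.
Qed.

Lemma sqint_bM (M : R) f g : measurable_fun setT f -> (forall x, `|f x| <= M) ->
  sqint g -> sqint (fun x => f x * g x).
Proof.
move=> mf fM [mg g2]; split; first exact: measurable_funM.
apply: integrable_dom (integrableZr_ (M ^+ 2) g2).
  by apply: measurable_funX; exact: measurable_funM.
move=> x; rewrite ger0_norm ?sqr_ge0// exprMn ler_wpM2r ?sqr_ge0//.
by rewrite -real_normK ?num_real// lerXn2r ?nnegrE// (le_trans _ (fM x)).
Qed.

End real_integrals.

Section probability_integrals.
Context d (T : measurableType d) (R : realType) (P : probability T R).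
Implicit Types f g : T -> R.

Lemma probability_integrable_cst (c : R) :
  P.-integrable setT (EFin \o (fun=> c)).
Proof. exact: finite_measure_integrable_cst. Qed.

Lemma probability_Rintegral_cst (c : R) : \int[P]_x (fun=> c) x = c.
Proof. by rewrite Rintegral_cst//= probability_setT mulr1. Qed.

Lemma sqint_integrable f : sqint P f -> P.-integrable setT (EFin \o f).
Proof.
move=> [mf f2]; apply: integrable_dom (integrableDr f2 (probability_integrable_cst 1)) => //.
by move=> x; have := normrM_le_sqrD (f x) 1; rewrite mulr1 expr1n.
Qed.

Lemma sqint_cst (c : R) : sqint P (fun=> c).
Proof. by split => //; exact: probability_integrable_cst. Qed.

Lemma bounded_sqint (M : R) f : measurable_fun setT f ->
  (forall x, `|f x| <= M) -> sqint P f.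
Proof.
move=> mf fM; have := sqint_bM mf fM (sqint_cst 1); congr sqint.
by apply/funext => x; rewrite mulr1.
Qed.

(** Independence says that the joint law of [f] and [g] agrees with the product of their laws on
    rectangles, hence everywhere. The expectation of the product is then computed by Fubini under
    the product law. *)
Lemma independent_expectation f g :
  (forall A B : set R, measurable A -> measurable B ->
    P (f @^-1` A `&` g @^-1` B) = (P (f @^-1` A) * P (g @^-1` B))%E) ->
  P.-integrable setT (EFin \o f) -> P.-integrable setT (EFin \o g) ->
  P.-integrable setT (EFin \o (fun x => f x * g x)) /\
  \int[P]_x (f x * g x) = (\int[P]_x f x) * (\int[P]_x g x).
Proof.
move=> fg fi gi.
have mf := integrable_measurable fi.
have mg := integrable_measurable gi.
pose F : {mfun T >-> R} := mfun_Sub (mem_set mf).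
pose G : {mfun T >-> R} := mfun_Sub (mem_set mg).
have mFG : measurable_fun setT (fun x => (f x, g x)).
  exact/measurable_fun_pair.
pose FG : {mfun T >-> (R * R)%type} := mfun_Sub (mem_set mFG).
have FGE (X : set (R * R)) : measurable X ->
    (distribution P F \x distribution P G)%E X = distribution P FG X.
  apply: product_measure_unique => A B mA mB.
  by rewrite /distribution /pushforward -fg.
have mM : measurable_fun setT (fun z : R * R => z.1 * z.2).
  by apply: measurable_funM; [exact: measurable_fst|exact: measurable_snd].
have mnorm (X : {mfun T >-> R}) : P.-integrable setT (EFin \o X) ->
    (\int[distribution P X]_y `|y|%:E < +oo)%E.
  move=> /integrableP[_]; rewrite ge0_integral_pushforward//.
  by apply/measurable_EFinP; exact: normr_measurable.
have iM : (distribution P F \x distribution P G)%E.-integrable setT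
    (EFin \o (fun z : R * R => z.1 * z.2)).
  apply/integrable12ltyP; first exact/measurable_EFinP.
  under eq_integral => a _.
    under eq_integral do rewrite /= normrM EFinM.
    rewrite ge0_integralZl//; last by apply/measurable_EFinP; exact: normr_measurable.
    over.
  rewrite ge0_integralZr//.
  - by apply: lte_mul_pinfty; rewrite ?integral_ge0// ?ge0_fin_numE ?integral_ge0// ?mnorm.
  - by apply/measurable_EFinP; exact: normr_measurable.
  - exact: integral_ge0.
have iFG : (distribution P FG).-integrable setT
    (EFin \o (fun z : R * R => z.1 * z.2)).
  move/integrableP : (iM) => [m2 i2]; apply/integrableP; split => //.
  rewrite (@eq_measure_integral _ _ _ _ (distribution P F \x distribution P G)%E)//.
  by move=> A mA _; exact/esym/FGE.
have iP : P.-integrable setT (EFin \o (fun x => f x * g x)).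
  move/integrableP : (iFG) => [m2 i2]; apply/integrableP; split.
    by apply/measurable_EFinP; exact: measurable_funM.
  move: i2; rewrite ge0_integral_pushforward//.
  by apply/measurable_EFinP; exact: measurableT_comp.
split => //.
apply: EFin_inj; rewrite EFinM -!Rintegral_EFin//.
have -> : (\int[P]_x (f x * g x)%:E = \int[distribution P FG]_z (z.1 * z.2)%:E)%E.
  rewrite integral_pushforward//.
  exact/measurable_EFinP.
rewrite (@eq_measure_integral _ _ _ _ (distribution P F \x distribution P G)%E)//; last first.
  by move=> A mA _; exact/esym/FGE.
rewrite -(integral12_prod_meas1 iM) /fubini_F/=.
have gE : (\int[P]_x (g x)%:E = \int[distribution P G]_z z%:E)%E.
  rewrite integral_pushforward//.
have fE : (\int[P]_x (f x)%:E = \int[distribution P F]_z z%:E)%E.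
  rewrite integral_pushforward//.
have iG : (distribution P G).-integrable setT (EFin \o id).
  by apply/integrableP; split; [exact/measurable_EFinP/measurable_id|exact: (mnorm G gi)].
have iF : (distribution P F).-integrable setT (EFin \o id).
  by apply/integrableP; split; [exact/measurable_EFinP/measurable_id|exact: (mnorm F fi)].
under eq_integral => a _.
  under eq_integral do rewrite EFinM.
  rewrite integralZl//. over.
rewrite gE -(fineK (integrable_fin_num measurableT iG)) integralZr//.
by rewrite fE.
Qed.

End probability_integrals.

(** * Integration against a density *)

Section density.
Import HBNNSimple.

(** Clear for simple functions, and monotone convergence does the rest. It serves for both the
    normal and the exponential law, which are given by their densities. *)
Lemma integral_density d (T : measurableType d) (R : realType)
    (mu nu : {measure set T -> \bar R}) (h : T -> R) (f : T -> \bar R) :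
  measurable_fun setT h -> (forall x, 0 <= h x) ->
  (forall A, measurable A -> nu A = \int[mu]_(x in A) (h x)%:E)%E ->
  measurable_fun setT f -> (forall x, 0 <= f x)%E ->
  (\int[nu]_x f x = \int[mu]_x (f x * (h x)%:E))%E.
Proof.
move=> mh h0 nuE mf f0.
have mEh : measurable_fun setT (EFin \o h) by exact/measurable_EFinP.
pose g := nnsfun_approx measurableT mf.
have gf x : (g n x)%:E @[n --> \oo] --> f x by exact: cvg_nnsfun_approx.
have ndg x : {homo (fun n => (g n x)%:E) : m n / (m <= n)%N >-> (m <= n)%E}.
  by move=> m n mn; rewrite lee_fin; exact/lefP/nd_nnsfun_approx.
transitivity (limn (fun n => \int[nu]_x (g n x)%:E)%E).
  rewrite -monotone_convergence//=.
  - by apply: eq_integral => x _; apply/esym/cvg_lim => //; exact: gf.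
  - by move=> n; exact/measurable_EFinP.
  - by move=> n x _; rewrite lee_fin.
transitivity (limn (fun n => \int[mu]_x ((g n x)%:E * (h x)%:E))%E); last first.
  rewrite -monotone_convergence//=.
  - apply: eq_integral => x _; apply/cvg_lim => //.
    by apply: cvgeMr => //; exact: gf.
  - by move=> n; apply: emeasurable_funM => //; exact/measurable_EFinP.
  - by move=> n x _; rewrite mule_ge0 ?lee_fin.
  - by move=> x _ m n mn; rewrite lee_wpmul2r ?lee_fin//; exact/lefP/nd_nnsfun_approx.
congr (limn _); apply/funext => n.
transitivity (\sum_(k \in range (g n)) k%:E * nu (g n @^-1` [set k]))%E.
  by rewrite integralT_nnsfun sintegralE fsbig_mkcond//.
rewrite (eq_integral (fun x => \sum_(k \in range (g n))
   (k * (\1_(g n @^-1` [set k]) x * h x))%:E)%E); last first.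
  move=> x _; rewrite [in LHS](fimfunE (g n)) -EFinM fsumEFin//; congr (_%:E).
  by rewrite mulr_fsuml; apply: eq_fsbigr => k _; rewrite mulrA.
rewrite ge0_integral_fsum//.
- apply: eq_fsbigr => k /set_mem[y _ <-].
  under eq_integral do rewrite EFinM.
  rewrite ge0_integralZl//.
  + congr (_ * _)%E; rewrite nuE// integral_mkcond.
    apply: eq_integral => x _; rewrite patchE indicE.
    by case: ifP => _; rewrite ?mul1r ?mul0r.
  + by apply/measurable_EFinP/measurable_funM.
  + by move=> x _; rewrite lee_fin mulr_ge0.
  + by rewrite lee_fin; exact: fun_ge0.
- by move=> k; apply/measurable_EFinP; do 2 apply: measurable_funM => //.
- move=> k x _; rewrite lee_fin indicE; case: (boolP (x \in _)) => [/set_mem <-|_].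
    by rewrite !mulr_ge0//; exact: fun_ge0.
  by rewrite mul0r mulr0.
Qed.

End density.

(** * Measurability with respect to the sigma-algebras of a filtration *)

Section subalgebra.
Context d (Om : measurableType d) (R : realType).
Implicit Types (G : set (set Om)) (f g : Om -> R).

(** A member of the filtration is a bare set of sets. Viewing it as the sigma-algebra it generates
    gives a measurable type, where the closure properties of measurable functions are available. *)
Lemma measurable_wrtP G f : sigma_algebra setT G ->
  measurable_wrt G f <->
  measurable_fun setT (f : g_sigma_algebraType G -> R).
Proof.
move=> sG; split=> [Gf _ B mB|mf B mB].
  by rewrite setTI; apply: sub_sigma_algebra; exact: Gf.
have := mf measurableT B mB; rewrite setTI /= => h.
exact: (h G (conj sG (@subset_refl _ G))).
Qed.

Lemma measurable_wrt_comp G f (h : R -> R) : measurable_wrt G f ->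
  measurable_fun setT h -> measurable_wrt G (fun w => h (f w)).
Proof.
move=> Gf mh B mB; have -> : (fun w => h (f w)) @^-1` B = f @^-1` (h @^-1` B) by [].
by apply: Gf; rewrite -[X in measurable X]setTI; exact: mh.
Qed.

Lemma measurable_wrtM G f g : sigma_algebra setT G ->
  measurable_wrt G f -> measurable_wrt G g ->
  measurable_wrt G (fun w => f w * g w).
Proof.
move=> sG /(measurable_wrtP _ sG) mf /(measurable_wrtP _ sG) mg.
by apply/(measurable_wrtP _ sG); exact: measurable_funM.
Qed.

Lemma measurable_wrtB G f g : sigma_algebra setT G ->
  measurable_wrt G f -> measurable_wrt G g ->
  measurable_wrt G (fun w => f w - g w).
Proof.
move=> sG /(measurable_wrtP _ sG) mf /(measurable_wrtP _ sG) mg.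
by apply/(measurable_wrtP _ sG); exact: measurable_funB.
Qed.

Lemma measurable_wrtD G f g : sigma_algebra setT G ->
  measurable_wrt G f -> measurable_wrt G g ->
  measurable_wrt G (fun w => f w + g w).
Proof.
move=> sG /(measurable_wrtP _ sG) mf /(measurable_wrtP _ sG) mg.
by apply/(measurable_wrtP _ sG); exact: measurable_funD.
Qed.

Lemma measurable_wrtS G (H : set (set Om)) f : G `<=` H ->
  measurable_wrt G f -> measurable_wrt H f.
Proof. by move=> GH Gf B mB; exact/GH/Gf. Qed.

Lemma measurable_wrt_measurable G f : G `<=` measurable -> measurable_wrt G f ->
  measurable_fun setT f.
Proof. by move=> Gm Gf _ B mB; rewrite setTI; exact/Gm/Gf. Qed.

End subalgebra.

Section gaussian.
Context (R : realType).

(** Completing the square: the exponential times the centred density is a constant times the normal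
    density centred at [c * s ^+ 2]. *)
Lemma normal_prob_mgf (s c : R) : s != 0 ->
  (\int[normal_prob 0 s]_y (expR (c * y))%:E = (expR (c ^+ 2 * s ^+ 2 / 2))%:E)%E.
Proof.
move=> s0.
have me : measurable_fun setT (fun y : R => (expR (c * y))%:E).
  by apply/measurable_EFinP; apply: measurableT_comp => //; exact: measurable_funM.
have e0 (y : R) : (0 <= (expR (c * y))%:E)%E by rewrite lee_fin expR_ge0.
rewrite (@integral_density _ _ _ lebesgue_measure (normal_prob 0 s)
  (normal_pdf 0 s) _ (measurable_normal_pdf 0 s) (normal_pdf_ge0 0 s)
  (fun A mA => erefl) me e0).
under eq_integral => y _.
  rewrite -EFinM (_ : expR (c * y) * normal_pdf 0 s y = expR (c ^+ 2 * s ^+ 2 / 2) * normal_pdf (c * s ^+ 2) s y); last first.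
    rewrite !normal_pdfE//= mulrCA [RHS]mulrCA /normal_fun -!expRD; congr (_ * expR _).
    by field.
  rewrite EFinM. over.
rewrite ge0_integralZl//.
- by rewrite integral_normal_pdf mule1.
- by apply/measurable_EFinP; exact: measurable_normal_pdf.
- by move=> y _; rewrite lee_fin normal_pdf_ge0.
Qed.

End gaussian.

Section tangent.
Context (R : realType).

(** A line that touches a differentiable graph and stays below it is the tangent. This replaces
    differentiation under the expectation when moments are read off a moment generating function. *)
Lemma tangent_slope (f f' : R -> R) (c a : R) :
  (forall x : R, is_derive x 1 f (f' x)) ->
  (forall e, e * c <= f (a + e) - f a) -> c = f' a.
Proof.
move=> df h; pose g x := f x - c * x.
have dg (x : R) : is_derive x 1 g (f' x - c).
  by apply: is_deriveB; apply: is_derive_eq; rewrite scaler1.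
have ming : forall t, t \in `]a - 1, a + 1[ -> g a <= g t.
  by move=> t _; rewrite /g; have := h (t - a); rewrite (_ : a + (t - a) = t); [lra|ring].
have : is_derive a 1 g 0.
  apply: (@derive1_at_min _ g (a - 1) (a + 1)) => //; first by lra.
  by rewrite in_itv/=; lra.
move=> dg0; have := @derive_val _ _ _ _ _ _ _ dg0.
by rewrite (@derive_val _ _ _ _ _ _ _ (dg a)); lra.
Qed.

Lemma exp_quad_derive (h x : R) :
  is_derive x 1 (fun c : R => expR (c ^+ 2 * h / 2)) (x * h * expR (x ^+ 2 * h / 2)).
Proof.
apply: is_derive_eq.
by rewrite /GRing.scale/= !mulr1; field.
Qed.

End tangent.

(** * Brownian increments *)

Lemma derive_ge0_le (R : realType) (f f' : R -> R) (a b : R) : a <= b ->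
  (forall x : R, is_derive x 1 f (f' x)) -> (forall x, a <= x -> 0 <= f' x) ->
  f a <= f b.
Proof.
move=> ab df f0; apply: (@ger0_derive1_ndecr _ f a b) => //.
- move=> x /[!in_itv]/= /andP[ax _]; rewrite derive1E.
  by rewrite (@derive_val _ _ _ _ _ _ _ (df x)) f0// ltW.
- apply: continuous_subspaceT => x.
  by apply/differentiable_continuous/derivable1_diffP; exact: (@ex_derive _ _ _ _ _ _ _ (df x)).
Qed.

(** The inequality sinh z >= z at z = y/2, squared. It bounds second moments by exponential
    moments. *)
Lemma expRDN_ge (R : realType) (y : R) : 2 + y ^+ 2 <= expR y + expR (- y).
Proof.
have sh (z : R) : 0 <= z -> 2 * z <= expR z - expR (- z).
  move=> z0; pose g (u : R) := expR u - expR (- u) - 2 * u.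
  have : g 0 <= g z.
    apply: (@derive_ge0_le _ g (fun u => expR u + expR (- u) - 2)) => //.
      move=> u; apply: is_derive_eq.
      by rewrite /GRing.scale/= !mulr1; ring.
    by move=> u _; have := expR_ge1Dx u; have := expR_ge1Dx (- u); lra.
  by rewrite /g oppr0 expR0; lra.
have h (x : R) : 0 <= x -> 2 + x ^+ 2 <= expR x + expR (- x).
  move=> x0; have := sh (x / 2) ltac:(lra).
  have -> : expR x = expR (x / 2) ^+ 2 by rewrite -expRM_natr; congr expR; field.
  have -> : expR (- x) = expR (- (x / 2)) ^+ 2.
    by rewrite -expRM_natr; congr expR; field.
  have := expRxMexpNx_1 (x / 2).
  set p := expR _; set q := expR _ => pq hpq.
  have : x ^+ 2 <= (p - q) ^+ 2 by rewrite lerXn2r ?nnegrE//; lra.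
  by lra.
have [/h//|/ltW y0] := leP 0 y.
by have := h (- y); rewrite oppr_ge0 sqrrN opprK addrC => /(_ y0); lra.
Qed.

Section brownian.
Context d (Om : measurableType d) (R : realType) (P : probability Om R).
Variables (F : R -> set (set Om)) (W : R -> Om -> R).
Hypotheses (filtrationF : filtration F) (brownianW : brownian_motion P F W).

Lemma filtration_sigma t : 0 <= t -> sigma_algebra setT (F t).
Proof. by case: filtrationF => h _ _; exact: h. Qed.

Lemma filtration_measurable t f : 0 <= t -> measurable_wrt (F t) f ->
  measurable_fun setT (f : Om -> R).
Proof. by move=> t0; apply: measurable_wrt_measurable; case: filtrationF => _ h _; exact: h. Qed.

Lemma filtration_le s t (f : Om -> R) : 0 <= s -> s <= t ->
  measurable_wrt (F s) f -> measurable_wrt (F t) f.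
Proof. by move=> s0 st; apply: measurable_wrtS; case: filtrationF => _ _ h; exact: h. Qed.

Lemma brownian_adapted t : 0 <= t -> measurable_wrt (F t) (W t).
Proof. by case: brownianW => h _ _ _ _; exact: h. Qed.

Lemma measurable_brownian t : 0 <= t -> measurable_fun setT (W t).
Proof. by move=> t0; exact: (filtration_measurable t0 (brownian_adapted t0)). Qed.

Lemma measurable_increment s t : 0 <= s -> s <= t ->
  measurable_fun setT (fun w => W t w - W s w).
Proof.
by move=> s0 st; apply: measurable_funB; apply: measurable_brownian; lra.
Qed.

Lemma increment_mgf s t c : 0 <= s -> s <= t ->
  P.-integrable setT (EFin \o (fun w => expR (c * (W t w - W s w)))) /\
  \int[P]_w expR (c * (W t w - W s w)) = expR (c ^+ 2 * (t - s) / 2).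
Proof.
move=> s0; rewrite le_eqVlt => /predU1P[<-|st].
  have -> : (fun w => expR (c * (W s w - W s w))) = fun=> 1.
    by apply/funext => w; rewrite subrr mulr0 expR0.
  by split; [exact: probability_integrable_cst|
    rewrite probability_Rintegral_cst subrr mulr0 mul0r expR0].
have mD := measurable_increment s0 (ltW st).
have mD' : @measurable_fun _ _ Om (measurableTypeR R) setT (fun w => W t w - W s w).
  exact: mD.
pose D := @mfun_Sub _ _ Om (measurableTypeR R) _ (mem_set mD').
have mE : measurable_fun setT (fun y : R => expR (c * y)).
  by apply: measurableT_comp => //; exact: measurable_funM.
have E : (\int[P]_w (expR (c * (W t w - W s w)))%:E = (expR (c ^+ 2 * (t - s) / 2))%:E)%E.
  transitivity (\int[distribution P D]_y (expR (c * y))%:E)%E.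
    by rewrite ge0_integral_pushforward//; exact/measurable_EFinP.
  have -> : t - s = Num.sqrt (t - s) ^+ 2 by rewrite sqr_sqrtr//; lra.
  have sq0 : Num.sqrt (t - s) != 0 by rewrite gt_eqF// sqrtr_gt0; lra.
  rewrite -(normal_prob_mgf c sq0).
  apply: eq_measure_integral => B mB _.
  by case: brownianW => _ _ _ h _; exact: h.
split; last by rewrite /Rintegral E.
apply: (ge0_integrable (c := (expR (c ^+ 2 * (t - s) / 2))%:E)) => //.
  exact: (measurableT_comp mE mD).
- by rewrite E lexx.
- exact: ltry.
Qed.

Lemma increment_independent s t (xi : Om -> R) (g : R -> R) : 0 <= s -> s <= t ->
  measurable_wrt (F s) xi -> P.-integrable setT (EFin \o xi) ->
  measurable_fun setT g ->
  P.-integrable setT (EFin \o (fun w => g (W t w - W s w))) ->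
  P.-integrable setT (EFin \o (fun w => xi w * g (W t w - W s w))) /\
  \int[P]_w (xi w * g (W t w - W s w)) =
  (\int[P]_w xi w) * \int[P]_w g (W t w - W s w).
Proof.
move=> s0; rewrite le_eqVlt => /predU1P[<-|st] Fxi ixi mg ig.
  have E : (fun w => xi w * g (W s w - W s w)) = (fun w => g 0 * xi w).
    by apply/funext => w; rewrite subrr mulrC.
  rewrite E; split; first exact: integrableZr_.
  rewrite RintegralZl// mulrC; congr (_ * _).
  rewrite (_ : (fun w => g (W s w - W s w)) = fun=> g 0); last first.
    by apply/funext => w; rewrite subrr.
  by rewrite probability_Rintegral_cst.
apply: independent_expectation => // A B mA mB.
have mB' : measurable (g @^-1` B) by rewrite -[X in measurable X]setTI; exact: mg.
case: brownianW => _ _ _ _ h.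
exact: (h s t s0 st (xi @^-1` A) (g @^-1` B) (Fxi A mA) mB').
Qed.

Lemma sqint_increment_exp s t c : 0 <= s -> s <= t ->
  sqint P (fun w => expR (c * (W t w - W s w))).
Proof.
move=> s0 st; have [ic _] := increment_mgf c s0 st.
split; first exact: integrable_measurable ic.
have [+ _] := increment_mgf (c *+ 2) s0 st; congr (P.-integrable _ _).
by apply/funext => w /=; rewrite -expRM_natl -mulr_natl mulrA.
Qed.

(** The square y^2 exp(2 c y) is dominated by exp((2 c + 1) y) + exp((2 c - 1) y), whose expectation
    is finite by [increment_mgf]. *)
Lemma sqint_increment_mulexp s t c : 0 <= s -> s <= t ->
  sqint P (fun w => (W t w - W s w) * expR (c * (W t w - W s w))).
Proof.
move=> s0 st; have mD := measurable_increment s0 st.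
have mf : measurable_fun setT
    (fun w => (W t w - W s w) * expR (c * (W t w - W s w))).
  apply: measurable_funM => //; apply: measurableT_comp => //.
  exact: measurable_funM.
split => //.
have [i1 _] := increment_mgf (2 * c + 1) s0 st.
have [i2 _] := increment_mgf (2 * c - 1) s0 st.
apply: integrable_dom (integrableDr i1 i2).
  exact: measurable_funX.
move=> w; move: (W t w - W s w) => y; rewrite ger0_norm ?sqr_ge0//.
have -> : expR ((2 * c + 1) * y) + expR ((2 * c - 1) * y) =
    expR (c * y) ^+ 2 * (expR y + expR (- y)).
  by rewrite -expRM_natl mulrDr -!expRD; congr (expR _ + expR _); ring.
rewrite exprMn mulrC ler_wpM2l ?sqr_ge0//.
by have := expRDN_ge y; lra.
Qed.

Lemma sqint_increment s t : 0 <= s -> s <= t ->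
  sqint P (fun w => W t w - W s w).
Proof.
move=> s0 st; have := sqint_increment_mulexp 0 s0 st; congr sqint.
by apply/funext => w; rewrite mul0r expR0 mulr1.
Qed.

(** By convexity of exp the required value is the slope of a line supporting the moment generating
    function at [c]; [tangent_slope] identifies it with the derivative. *)
Lemma expectation_increment_mulexp s t c : 0 <= s -> s <= t ->
  \int[P]_w ((W t w - W s w) * expR (c * (W t w - W s w))) =
  c * (t - s) * expR (c ^+ 2 * (t - s) / 2).
Proof.
move=> s0 st.
have iDe := sqint_integrable (sqint_increment_mulexp c s0 st).
apply: (tangent_slope (f := fun c => expR (c ^+ 2 * (t - s) / 2)) (a := c)
  (f' := fun x => x * (t - s) * expR (x ^+ 2 * (t - s) / 2))).
  by move=> x; exact: exp_quad_derive.
move=> e.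
have [i1 <-] := increment_mgf (c + e) s0 st.
have [i2 <-] := increment_mgf c s0 st.
rewrite -RintegralB// -RintegralZl//; apply: le_Rintegral => //.
- exact: integrableZr_.
- exact: integrableBr.
move=> w _; move: (W t w - W s w) => y; rewrite mulrDl expRD mulrA.
rewrite -[X in _ <= _ - X]mulr1 -mulrBr mulrC ler_wpM2l ?expR_ge0//.
by have := expR_ge1Dx (e * y); lra.
Qed.

Lemma expectation_increment s t : 0 <= s -> s <= t ->
  \int[P]_w (W t w - W s w) = 0.
Proof.
move=> s0 st; have := expectation_increment_mulexp 0 s0 st; rewrite !mul0r => <-.
by apply: eq_Rintegral => w _; rewrite mul0r expR0 mulr1.
Qed.

Lemma expectation_increment_sqr s t : 0 <= s -> s <= t ->
  \int[P]_w ((W t w - W s w) ^+ 2) <= t - s.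
Proof.
move=> s0 st; have [_ iD2] := sqint_increment s0 st.
set v := \int[P]_w _; set h := t - s.
have h0 : 0 <= h by rewrite /h; lra.
(* [2 + (e y)^2 <= exp (e y) + exp (- e y)], integrated and divided by [e^2] *)
have ev e : 0 < e -> v <= h * expR (e ^+ 2 * h / 2).
  move=> e0.
  have [i1 E1] := increment_mgf e s0 st; have [i2 E2] := increment_mgf (- e) s0 st.
  rewrite -/h in E1 E2.
  have : 2 + e ^+ 2 * v <= expR (e ^+ 2 * h / 2) + expR ((- e) ^+ 2 * h / 2).
    rewrite -E1 -E2 -RintegralD// -(@probability_Rintegral_cst _ _ _ P 2).
    rewrite -RintegralZl// -RintegralD//; last 2 first.
    - exact: probability_integrable_cst.
    - exact: integrableZr_.
    apply: le_Rintegral => //.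
    - by apply: integrableDr; [exact: probability_integrable_cst|exact: integrableZr_].
    - exact: integrableDr.
    by move=> w _; rewrite -exprMn mulNr; exact: expRDN_ge.
  rewrite sqrrN => h2.
  have := expR_ge1Dx (- (e ^+ 2 * h / 2)); rewrite expRN => h3.
  set z := e ^+ 2 * h / 2 in h2 h3 *.
  have h4 : expR z - 1 <= z * expR z.
    have : (1 - z) * expR z <= 1 by rewrite -ler_pdivlMr ?expR_gt0// mul1r.
    by lra.
  have e2 : 0 < e ^+ 2 by rewrite exprn_gt0.
  rewrite -(ler_pM2l e2) (_ : e ^+ 2 * (h * expR z) = 2 * (z * expR z)); last first.
    by rewrite /z; field.
  by lra.
have cE : expR (e ^+ 2 * h / 2) @[e --> 0^'+] --> (1 : R).
  have : continuous (fun e : R => expR (e ^+ 2 * h / 2)).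
    move=> x; apply/differentiable_continuous/derivable1_diffP.
    exact: (@ex_derive _ _ _ _ _ _ _ (exp_quad_derive h x)).
  move=> /(_ 0) /cvg_at_right_filter; rewrite expr0n/= mul0r mul0r expR0.
  exact.
have : h * expR (e ^+ 2 * h / 2) @[e --> 0^'+] --> h * 1 by exact: cvgMr.
move=> cv; rewrite -[leRHS]mulr1; apply: (cvgr_to_ge cv).
by near=> e; apply: ev; near: e; exact: nbhs_right_gt.
Unshelve. all: by end_near. Qed.

End brownian.

(** * Joint measurability and time integrals of continuous processes *)

Section clamped_paths.
Context (R : realType).

(** Paths are controlled on nonnegative times only. Clamping the time at 0 gives a function
    continuous on the whole line, to which statements about the full topology apply. *)
Lemma continuous_clamp (f : R -> R) : {within `[0, +oo[, continuous f} ->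
  continuous (fun t : R => f (Num.max t 0)).
Proof.
move=> cf t; apply/cvgrPdist_lt => e e0.
have a0 : Num.max t 0 \in `[0, +oo[.
  by rewrite in_itv/= le_max lexx orbT.
have /subspace_continuousP /(_ _ a0) /cvgrPdist_lt /(_ e e0) := cf.
rewrite /prop_near1 /within/= => h.
have cm : (fun s : R => Num.max s 0) @ t --> Num.max t 0.
  by apply: (@continuous_max _ _ id (fun=> 0)); [exact: cvg_id|exact: cvg_cst].
near=> s.
have hs : `[0, +oo[%classic (Num.max s 0) by rewrite /= in_itv/= le_max lexx orbT.
by move: hs; near: s; exact: (cm _ h).
Unshelve. all: by end_near. Qed.

End clamped_paths.

Section joint_measurability.
Context d (Om : measurableType d) (R : realType).

Lemma truncn_scale_cvg (a : R) : 0 <= a ->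
  (Num.truncn (n.+1%:R * a))%:R / n.+1%:R @[n --> \oo] --> a.
Proof.
move=> a0; apply: (@squeeze_cvgr _ _ _ _ (fun n : nat => a - n.+1%:R^-1) (fun=> a)).
- near=> n; have n0 : (0 : R) < n.+1%:R by rewrite ltr0n.
  have /andP[h1 h2] := truncn_itv (mulr_ge0 (ltW n0) a0).
  apply/andP; split; last by rewrite ler_pdivrMr// [a * _]mulrC.
  rewrite ler_pdivlMr// mulrBl mulVf ?gt_eqF// lerBlDr [a * _]mulrC.
  by move: h2; rewrite -[X in _ < X -> _]natr1 => /ltW.
- rewrite -[X in _ --> X]subr0; apply: (@cvgB _ R^o _ _ _ (fun=> a) harmonic).
    exact: cvg_cst.
  exact: cvg_harmonic.
- exact: cvg_cst.
Unshelve. all: by end_near. Qed.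

(* The process is the pointwise limit of its discretizations on the grids of
   mesh [1 / n.+1], which are countably valued in time. *)
Lemma jointly_measurable (Z : R -> Om -> R) :
  (forall t, 0 <= t -> measurable_fun setT (Z t)) -> continuous_paths Z ->
  measurable_fun setT
    (fun z : measurableTypeR R * Om => Z (Num.max z.1 0) z.2).
Proof.
move=> mZ cZ.
pose k (n : nat) (t : R) := Num.truncn (n.+1%:R * Num.max t 0).
apply: (@measurable_fun_cvg _ _ _ setT
   (fun n (z : measurableTypeR R * Om) => Z ((k n z.1)%:R / n.+1%:R) z.2)) => //.
  move=> n _ B mB; rewrite setTI.
  rewrite (_ : _ @^-1` B = \bigcup_i
     ((k n @^-1` [set i]) `*` (Z (i%:R / n.+1%:R) @^-1` B))); last first.
    apply/seteqP; split => [[t w] /= Bz|[t w] [i _ [/= <-]]//].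
    by exists (k n t).
  apply: bigcup_measurable => i _; apply: measurableX.
    rewrite (_ : _ @^-1` _ = (fun t : R => n.+1%:R * Num.max t 0) @^-1` `[i%:R, i.+1%:R[); last first.
      have h (t : R) : 0 <= n.+1%:R * Num.max t 0 :> R.
        by rewrite mulr_ge0// le_max lexx orbT.
      apply/seteqP; split => t /=.
        by move=> <-; rewrite in_itv/=; exact: truncn_itv.
      by rewrite in_itv/= => ti; exact: truncn_def.
    rewrite -[X in measurable X]setTI; apply: measurable_funM => //.
    exact: measurable_maxr.
  rewrite -[X in measurable X]setTI; apply: mZ => //.
move=> [t w] _ /=.
have cc := continuous_clamp (cZ w).
have := truncn_scale_cvg (a := Num.max t 0) ltac:(by rewrite le_max lexx orbT).
move=> /(cvg_comp _ _) /(_ (cc _)).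
rewrite (_ : Num.max (Num.max t 0) 0 = Num.max t 0); last first.
  by apply/max_idPl; rewrite le_max lexx orbT.
apply: cvg_trans; apply: near_eq_cvg; near=> n; rewrite /=.
by congr (Z _ _); apply/max_idPl; rewrite divr_ge0.
Unshelve. all: by end_near. Qed.

End joint_measurability.

Section time_integral.
Context d (Om : measurableType d) (R : realType) (P : probability Om R).
Variable Z : R -> Om -> R.
Hypotheses (mZ : forall t, 0 <= t -> measurable_fun setT (Z t))
  (cZ : continuous_paths Z).
Variables a b : R.
Hypotheses (a0 : 0 <= a) (ab : a <= b).
Local Notation mu := (@lebesgue_measure R).

Let mc : measurable_fun setT
  (fun z : measurableTypeR R * Om => Z (Num.max z.1 0) z.2).
Proof. exact: jointly_measurable. Qed.

Let clampE s : `[a, b]%classic s -> Num.max s 0 = s.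
Proof. by rewrite /= in_itv/= => /andP[h _]; apply/max_idPl; exact: le_trans h. Qed.

Let cZab w : {within `[a, b], continuous (Z ^~ w)}.
Proof.
apply: (continuous_subspaceW _ (@cZ w)) => s /=; rewrite !in_itv/= andbT => /andP[h _].
exact: le_trans h.
Qed.

Lemma path_integrable w : mu.-integrable `[a, b] (EFin \o (Z ^~ w)).
Proof. by apply: continuous_compact_integrable => //; exact: segment_compact. Qed.

Lemma path_sqr_integrable w :
  mu.-integrable `[a, b] (EFin \o (fun s => Z s w ^+ 2)).
Proof.
apply: continuous_compact_integrable; first exact: segment_compact.
by move=> s; apply: (@cvgM R (subspace `[a, b])); exact: cZab.
Qed.

(** Joint measurability is known for the process clamped in time, on the whole product space.
    Integrals over the time interval are rewritten with an indicator and the clamped process so that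
    Tonelli applies. *)
Let indE (f : R -> R) : (\int[mu]_(s in `[a, b]) (f s)%:E =
  \int[mu]_s (\1_(`[a, b]) s * f s)%:E)%E.
Proof.
rewrite integral_mkcond; apply: eq_integral => s _; rewrite patchE indicE.
by case: ifP => _; rewrite ?mul1r ?mul0r.
Qed.

Let indcE (f : R -> R) (g : R -> R) : (forall s, `[a, b]%classic s -> f s = g s) ->
  (fun s => (\1_(`[a, b]) s * f s)%:E) = (fun s => (\1_(`[a, b]) s * g s)%:E).
Proof.
move=> h; apply/funext => s; rewrite indicE.
by case: (boolP (s \in _)) => [/set_mem/h->|_]; rewrite ?mul0r.
Qed.

Let m1 : measurable_fun setT
  (fun z : measurableTypeR R * Om => \1_(`[a, b]) z.1 : R).
Proof.
apply: (@measurableT_comp _ _ _ _ _ _ (\1_(`[a, b]) : measurableTypeR R -> R)) => //.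
Qed.

Let m2 : measurable_fun setT (fun z : measurableTypeR R * Om =>
  (\1_(`[a, b]) z.1 * Z (Num.max z.1 0) z.2 ^+ 2)%:E).
Proof.
by apply/measurable_EFinP; apply: measurable_funM => //; exact: measurable_funX.
Qed.

Let sq0 z : (0 <= (\1_(`[a, b]) z.1 * Z (Num.max z.1 0) z.2 ^+ 2)%:E)%E.
Proof. by rewrite lee_fin mulr_ge0 ?sqr_ge0// indicE. Qed.

Lemma measurable_path_sqr_integral :
  measurable_fun setT (fun w => \int[mu]_(s in `[a, b]) (Z s w ^+ 2)%:E)%E.
Proof.
have := @measurable_fun_fubini_tonelli_G _ _ _ _ _ mu _ m2 sq0; congr (measurable_fun _ _).
apply/funext => w; rewrite /fubini_G indE.
by congr (integral _ _ _); apply: indcE => s /clampE ->.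
Qed.

Lemma tonelli_path : (\int[P]_w \int[mu]_(s in `[a, b]) (Z s w ^+ 2)%:E =
  \int[mu]_(s in `[a, b]) \int[P]_w (Z s w ^+ 2)%:E)%E.
Proof.
have := @fubini_tonelli _ _ _ _ _ mu P _ m2 sq0 => /= h.
transitivity (\int[P]_w \int[mu]_s
    (\1_(`[a, b]) s * Z (Num.max s 0) w ^+ 2)%:E)%E.
  apply: eq_integral => w _; rewrite indE.
  by congr (integral _ _ _); apply: indcE => s /clampE ->.
rewrite -h [RHS]integral_mkcond; apply: eq_integral => s _; rewrite patchE indicE.
case: ifPn => [/set_mem/clampE ->|_].
  by apply: eq_integral => w _; rewrite mul1r.
by rewrite integral0_eq// => w _; rewrite mul0r.
Qed.

Lemma measurable_sqr_expectation :
  measurable_fun `[a, b] (fun s => \int[P]_w (Z s w ^+ 2)%:E)%E.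
Proof.
apply/(measurable_restrictT _ (measurable_itv _)).
have := @measurable_fun_fubini_tonelli_F _ _ _ _ _ P _ m2 sq0.
congr (measurable_fun _ _); apply/funext => s; rewrite patchE /fubini_F/= indicE.
case: ifPn => [/set_mem/clampE ->|_].
  by apply: eq_integral => w _; rewrite mul1r.
by rewrite integral0_eq// => w _; rewrite mul0r.
Qed.

Lemma measurable_path_integral :
  measurable_fun setT (fun w => \int[mu]_(s in `[a, b]) Z s w).
Proof.
pose f (z : measurableTypeR R * Om) := (\1_(`[a, b]) z.1 * Z (Num.max z.1 0) z.2)%:E.
have mf : measurable_fun setT f.
  by apply/measurable_EFinP; exact: measurable_funM.
have mp := @measurable_fun_fubini_tonelli_G _ _ _ _ _ mu _
    (measurable_funepos mf) (funepos_ge0 f).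
have mn := @measurable_fun_fubini_tonelli_G _ _ _ _ _ mu _
    (measurable_funeneg mf) (funeneg_ge0 f).
have -> : (fun w => \int[mu]_(s in `[a, b]) Z s w) =
    (fun w => fine (fubini_G mu f^\+ w - fubini_G mu f^\- w)).
  apply/funext => w; rewrite /Rintegral indE; congr fine.
  rewrite integralE; congr (_ - _)%E; apply: eq_integral => s _;
    rewrite ?funeposE ?funenegE /f/=;
    congr (maxe _ _); rewrite indicE;
    by case: (boolP (s \in _)) => [/set_mem/clampE ->|_]; rewrite ?mul0r.
apply: measurableT_comp => //; exact: emeasurable_funB.
Qed.

(** Cauchy-Schwarz: the integral of (Z - c)^2 is nonnegative, and c is taken to be the mean of Z
    over the interval. An interval reduced to a point is treated apart. *)
Lemma path_integral_sqr_le w : (\int[mu]_(s in `[a, b]) Z s w) ^+ 2 <=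
  (b - a) * \int[mu]_(s in `[a, b]) (Z s w ^+ 2).
Proof.
set m := \int[mu]_(s in _) _; set q := \int[mu]_(s in _) _.
have i1 := path_integrable w; have i2 := path_sqr_integrable w.
have mab : fine (mu `[a, b]) = b - a.
  rewrite lebesgue_measure_itv/= lte_fin; move: ab.
  by rewrite le_eqVlt => /predU1P[->|->//]; rewrite ltxx subrr.
have h c : 0 <= q - 2 * c * m + c ^+ 2 * (b - a).
  have ic : mu.-integrable `[a, b] (EFin \o (fun=> c ^+ 2)).
    apply: continuous_compact_integrable; first exact: segment_compact.
    by apply: continuous_subspaceT => s; exact: cvg_cst.
  have i3 : mu.-integrable `[a, b] (EFin \o (fun s => 2 * c * Z s w)).
    exact: (integrableZl _ (2 * c) i1).
  rewrite -mab -Rintegral_cst// -RintegralZl// -RintegralB// -RintegralD//.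
    by apply: Rintegral_ge0 => s _; have := sqr_ge0 (Z s w - c); lra.
  exact: (integrableB _ i2 i3).
have [ba|ba] := ltP 0 (b - a); last first.
  have ba0 : b - a = 0 by have := ab; lra.
  rewrite ba0 mul0r; rewrite /m (_ : a = b); last by have := ab; lra.
  by rewrite set_itv1 Rintegral_set1 expr0n.
have := h (m / (b - a)); set L := b - a in ba *.
have -> : q - 2 * (m / L) * m + (m / L) ^+ 2 * L = q - m ^+ 2 / L.
  by field; rewrite gt_eqF.
by rewrite subr_ge0 ler_pdivrMr// mulrC.
Qed.

Hypothesis Zfin : (\int[mu]_(s in `[a, b]) \int[P]_w (Z s w ^+ 2)%:E < +oo)%E.

Lemma path_integral_sqr_expectation :
  (\int[P]_w ((\int[mu]_(s in `[a, b]) Z s w) ^+ 2)%:E <=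
   (b - a)%:E * \int[mu]_(s in `[a, b]) \int[P]_w (Z s w ^+ 2)%:E)%E.
Proof.
rewrite -tonelli_path -ge0_integralZl//; last 3 first.
- exact: measurable_path_sqr_integral.
- by move=> w _; apply: integral_ge0 => s _; rewrite lee_fin sqr_ge0.
- by rewrite lee_fin subr_ge0.
apply: ge0_le_integral => //.
- by move=> w _; rewrite lee_fin sqr_ge0.
- by apply/measurable_EFinP; apply: measurable_funX; exact: measurable_path_integral.
- by apply: measurable_funeM; exact: measurable_path_sqr_integral.
move=> w _; rewrite -[X in (_ * X)%E]fineK; last first.
  by apply: integrable_fin_num => //; exact: path_sqr_integrable.
by rewrite -EFinM lee_fin; exact: path_integral_sqr_le.
Qed.

Lemma sqint_path_integral : sqint P (fun w => \int[mu]_(s in `[a, b]) Z s w).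
Proof.
split; first exact: measurable_path_integral.
apply: (ge0_integrable _ _ path_integral_sqr_expectation).
- by apply: measurable_funX; exact: measurable_path_integral.
- by move=> w; exact: sqr_ge0.
by apply: lte_mul_pinfty => //; rewrite lee_fin subr_ge0.
Qed.

(** Integrability on the product comes from |xi Z| <= xi^2 + Z^2, whose integral is finite by
    [Zfin]. *)
Lemma fubini_path xi : sqint P xi -> (forall t, 0 <= t -> sqint P (Z t)) ->
  \int[P]_w (xi w * \int[mu]_(s in `[a, b]) Z s w) =
  \int[mu]_(s in `[a, b]) \int[P]_w (xi w * Z s w).
Proof.
move=> xi2 Z2.
have mx : measurable_fun setT (fun z : measurableTypeR R * Om => xi z.2).
  by apply: (measurableT_comp xi2.1); exact: measurable_snd.
pose f (z : measurableTypeR R * Om) :=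
  (\1_(`[a, b]) z.1 * (xi z.2 * Z (Num.max z.1 0) z.2))%:E.
have mf : measurable_fun setT f.
  by apply/measurable_EFinP; apply: measurable_funM => //; exact: measurable_funM.
have ifub : (mu \x P)%E.-integrable setT f.
  apply/integrable21ltyP => //.
  have mg : measurable_fun setT (fun w => ((b - a) * xi w ^+ 2)%:E +
      \int[mu]_(s in `[a, b]) (Z s w ^+ 2)%:E)%E.
    apply: emeasurable_funD; last exact: measurable_path_sqr_integral.
    apply/measurable_EFinP; apply: measurable_funM => //.
    exact: (measurable_funX _ xi2.1).
  have g0 w : (0 <= \int[mu]_(s in `[a, b]) (Z s w ^+ 2)%:E)%E.
    by apply: integral_ge0 => s _; rewrite lee_fin sqr_ge0.
  have k0 w : 0 <= (b - a) * xi w ^+ 2 by rewrite mulr_ge0 ?sqr_ge0 ?subr_ge0.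
  apply: (@le_lt_trans _ _ (\int[P]_w (((b - a) * xi w ^+ 2)%:E +
      \int[mu]_(s in `[a, b]) (Z s w ^+ 2)%:E))%E).
    apply: ge0_le_integral => //.
    - by move=> w _; exact: integral_ge0.
    - apply: (@measurable_fun_fubini_tonelli_G _ _ _ _ _ mu (abse \o f)).
        exact: measurableT_comp.
      by move=> z; exact: abse_ge0.
    move=> w _; have -> : ((b - a) * xi w ^+ 2)%:E =
        (\int[mu]_(s in `[a, b]) (xi w ^+ 2)%:E)%E.
      rewrite integral_cst//= lebesgue_measure_itv/= lte_fin; have := ab.
      rewrite le_eqVlt => /predU1P[->|->]; last by rewrite -EFinD -EFinM mulrC.
      by rewrite ltxx subrr mul0r mule0.
    rewrite -ge0_integralD//; [|by move=> s _; rewrite lee_fin sqr_ge0..|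
      by have /measurable_int := path_sqr_integrable w].
    rewrite (indE (fun s => xi w ^+ 2 + Z s w ^+ 2)).
    have -> := indcE (f := fun s => xi w ^+ 2 + Z s w ^+ 2)
      (g := fun s => xi w ^+ 2 + Z (Num.max s 0) w ^+ 2)
      (fun s hs => congr1 (fun r => xi w ^+ 2 + Z r w ^+ 2) (esym (clampE hs))).
    apply: ge0_le_integral => //.
    - apply/measurable_EFinP; apply: measurableT_comp => //.
      apply: (measurable_fun_pair1 (f := fun z => fine (f z)) w).
      by move/measurable_EFinP : mf.
    - apply/measurable_EFinP; apply: measurable_funM => //.
      apply: measurable_funD => //; apply: measurable_funX.
      exact: (measurable_fun_pair1 w mc).
    move=> s _; rewrite lee_fin /f/= normrM ger0_norm ?indicE//.
    by rewrite ler_wpM2l// normrM_le_sqrD.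
  have mk : measurable_fun setT (fun w => ((b - a) * xi w ^+ 2)%:E).
    apply/measurable_EFinP; apply: measurable_funM => //.
    exact: (measurable_funX _ xi2.1).
  rewrite (ge0_integralD _ _ _ mk _ measurable_path_sqr_integral)//; last first.
    by move=> w _; rewrite lee_fin.
  rewrite tonelli_path lte_add_pinfty//.
  by apply: integrable_lty => //; exact: (integrableZr_ (b - a) xi2.2).
have := Fubini ifub => /= h.
rewrite [LHS]/Rintegral [RHS]/Rintegral; congr fine.
transitivity (\int[P]_w \int[mu]_s f (s, w))%E.
  apply: eq_integral => w _; rewrite -RintegralZl//; last exact: path_integrable.
  rewrite /Rintegral fineK; last first.
    by apply: integrable_fin_num => //; exact: (integrableZl _ (xi w) (path_integrable w)).
  rewrite (indE (fun s => xi w * Z s w)).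
  by congr (integral _ _ _); apply: indcE => s /clampE ->.
rewrite -h integral_mkcond; apply: eq_integral => s _; rewrite patchE.
case: ifPn => [sab|nsab]; last first.
  by rewrite integral0_eq// => w _; rewrite /f/= indicE (negbTE nsab) mul0r.
rewrite /Rintegral fineK; last first.
  apply: integrable_fin_num => //; apply: sqintM => //; apply: Z2.
  by move/set_mem : sab; rewrite /= in_itv/= => /andP[+ _]; exact: le_trans.
by apply: eq_integral => w _; rewrite /f/= indicE sab mul1r (clampE (set_mem sab)).
Qed.

End time_integral.

(** * Primitives of exponentials *)

Section calculus.
Context (R : realType).

Lemma is_derive_continuous (f f' : R -> R) :
  (forall x : R, is_derive x 1 f (f' x)) -> continuous f.
Proof.
move=> df x; apply/differentiable_continuous/derivable1_diffP.
exact: (@ex_derive _ _ _ _ _ _ _ (df x)).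
Qed.

Lemma integral_is_derive (F f : R -> R) (a b : R) : a <= b ->
  (forall x : R, is_derive x 1 F (f x)) -> continuous f ->
  (\int[lebesgue_measure]_(r in `[a, b]) (f (r - a))%:E = (F (b - a) - F 0)%:E)%E.
Proof.
move=> + dF cf; rewrite le_eqVlt => /predU1P[->|ab].
  by rewrite set_itv1 integral_set1 subrr subrr.
pose G r := F (r - a).
have dG (r : R) : is_derive r 1 G (f (r - a)).
  have h := dF (r - a).
  have -> : f (r - a) = f (r - a) *: (1 - 0) by rewrite subr0 /GRing.scale/= mulr1.
  apply: (@is_derive1_comp _ F (fun r => r - a)).
have cG := is_derive_continuous dG.
rewrite (@continuous_FTC2 _ _ G)//.
- by rewrite /G subrr EFinB.
- apply: continuous_subspaceT => r.
  apply: (@continuous_comp _ _ _ (fun r => r - a) f); last exact: cf.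
  by apply: (@continuousB _ R^o) => //; exact: cvg_cst.
- split.
  + by move=> r _; exact: (@ex_derive _ _ _ _ _ _ _ (dG r)).
  + exact/cvg_at_right_filter/cG.
  + exact/cvg_at_left_filter/cG.
- by move=> r _; rewrite derive1E (@derive_val _ _ _ _ _ _ _ (dG r)).
Qed.

Lemma Rintegral_is_derive (F f : R -> R) (a b : R) : a <= b ->
  (forall x : R, is_derive x 1 F (f x)) -> continuous f ->
  \int[lebesgue_measure]_(r in `[a, b]) f (r - a) = F (b - a) - F 0.
Proof. by move=> ab dF cf; rewrite /Rintegral (integral_is_derive ab dF cf). Qed.

Lemma is_derive_expRM (k x : R) :
  is_derive x 1 (fun r => expR (k * r)) (k * expR (k * x)).
Proof. by apply: is_derive_eq; rewrite /GRing.scale/= mulr1 mulrC. Qed.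

Lemma continuous_expRM (k : R) : continuous (fun r : R => expR (k * r)).
Proof. exact: is_derive_continuous (is_derive_expRM k). Qed.

(** Stated as an existence so as to include [k = 0], where the quotient (exp(k x) - 1)/k degenerates
    and the primitive is the identity. The moment computations below then need no case distinction
    on the drift. *)
Lemma expRM_primitive (k : R) : exists G : R -> R, [/\ G 0 = 0,
  forall x : R, is_derive x 1 G (expR (k * x)) &
  forall x, k * G x = expR (k * x) - 1].
Proof.
have [->|k0] := eqVneq k 0.
  exists id; split => // x; last by rewrite !mul0r expR0 subrr.
  by rewrite mul0r expR0; exact: is_derive_id.
exists (fun x => (expR (k * x) - 1) / k); split.
- by rewrite mulr0 expR0 subrr mul0r.
- move=> x; apply: is_derive_eq.
  by rewrite /GRing.scale/= subr0 mulr1; field.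
- by move=> x; field.
Qed.

Lemma continuous_itv_integrable (f : R -> R) (a b : R) : continuous f ->
  lebesgue_measure.-integrable `[a, b] (EFin \o (fun r => f (r - a))).
Proof.
move=> cf; apply: continuous_compact_integrable; first exact: segment_compact.
apply: continuous_subspaceT => r.
apply: (@continuous_comp _ _ _ (fun r => r - a) f); last exact: cf.
by apply: (@continuousB _ R^o) => //; exact: cvg_cst.
Qed.

End calculus.

(** * The explicit solution *)

Section explicit_gbm.
Context d (Om : measurableType d) (R : realType) (P : probability Om R).
Variables (F : R -> set (set Om)) (W : R -> Om -> R).
Hypotheses (filtrationF : filtration F) (brownianW : brownian_motion P F W).
Variables mu sigma x : R.
Local Notation leb := (@lebesgue_measure R).

Definition gbm (t : R) (w : Om) : R :=
  x * expR (sigma * W t w + (mu - sigma ^+ 2 / 2) * t).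

Lemma gbm0 w : gbm 0 w = x.
Proof. by case: brownianW => _ _ h _ _; rewrite /gbm h !mulr0 addr0 expR0 mulr1. Qed.

Lemma gbm_adapted t : 0 <= t -> measurable_wrt (F t) (gbm t).
Proof.
move=> t0; apply: (measurable_wrt_comp (f := W t)
  (h := fun y => x * expR (sigma * y + (mu - sigma ^+ 2 / 2) * t))).
  exact: (brownian_adapted brownianW t0).
apply: measurable_funM => //; apply: measurableT_comp => //.
by apply: measurable_funD => //; exact: measurable_funM.
Qed.

Lemma measurable_gbm t : 0 <= t -> measurable_fun setT (gbm t).
Proof. by move=> t0; exact: (filtration_measurable filtrationF t0 (gbm_adapted t0)). Qed.

Lemma gbm_continuous : continuous_paths gbm.
Proof.
case: brownianW => _ cW _ _ _ w t.
apply: (@cvgM R (subspace `[0, +oo[)); first exact: cvg_cst.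
apply: (@cvg_comp _ _ _ _ (@expR R)); last exact: continuous_expR.
apply: (@cvgD R R^o (subspace `[0, +oo[)).
  by apply: (@cvgM R (subspace `[0, +oo[)); [exact: cvg_cst|exact: cW].
apply: (@cvgM R (subspace `[0, +oo[)); first exact: cvg_cst.
by apply: continuous_subspaceT => s; exact: cvg_id.
Qed.

Lemma gbm_split s t w : gbm t w = gbm s w *
  (expR (sigma * (W t w - W s w)) * expR ((mu - sigma ^+ 2 / 2) * (t - s))).
Proof. by rewrite /gbm -mulrA -!expRD; congr (_ * expR _); ring. Qed.

Lemma sqint_gbm t : 0 <= t -> sqint P (gbm t).
Proof.
move=> t0.
have := sqintZ (x * expR ((mu - sigma ^+ 2 / 2) * t))
  (sqint_increment_exp filtrationF brownianW sigma (lexx 0) t0).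
congr sqint; apply/funext => w; rewrite (gbm_split 0 t w) gbm0 subr0.
by ring.
Qed.

Let g s t (y : R) := expR (sigma * y) * expR ((mu - sigma ^+ 2 / 2) * (t - s)).

Let mg s t : measurable_fun setT (g s t).
Proof.
by apply: measurable_funM => //; apply: measurableT_comp => //.
Qed.

Let Eg s t : 0 <= s -> s <= t ->
  P.-integrable setT (EFin \o (fun w => g s t (W t w - W s w))) /\
  \int[P]_w g s t (W t w - W s w) = expR (mu * (t - s)).
Proof.
move=> s0 st; have [i e] := increment_mgf filtrationF brownianW sigma s0 st.
have E : (fun w => g s t (W t w - W s w)) = (fun w =>
    expR ((mu - sigma ^+ 2 / 2) * (t - s)) * expR (sigma * (W t w - W s w))).
  by apply/funext => w; rewrite /g mulrC.
rewrite E; split; first exact: integrableZr_.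
by rewrite RintegralZl// e -expRD; congr expR; field.
Qed.

(** The conditional expectation of the explicit solution given F_s, expressed by testing against
    F_s-measurable weights. The factor between times s and t depends only on the increment of W,
    which is independent of F_s. *)
Lemma gbm_martingale s t psi : 0 <= s -> s <= t -> measurable_wrt (F s) psi ->
  P.-integrable setT (EFin \o (fun w => psi w * gbm s w)) ->
  P.-integrable setT (EFin \o (fun w => psi w * gbm t w)) /\
  \int[P]_w (psi w * gbm t w) =
    expR (mu * (t - s)) * \int[P]_w (psi w * gbm s w).
Proof.
move=> s0 st Fpsi ipsi.
have E : (fun w => psi w * gbm t w) =
    (fun w => (psi w * gbm s w) * g s t (W t w - W s w)).
  by apply/funext => w; rewrite (gbm_split s t w) mulrA.
have [ig eg] := Eg s0 st.
have Fg : measurable_wrt (F s) (fun w => psi w * gbm s w).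
  by apply: measurable_wrtM => //; [exact: (filtration_sigma filtrationF s0)|exact: gbm_adapted].
have [i e] := increment_independent brownianW s0 st Fg ipsi (mg s t) ig.
by rewrite E; split=> //; rewrite e eg mulrC.
Qed.

Lemma gbm_sqr_expectation s t : 0 <= s -> s <= t ->
  \int[P]_w (gbm t w ^+ 2) =
  expR ((2 * mu + sigma ^+ 2) * (t - s)) * \int[P]_w (gbm s w ^+ 2).
Proof.
move=> s0 st.
have [i e] := increment_mgf filtrationF brownianW (2 * sigma) s0 st.
pose h y := expR ((2 * mu - sigma ^+ 2) * (t - s)) * expR (2 * sigma * y).
have mh : measurable_fun setT h.
  by apply: measurable_funM => //; apply: measurableT_comp => //.
have Fg : measurable_wrt (F s) (fun w => gbm s w ^+ 2).
  by apply: measurable_wrtM; [exact: (filtration_sigma filtrationF s0)|exact: gbm_adapted..].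
have [_ e2] := increment_independent brownianW s0 st Fg (sqint_gbm s0).2 mh
  (integrableZr_ _ i).
transitivity (\int[P]_w (gbm s w ^+ 2 * h (W t w - W s w))).
  apply: eq_Rintegral => w _; rewrite (gbm_split s t w) exprMn; congr (_ * _).
  by rewrite /h expr2 -!expRD; congr expR; field.
rewrite e2 mulrC; congr (_ * _).
by rewrite /h RintegralZl// e -expRD; congr expR; field.
Qed.

(** What ought to be the integral of sigma Y dW over [v, u]. Taking it as the residual of the
    equation makes it available before any stochastic integral is. *)
Definition gbm_noise v u w :=
  gbm u w - gbm v w - mu * \int[leb]_(r in `[v, u]) gbm r w.

Lemma gbm_sqr_integral_fin v u : 0 <= v -> v <= u ->
  (\int[leb]_(r in `[v, u]) \int[P]_w (gbm r w ^+ 2)%:E < +oo)%E.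
Proof.
move=> v0 vu.
have [G [_ dG _]] := expRM_primitive (2 * mu + sigma ^+ 2).
have := integral_is_derive vu (F := fun r => (\int[P]_w (gbm v w ^+ 2)) * G r)
  (f := fun r => (\int[P]_w (gbm v w ^+ 2)) * expR ((2 * mu + sigma ^+ 2) * r)).
move=> /(_ _ _) h.
have -> : (\int[leb]_(r in `[v, u]) \int[P]_w (gbm r w ^+ 2)%:E =
    \int[leb]_(r in `[v, u]) ((\int[P]_w (gbm v w ^+ 2)) *
      expR ((2 * mu + sigma ^+ 2) * (r - v)))%:E)%E.
  apply: eq_integral => r /set_mem; rewrite /= in_itv/= => /andP[vr _].
  rewrite Rintegral_EFin; last exact: (sqint_gbm (le_trans v0 vr)).2.
  by rewrite (gbm_sqr_expectation v0 vr) mulrC.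
rewrite h ?ltry//.
by move=> r; apply: cvgM; [exact: cvg_cst|exact: continuous_expRM].
Qed.

Let Ypath v u : 0 <= v -> v <= u -> sqint P (fun w => \int[leb]_(r in `[v, u]) gbm r w).
Proof.
move=> v0 vu; apply: sqint_path_integral => //.
- exact: measurable_gbm.
- exact: gbm_continuous.
- exact: gbm_sqr_integral_fin.
Qed.

Lemma sqint_noise v u : 0 <= v -> v <= u -> sqint P (gbm_noise v u).
Proof.
move=> v0 vu; apply: sqintB; last by apply: sqintZ; exact: Ypath.
by apply: sqintB; apply: sqint_gbm => //; exact: le_trans vu.
Qed.

Lemma noise_adapted v u : 0 <= v -> v <= u -> measurable_wrt (F u) (gbm_noise v u).
Proof.
move=> v0 vu; have u0 := le_trans v0 vu.
have sF := filtration_sigma filtrationF u0.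
apply: measurable_wrtB => //.
  apply: measurable_wrtB => //; first exact: gbm_adapted.
  by apply: (filtration_le filtrationF v0 vu); exact: gbm_adapted.
apply: (measurable_wrt_comp
  (f := fun w => \int[leb]_(r in `[v, u]) gbm r w) (h := fun y => mu * y)); last exact: measurable_funM.
apply/(measurable_wrtP _ sF).
pose Z r := gbm (Num.max (Num.min r u) 0).
rewrite (_ : (fun w => _) = (fun w => \int[leb]_(r in `[v, u]) Z r w)); last first.
  apply/funext => w; apply: eq_Rintegral => r /set_mem; rewrite /= in_itv/= => /andP[vr ru].
  by rewrite /Z (min_idPl ru) (max_idPl _)//; exact: le_trans vr.
apply: (@measurable_path_integral _ (g_sigma_algebraType (F u)) R Z _ _ v u v0).
- move=> t t0; apply/(measurable_wrtP _ sF).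
  have m0 : 0 <= Num.max (Num.min t u) 0 by rewrite le_max lexx orbT.
  apply: (filtration_le filtrationF m0); last exact: gbm_adapted.
  by rewrite ge_max u0 ge_min lexx orbT.
- move=> w; apply: continuous_subspaceT => t.
  have c := continuous_clamp (@gbm_continuous w).
  have cm : (fun s : R => Num.min s u) @ t --> Num.min t u.
    by apply: (@continuous_min _ _ id (fun=> u)); [exact: cvg_id|exact: cvg_cst].
  exact: (cvg_comp _ _ cm (c _)).
Qed.

Lemma noise_expectation v u xi : 0 <= v -> v <= u -> sqint P xi ->
  \int[P]_w (xi w * gbm_noise v u w) =
  \int[P]_w (xi w * gbm u w) - \int[P]_w (xi w * gbm v w) -
  mu * \int[leb]_(r in `[v, u]) \int[P]_w (xi w * gbm r w).
Proof.
move=> v0 vu xi2; have u0 := le_trans v0 vu.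
have iY r : 0 <= r -> P.-integrable setT (EFin \o (fun w => xi w * gbm r w)).
  by move=> r0; apply: sqintM => //; exact: sqint_gbm.
have iT := sqintM xi2 (Ypath v0 vu).
have -> : (fun w => xi w * gbm_noise v u w) = (fun w =>
    (xi w * gbm u w - xi w * gbm v w) -
    mu * (xi w * \int[leb]_(r in `[v, u]) gbm r w)).
  by apply/funext => w; rewrite /gbm_noise; ring.
rewrite RintegralB//; [|exact: integrableBr (iY _ u0) (iY _ v0)|exact: integrableZr_].
rewrite RintegralB//; [|exact: iY..].
by rewrite RintegralZl// (fubini_path measurable_gbm gbm_continuous v0 vu
  (gbm_sqr_integral_fin v0 vu) xi2 sqint_gbm).
Qed.

(** The residual is a martingale increment: against an F_v-measurable weight the solution has
    expectation k exp(mu (r - v)) at time r, and this function of r solves the deterministic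
    equation exactly. *)
Lemma noise_orthogonal v u psi : 0 <= v -> v <= u -> measurable_wrt (F v) psi ->
  sqint P psi -> \int[P]_w (psi w * gbm_noise v u w) = 0.
Proof.
move=> v0 vu Fpsi psi2; rewrite noise_expectation//.
have iY : P.-integrable setT (EFin \o (fun w => psi w * gbm v w)).
  by apply: sqintM => //; exact: sqint_gbm.
have [_ ->] := gbm_martingale v0 vu Fpsi iY.
set k := \int[P]_w (psi w * gbm v w).
have [G [G0 dG Gmu]] := expRM_primitive mu.
have -> : \int[leb]_(r in `[v, u]) \int[P]_w (psi w * gbm r w) =
    \int[leb]_(r in `[v, u]) ((fun r => k * expR (mu * r)) (r - v)).
  apply: eq_Rintegral => r /set_mem; rewrite /= in_itv/= => /andP[vr ru].
  by have [_ ->] := gbm_martingale v0 vr Fpsi iY; rewrite mulrC.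
have ck : continuous (fun r => k * expR (mu * r)).
  by move=> r; apply: cvgM; [exact: cvg_cst|exact: continuous_expRM].
rewrite (Rintegral_is_derive (F := fun r => k * G r) vu _ ck).
by rewrite G0 mulr0 subr0 mulrCA Gmu; ring.
Qed.

Lemma noise_split v r u w : 0 <= v -> v <= r -> r <= u ->
  gbm_noise v u w = gbm_noise v r w + gbm_noise r u w.
Proof.
move=> v0 vr ru; rewrite /gbm_noise.
have iY : leb.-integrable `[v, u] (EFin \o (gbm ^~ w)).
  by apply: path_integrable v0 w; exact: gbm_continuous.
have := Rintegral_itvB iY (x := r); rewrite !bnd_simp => /(_ vr ru).
rewrite Rintegral_itv_obnd_cbnd; last first.
  apply: integrableS iY => // t /=; rewrite !in_itv/= => /andP[rt ->].
  by rewrite andbT (le_trans vr)// ltW.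
by move=> <-; ring.
Qed.

Section increment_step.
Variables (v u : R) (phi : Om -> R) (M : R).
Hypotheses (v0 : 0 <= v) (vu : v <= u) (Fphi : measurable_wrt (F v) phi)
  (phiM : forall w, `|phi w| <= M).
Let u0 : 0 <= u. Proof. exact: le_trans vu. Qed.
Let sFv := filtration_sigma filtrationF v0.
Let mphi := filtration_measurable filtrationF v0 Fphi.
Let dW w := W u w - W v w.
Let k := \int[P]_w (phi w * gbm v w).
Let m := \int[P]_w (gbm v w ^+ 2).

Let phi2 : sqint P phi. Proof. exact: bounded_sqint mphi phiM. Qed.

Let ikY r : 0 <= r -> P.-integrable setT (EFin \o (fun w => phi w * gbm r w)).
Proof. by move=> r0; apply: sqintM => //; exact: sqint_gbm. Qed.

Let phidW2 : sqint P (fun w => phi w * dW w).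
Proof. by apply: sqint_bM mphi phiM _; exact: (sqint_increment filtrationF brownianW). Qed.

(** The increment of W is cut at r. Its part after r is independent of the past and centred; its
    part before r multiplies the exponential of itself, a moment already computed. *)
Let increment_gbm r : v <= r -> r <= u ->
  \int[P]_w (phi w * dW w * gbm r w) =
  k * sigma * ((r - v) * expR (mu * (r - v))).
Proof.
move=> vr ru; have r0 := le_trans v0 vr.
pose g1 y := expR ((mu - sigma ^+ 2 / 2) * (r - v)) * (y * expR (sigma * y)).
have mg1 : measurable_fun setT g1.
  apply: measurable_funM => //; apply: measurable_funM => //.
  exact: measurableT_comp.
have Fr : measurable_wrt (F r) (fun w => phi w * gbm r w).
  apply: measurable_wrtM; first exact: (filtration_sigma filtrationF r0).
    exact: (filtration_le filtrationF v0 vr Fphi).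
  exact: gbm_adapted.
have Fv : measurable_wrt (F v) (fun w => phi w * gbm v w).
  by apply: measurable_wrtM => //; exact: gbm_adapted.
have ig1 := sqint_integrable (sqint_increment_mulexp filtrationF brownianW sigma v0 vr).
have [i1 e1] := increment_independent brownianW v0 vr Fv (ikY v0) mg1 (integrableZr_ _ ig1).
have iid := sqint_integrable (sqint_increment filtrationF brownianW r0 ru).
have [i2 e2] := increment_independent (g := id) brownianW r0 ru Fr (ikY r0) (@measurable_id _ _ _) iid.
have -> : (fun w => phi w * dW w * gbm r w) = (fun w =>
   phi w * gbm v w * g1 (W r w - W v w) + phi w * gbm r w * id (W u w - W r w)).
  by apply/funext => w; rewrite /g1 /dW/= (gbm_split v r w); ring.
rewrite RintegralD// e1 e2 (expectation_increment filtrationF brownianW r0 ru) mulr0 addr0.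
rewrite RintegralZl// (expectation_increment_mulexp filtrationF brownianW sigma v0 vr).
have -> : expR (mu * (r - v)) = expR ((mu - sigma ^+ 2 / 2) * (r - v)) *
    expR (sigma ^+ 2 * (r - v) / 2).
  by rewrite -expRD; congr expR; field.
by rewrite -/k; ring.
Qed.

Let gbm_expectation r : v <= r ->
  \int[P]_w (phi w * gbm r w) = k * expR (mu * (r - v)).
Proof. by move=> vr; have [_ ->] := gbm_martingale v0 vr Fphi (ikY v0); rewrite mulrC. Qed.

(** The value is the integral over [v, u] of the expectation of phi sigma Y_r, which is what the Ito
    isometry predicts for the covariance. It is obtained by exhibiting a primitive. *)
Let increment_noise (G : R -> R) : G 0 = 0 ->
  (forall r : R, is_derive r 1 G (expR (mu * r))) ->
  \int[P]_w (phi w * dW w * gbm_noise v u w) = k * sigma * G (u - v).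
Proof.
move=> G0 dG; rewrite noise_expectation// !increment_gbm// subrr mul0r mulr0 subr0.
pose f r := k * sigma * (r * expR (mu * r)).
have df (r : R) : is_derive r 1 f (k * sigma * (expR (mu * r) + mu * (r * expR (mu * r)))).
  by apply: is_derive_eq; rewrite /GRing.scale/=; ring.
have cf := is_derive_continuous df.
have -> : \int[leb]_(r in `[v, u]) \int[P]_w (phi w * dW w * gbm r w) =
    \int[leb]_(r in `[v, u]) f (r - v).
  apply: eq_Rintegral => r /set_mem; rewrite /= in_itv/= => /andP[vr ru].
  by rewrite increment_gbm.
rewrite -RintegralZl//; last exact: continuous_itv_integrable.
pose H r := k * sigma * (r * expR (mu * r) - G r).
have dH (r : R) : is_derive r 1 H (mu * f r).
  by apply: is_derive_eq; rewrite /f /GRing.scale/=; ring.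
have cmf : continuous (fun r => mu * f r).
  by move=> r; apply: cvgM; [exact: cvg_cst|exact: cf].
by rewrite (Rintegral_is_derive vu dH cmf) /H G0 mul0r; ring.
Qed.

(** The residual after time r is orthogonal to Y_r, so that only the residual over [v, r]
    contributes. *)
Let noise_gbm (G : R -> R) : G 0 = 0 ->
  (forall r : R, is_derive r 1 G (expR ((mu + sigma ^+ 2) * r))) ->
  (forall r, (mu + sigma ^+ 2) * G r = expR ((mu + sigma ^+ 2) * r) - 1) ->
  forall r, v <= r -> r <= u -> \int[P]_w (gbm_noise v u w * gbm r w) =
    m * sigma ^+ 2 * (expR (mu * (r - v)) * G (r - v)).
Proof.
move=> G0 dG Gk r vr ru; have r0 := le_trans v0 vr.
have Yr := sqint_gbm r0.
have -> : (fun w => gbm_noise v u w * gbm r w) =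
    (fun w => gbm r w * gbm_noise v r w + gbm r w * gbm_noise r u w).
  by apply/funext => w; rewrite (noise_split w v0 vr ru); ring.
rewrite RintegralD//; [|by apply: sqintM => //; exact: sqint_noise..].
rewrite (noise_orthogonal r0 ru (gbm_adapted r0) Yr) addr0 noise_expectation//.
have YY q : v <= q -> q <= r -> \int[P]_w (gbm r w * gbm q w) =
    m * expR (mu * (r - v)) * expR ((mu + sigma ^+ 2) * (q - v)).
  move=> vq qr; have q0 := le_trans v0 vq.
  have iYY : P.-integrable setT (EFin \o (fun w => gbm q w * gbm q w)).
    by apply: sqintM; exact: sqint_gbm.
  transitivity (\int[P]_w (gbm q w * gbm r w)).
    by apply: eq_Rintegral => w _; rewrite mulrC.
  have [_ ->] := gbm_martingale q0 qr (gbm_adapted q0) iYY.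
  rewrite (gbm_sqr_expectation v0 vq) -/m mulrA -expRD.
  rewrite mulrC -mulrA -expRD; congr (_ * expR _); ring.
rewrite !YY// subrr mulr0 expR0 mulr1.
pose e0 := m * expR (mu * (r - v)).
pose f q := e0 * expR ((mu + sigma ^+ 2) * q).
have -> : \int[leb]_(q in `[v, r]) \int[P]_w (gbm r w * gbm q w) =
    \int[leb]_(q in `[v, r]) f (q - v).
  apply: eq_Rintegral => q /set_mem; rewrite /= in_itv/= => /andP[vq qr].
  by rewrite YY.
have df (q : R) : is_derive q 1 (fun q => e0 * G q) (f q).
  by apply: is_derive_eq; rewrite /f /GRing.scale/=; ring.
have cf : continuous f.
  by move=> q; apply: cvgM; [exact: cvg_cst|exact: continuous_expRM].
rewrite (Rintegral_is_derive vr df cf) /e0.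
rewrite G0; have := Gk (r - v); set e := expR ((mu + _) * _) => Ge.
have -> : e = (mu + sigma ^+ 2) * G (r - v) + 1 by rewrite Ge; ring.
by ring.
Qed.

Let noise_sqr (G : R -> R) : G 0 = 0 ->
  (forall r : R, is_derive r 1 G (expR ((2 * mu + sigma ^+ 2) * r))) ->
  \int[P]_w (gbm_noise v u w ^+ 2) = m * sigma ^+ 2 * G (u - v).
Proof.
move=> G0 dG; have [H [H0 dH Hk]] := expRM_primitive (mu + sigma ^+ 2).
have nE := noise_gbm H0 dH Hk.
have -> : (fun w => gbm_noise v u w ^+ 2) =
    (fun w => gbm_noise v u w * gbm_noise v u w) by [].
rewrite noise_expectation//; last exact: sqint_noise.
rewrite !nE// subrr H0 !mulr0 subr0.
pose f r := m * sigma ^+ 2 * (expR (mu * r) * H r).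
have df (r : R) : is_derive r 1 f (mu * f r +
    m * sigma ^+ 2 * expR ((2 * mu + sigma ^+ 2) * r)).
  apply: is_derive_eq; rewrite /GRing.scale/= /f.
  have -> : (2 * mu + sigma ^+ 2) * r = mu * r + (mu + sigma ^+ 2) * r by ring.
  by rewrite expRD; ring.
have cf := is_derive_continuous df.
have -> : \int[leb]_(r in `[v, u]) \int[P]_w (gbm_noise v u w * gbm r w) =
    \int[leb]_(r in `[v, u]) f (r - v).
  apply: eq_Rintegral => r /set_mem; rewrite /= in_itv/= => /andP[vr ru].
  by rewrite nE.
rewrite -RintegralZl//; last exact: continuous_itv_integrable.
pose K r := f r - m * sigma ^+ 2 * G r.
have dK (r : R) : is_derive r 1 K (mu * f r).
  by apply: is_derive_eq; rewrite /f /GRing.scale/=; ring.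
have cmf : continuous (fun r => mu * f r).
  by move=> r; apply: cvgM; [exact: cvg_cst|exact: cf].
by rewrite (Rintegral_is_derive vu dK cmf) /K G0 /f H0; ring.
Qed.

(** The Ito isometry on one interval of constancy. Both sides are explicit in c, k, m and the two
    primitives; they differ only in that the second moment of the increment of W is bounded by u -
    v. *)
Lemma increment_step_le :
  (\int[P]_w ((phi w * dW w - gbm_noise v u w) ^+ 2)%:E <=
   \int[P]_w \int[leb]_(r in `[v, u]) ((phi w - sigma * gbm r w) ^+ 2)%:E)%E.
Proof.
have [G [G0 dG _]] := expRM_primitive mu.
have [H [H0 dH _]] := expRM_primitive (2 * mu + sigma ^+ 2).
have N2 := sqint_noise v0 vu.
pose c := \int[P]_w (phi w ^+ 2).
have mZ t : 0 <= t -> measurable_fun setT (fun w => phi w - sigma * gbm t w).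
  move=> t0; apply: measurable_funB => //; apply: measurable_funM => //.
  exact: measurable_gbm.
have cZ : continuous_paths (fun r w => phi w - sigma * gbm r w).
  move=> w r; apply: (@cvgB R R^o (subspace `[0, +oo[)); first exact: cvg_cst.
  apply: (@cvgM R (subspace `[0, +oo[)); first exact: cvg_cst.
  exact: gbm_continuous.
have tE : (\int[P]_w \int[leb]_(r in `[v, u]) ((phi w - sigma * gbm r w) ^+ 2)%:E =
   (c * (u - v) - 2 * sigma * k * G (u - v) + sigma ^+ 2 * m * H (u - v))%:E)%E.
  rewrite (tonelli_path P mZ cZ u v0).
  pose f r := c - 2 * sigma * k * expR (mu * r) +
    sigma ^+ 2 * m * expR ((2 * mu + sigma ^+ 2) * r).
  transitivity (\int[leb]_(r in `[v, u]) (f (r - v))%:E)%E.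
    apply: eq_integral => r /set_mem; rewrite /= in_itv/= => /andP[vr ru].
    have r0 := le_trans v0 vr.
    have Y2 := sqint_gbm r0.
    rewrite Rintegral_EFin; last exact: (sqintB phi2 (sqintZ sigma Y2)).2.
    congr (_%:E); rewrite /f -/c.
    have -> : (fun w => (phi w - sigma * gbm r w) ^+ 2) = (fun w =>
        phi w ^+ 2 - 2 * sigma * (phi w * gbm r w) + sigma ^+ 2 * gbm r w ^+ 2).
      by apply/funext => w; ring.
    have i1 := integrableZr_ (2 * sigma) (ikY r0).
    rewrite RintegralD//; [|exact: integrableBr phi2.2 i1|exact: integrableZr_ Y2.2].
    rewrite RintegralB//; last exact: phi2.2.
    rewrite RintegralZl//; last exact: ikY.
    rewrite RintegralZl//; last exact: Y2.2.
    rewrite gbm_expectation// (gbm_sqr_expectation v0 vr) -/m -/c; ring.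
  pose K r := c * r - 2 * sigma * k * G r + sigma ^+ 2 * m * H r.
  have dK (r : R) : is_derive r 1 K (f r).
    by apply: is_derive_eq; rewrite /f /GRing.scale/=; ring.
  have cf : continuous f.
    apply: (@is_derive_continuous _ f (fun r => - (2 * sigma * k * (mu * expR (mu * r))) +
      sigma ^+ 2 * m * ((2 * mu + sigma ^+ 2) * expR ((2 * mu + sigma ^+ 2) * r)))).
    by move=> r; apply: is_derive_eq; rewrite /GRing.scale/=; ring.
  by rewrite (integral_is_derive vu dK cf) /K G0 H0; congr (_%:E); ring.
have dW2 := sqint_increment filtrationF brownianW v0 vu.
rewrite tE Rintegral_EFin; last exact: (sqintB phidW2 N2).2.
have Fphi2 : measurable_wrt (F v) (fun w => phi w ^+ 2) by exact: measurable_wrtM.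
have [i1 e1] := increment_independent brownianW v0 vu Fphi2 phi2.2
  (g := fun y => y ^+ 2) (exprn_measurable 2) dW2.2.
have i2 := sqintM phidW2 N2.
have -> : (fun w => (phi w * dW w - gbm_noise v u w) ^+ 2) = (fun w =>
    phi w ^+ 2 * (W u w - W v w) ^+ 2 - 2 * (phi w * dW w * gbm_noise v u w) +
    gbm_noise v u w ^+ 2).
  by apply/funext => w; rewrite /dW; ring.
have i3 := integrableZr_ 2 i2.
rewrite lee_fin RintegralD//; [|exact: integrableBr i1 i3|exact: N2.2].
rewrite RintegralB// e1 RintegralZl// (increment_noise G0 dG) (noise_sqr H0 dH) -/c.
have c0 : 0 <= c by apply: Rintegral_ge0 => w _; exact: sqr_ge0.
have := ler_wpM2l c0 (expectation_increment_sqr filtrationF brownianW v0 vu).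
by lra.
Qed.

End increment_step.

End explicit_gbm.

(** Iterating the hypothesis gives [v t <= C * B * expR (2 * C * t) / 2 ^+ n] for all n: each pass
    integrates exp(2 C s), and C times this integral is at most half of exp(2 C t). *)
Lemma gronwall_zero (R : realType) (v : R -> \bar R) (C T : R) : 0 < C -> 0 <= T ->
  (forall t, (0 <= v t)%E) -> measurable_fun (`[0, T]%classic : set (measurableTypeR R)) v ->
  (\int[lebesgue_measure]_(s in `[0%R, T]) v s < +oo)%E ->
  (forall t, 0 <= t -> t <= T ->
    (v t <= C%:E * \int[lebesgue_measure]_(s in `[0%R, t]) v s)%E) ->
  forall t, 0 <= t -> t <= T -> v t = 0%E.
Proof.
move=> C0 T0 v0 mv vfin vC.
have mvt t : t <= T -> measurable_fun (`[0, t]%classic : set (measurableTypeR R)) v.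
  move=> tT; apply: measurable_funS mv => // s /=; rewrite !in_itv/= => /andP[-> st].
  exact: le_trans tT.
pose B := fine (\int[lebesgue_measure]_(s in `[0%R, T]) v s).
have BE : (\int[lebesgue_measure]_(s in `[0%R, T]) v s = B%:E)%E.
  by rewrite fineK// ge0_fin_numE// integral_ge0.
have B0 : 0 <= B by rewrite fine_ge0// integral_ge0.
have bnd n t : 0 <= t -> t <= T -> (v t <= (C * B * expR (2 * C * t) / 2 ^+ n)%:E)%E.
  elim: n t => [|n IH] t t0 tT.
    apply: (le_trans (vC t t0 tT)); rewrite expr0 divr1.
    apply: (@le_trans _ _ (C * B)%:E).
      rewrite EFinM lee_wpmul2l ?lee_fin ?(ltW C0)// -BE.
      apply: ge0_subset_integral => //.
      by move=> s /=; rewrite !in_itv/= => /andP[-> st]; exact: le_trans tT.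
    rewrite lee_fin ler_peMr ?(mulr_ge0 (ltW C0))//.
    by have := expR_ge1Dx (2 * C * t); have := mulr_ge0 (ltW C0) t0; lra.
  apply: (le_trans (vC t t0 tT)).
  pose f r := C * B / 2 ^+ n * expR (2 * C * r).
  pose G r := C * B / 2 ^+ n / (2 * C) * expR (2 * C * r).
  have dG (r : R) : is_derive r 1 G (f r).
    apply: is_derive_eq; rewrite /f /GRing.scale/= !mulr1.
    by field; rewrite gt_eqF//= gt_eqF// exprn_gt0.
  have cf : continuous f.
    by move=> r; apply: cvgM; [exact: cvg_cst|exact: continuous_expRM].
  apply: (@le_trans _ _ (C%:E * \int[lebesgue_measure]_(s in `[0%R, t]) (f (s - 0))%:E)%E).
    rewrite lee_wpmul2l ?lee_fin ?(ltW C0)//; apply: ge0_le_integral => //.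
    - exact: mvt.
    - apply/measurable_EFinP; apply: measurable_funTS; apply: continuous_measurable_fun.
      by under eq_fun do rewrite subr0.
    move=> s /=; rewrite in_itv/= => /andP[s0 st].
    apply: (le_trans (IH s s0 (le_trans st tT))); rewrite subr0 lee_fin /f.
    by rewrite mulrAC.
  rewrite (integral_is_derive t0 dG cf) -EFinM lee_fin subr0 /G.
  rewrite mulr0 expR0 mulr1 exprS.
  have P0 : 0 <= C * B / 2 ^+ n by rewrite divr_ge0 ?exprn_ge0// mulr_ge0// ltW.
  have -> : C * (C * B / 2 ^+ n / (2 * C) * expR (2 * C * t) - C * B / 2 ^+ n / (2 * C)) =
    C * B * expR (2 * C * t) / (2 * 2 ^+ n) - C * B / 2 ^+ n / 2.
    by field; rewrite gt_eqF//= gt_eqF// exprn_gt0.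
  by lra.
move=> t t0 tT; apply/eqP; rewrite eq_le v0 andbT.
have cr : C * B * expR (2 * C * t) * 2^-1 ^+ n @[n --> \oo] --> C * B * expR (2 * C * t) * 0.
  apply: cvgM; first exact: cvg_cst.
  by apply: cvg_expr; rewrite ger0_norm//; lra.
have cv : ((C * B * expR (2 * C * t) / 2 ^+ n)%:E @[n --> \oo] --> 0%E)%E.
  apply: cvg_EFin; first by near=> n.
  by move: cr; rewrite mulr0; under eq_fun do rewrite exprVn.
by apply: (cvge_to_ge cv); near=> n; exact: bnd.
Unshelve. all: by end_near. Qed.

(** * Uniqueness of the solution *)

Section simple_processes.
Context d (Om : measurableType d) (R : realType) (P : probability Om R).
Variables (F : R -> set (set Om)) (W : R -> Om -> R).
Hypotheses (filtrationF : filtration F) (brownianW : brownian_motion P F W).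
Local Notation leb := (@lebesgue_measure R).
Variables (t : R) (phi : simple_process Om R).
Hypothesis phiP : simple_process_on F t phi.
Local Notation n := (sp_size phi).
Local Notation tm := (sp_time phi).

Lemma sp_time_le i j : (i <= j)%N -> (j <= n)%N -> tm i <= tm j.
Proof.
case: phiP => _ _ tS _ _; elim: j => [|j IH]; first by rewrite leqn0 => /eqP ->.
rewrite leq_eqVlt => /predU1P[->//|]; rewrite ltnS => ij jn.
by apply: le_trans (tS j jn); apply: IH => //; exact: ltnW.
Qed.

Lemma sp_time_ge0 i : (i <= n)%N -> 0 <= tm i.
Proof. by case: (phiP) => <- _ _ _ _ ; exact: sp_time_le. Qed.

Lemma simple_value_on i s w : (i < n)%N -> tm i < s -> s <= tm i.+1 ->
  simple_value phi s w = sp_val phi i w.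
Proof.
move=> iN its sti; rewrite /simple_value (bigD1 (Ordinal iN))//=.
rewrite indicE mem_set/=; last by rewrite in_itv/= its.
rewrite mulr1 big1 ?addr0// => j; rewrite -val_eqE/= neq_ltn => ji.
rewrite indicE memNset ?mulr0//= in_itv/= => /andP[js sj].
case/orP: ji => [ji|ij].
  by have := sp_time_le ji (ltnW iN); rewrite leNgt (lt_le_trans its sj).
by have := sp_time_le ij (ltnW (ltn_ord j)); rewrite leNgt (lt_le_trans js sti).
Qed.

Lemma sp_val_bounded : exists M : nat -> R,
  forall i, (i < n)%N -> forall w, `|sp_val phi i w| <= M i.
Proof.
case: phiP => _ _ _ _ b.
have h i : exists M : R, (i < n)%N -> forall w, `|sp_val phi i w| <= M.
  by case: (boolP (i < n)%N) => [/b[M hM]|_]; [exists M|exists 0].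
by have [M hM] := choice h; exists M.
Qed.

Lemma simple_value_bounded : exists M : R, forall s w, `|simple_value phi s w| <= M.
Proof.
have [M hM] := sp_val_bounded; exists (\sum_(i < n) M i) => s w.
rewrite /simple_value (le_trans (ler_norm_sum _ _ _))// ler_sum// => i _.
rewrite normrM (le_trans _ (hM i (ltn_ord i) w))// ler_piMr//.
by rewrite indicE; case: (_ \in _); rewrite ?normr1 ?normr0.
Qed.

Lemma measurable_simple_value w : measurable_fun setT (fun s => simple_value phi s w).
Proof.
by apply: measurable_sum => i; exact: measurable_funM.
Qed.

Section path_decomposition.
Variable Z : R -> Om -> R.
Hypotheses (mZ : forall t, 0 <= t -> measurable_fun setT (Z t))
  (cZ : continuous_paths Z).

Let cZv i : continuous_paths (fun s w => Z s w - sp_val phi i w).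
Proof.
move=> w s; apply: (@cvgB R R^o (subspace `[0, +oo[)); last exact: cvg_cst.
exact: cZ.
Qed.

Let mZv i : (i < n)%N -> forall s, 0 <= s ->
  measurable_fun setT (fun w => Z s w - sp_val phi i w).
Proof.
move=> iN s s0; apply: measurable_funB; first exact: mZ.
case: phiP => _ _ _ m _.
exact: (filtration_measurable filtrationF (sp_time_ge0 (ltnW iN)) (m i iN)).
Qed.

Let mpath i w : (i <= n)%N ->
  measurable_fun (`[0, tm i]%classic : set (measurableTypeR R))
    (fun s => ((Z s w - simple_value phi s w) ^+ 2)%:E).
Proof.
move=> iN; apply/measurable_EFinP; apply: measurable_funX; apply: measurable_funB.
  have /measurable_int/measurable_EFinP := path_integrable cZ (tm i) (lexx 0) w.
  exact.
by apply: measurable_funTS; exact: measurable_simple_value.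
Qed.

Lemma simple_path_integral i w : (i <= n)%N ->
  (\int[leb]_(s in `[0%R, tm i]) ((Z s w - simple_value phi s w) ^+ 2)%:E =
   \sum_(j < i) \int[leb]_(s in `[tm j, tm j.+1]) ((Z s w - sp_val phi j w) ^+ 2)%:E)%E.
Proof.
elim: i => [|i IH] iN.
  by case: (phiP) => -> _ _ _ _; rewrite set_itv1 integral_set1 big_ord0.
rewrite big_ord_recr/= -IH; last exact: ltnW.
have ti := sp_time_ge0 (ltnW iN).
have tii := sp_time_le (leqnSn i) iN.
rewrite (@itv_bndbnd_setU _ _ _ (BRight (tm i))) ?bnd_simp//.
have m := mpath w iN.
rewrite (@itv_bndbnd_setU _ _ _ (BRight (tm i))) ?bnd_simp// in m.
rewrite ge0_integral_setU//.
- congr (_ + _)%E; rewrite -integral_itv_obnd_cbnd.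
    apply: eq_integral => s /set_mem; rewrite /= in_itv/= => /andP[s1 s2].
    by rewrite (simple_value_on w iN s1 s2).
  have /measurable_int := path_sqr_integrable (@cZv i) (tm i.+1) ti w.
  apply: measurable_funS => //= s /=; rewrite !in_itv/= => /andP[s1 ->].
  by rewrite andbT ltW.
- by move=> s _; rewrite lee_fin sqr_ge0.
- apply/disj_setPS => s [/=]; rewrite !in_itv/= => /andP[_ si] /andP[].
  by rewrite ltNge si.
Qed.

Lemma simple_path_integral_total w :
  (\int[leb]_(s in `[0%R, t]) ((Z s w - simple_value phi s w) ^+ 2)%:E =
   \sum_(j < n) \int[leb]_(s in `[tm j, tm j.+1]) ((Z s w - sp_val phi j w) ^+ 2)%:E)%E.
Proof. by case: (phiP) => _ <- _ _ _; exact: simple_path_integral. Qed.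

Let msum j : (j < n)%N -> measurable_fun setT (fun w =>
  \int[leb]_(s in `[tm j, tm j.+1]) ((Z s w - sp_val phi j w) ^+ 2)%:E)%E.
Proof.
move=> jn; apply: (measurable_path_sqr_integral (mZv jn) (@cZv j)).
exact: sp_time_ge0 (ltnW jn).
Qed.

Lemma measurable_simple_path_integral :
  measurable_fun setT
   (fun w => \int[leb]_(s in `[0%R, t]) ((Z s w - simple_value phi s w) ^+ 2)%:E)%E.
Proof.
under eq_fun do rewrite simple_path_integral_total.
by apply: emeasurable_sum => j; exact: msum.
Qed.

Lemma expectation_simple_path_integral :
  (\int[P]_w \int[leb]_(s in `[0%R, t]) ((Z s w - simple_value phi s w) ^+ 2)%:E =
   \sum_(j < n) \int[P]_w
     \int[leb]_(s in `[tm j, tm j.+1]) ((Z s w - sp_val phi j w) ^+ 2)%:E)%E.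
Proof.
under eq_integral do rewrite simple_path_integral_total.
rewrite ge0_integral_sum//.
- by move=> j; exact: msum.
- by move=> j w _; apply: integral_ge0 => s _; rewrite lee_fin sqr_ge0.
Qed.

End path_decomposition.

Variables mu sigma x : R.
Local Notation gbm := (gbm W mu sigma x).
Local Notation gbm_noise := (gbm_noise W mu sigma x).

Lemma sqint_expectationD f g : sqint P f -> sqint P g ->
  \int[P]_w (f w * g w) = 0 ->
  (\int[P]_w ((f w + g w) ^+ 2)%:E =
   \int[P]_w (f w ^+ 2)%:E + \int[P]_w (g w ^+ 2)%:E)%E.
Proof.
move=> f2 g2 fg.
rewrite !Rintegral_EFin; [|exact: g2.2|exact: f2.2|exact: (sqintD f2 g2).2].
rewrite -EFinD; congr (_%:E).
have i := integrableZr_ 2 (sqintM f2 g2).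
have -> : (fun w => (f w + g w) ^+ 2) = (fun w => f w ^+ 2 + 2 * (f w * g w) + g w ^+ 2).
  by apply/funext => w; ring.
rewrite RintegralD//; [|exact: integrableDr f2.2 i|exact: g2.2].
rewrite RintegralD//; last exact: f2.2.
by rewrite RintegralZl ?fg ?mulr0 ?addr0//; exact: sqintM.
Qed.

Let S i w := \sum_(j < i) sp_val phi j w * (W (tm j.+1) w - W (tm j) w).

(** Induction on the number of intervals. The new error, on the interval starting at [tm i], is
    orthogonal to the error accumulated so far, which is F-measurable at time [tm i]; the squared
    errors therefore add up, and each is bounded by [increment_step_le]. *)
Lemma simple_sum_isometry i : (i <= n)%N ->
  [/\ measurable_wrt (F (tm i)) (S i), sqint P (S i) &
  (\int[P]_w ((S i w - gbm_noise 0 (tm i) w) ^+ 2)%:E <=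
   \sum_(j < i) \int[P]_w \int[leb]_(r in `[tm j, tm j.+1])
     ((sp_val phi j w - sigma * gbm r w) ^+ 2)%:E)%E].
Proof.
elim: i => [|i IH] iN.
  have S0 : S 0%N = fun=> 0 by apply/funext => w; rewrite /S big_ord0.
  have t0 : tm 0%N = 0 by case: phiP.
  rewrite S0 t0 big_ord0; split.
  - apply/(measurable_wrtP _ (filtration_sigma filtrationF (lexx 0))).
    exact: measurable_cst.
  - exact: sqint_cst.
  - rewrite integral0_eq// => w _; rewrite /gbm_noise set_itv1 Rintegral_set1.
    by rewrite mulr0 !subrr expr0n.
have [FS S2 IHi] := IH (ltnW iN).
have ti := sp_time_ge0 (ltnW iN); have tii := sp_time_le (leqnSn i) iN.
have tS := sp_time_ge0 iN.
have [M hM] := sp_val_bounded.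
have Fphi : measurable_wrt (F (tm i)) (sp_val phi i) by case: phiP => _ _ _ m _; exact: m.
have mphi := filtration_measurable filtrationF ti Fphi.
have sF := filtration_sigma filtrationF ti.
have dW2 := sqint_increment filtrationF brownianW ti tii.
have pdW2 := sqint_bM mphi (hM i iN) dW2.
have SE w : S i.+1 w = S i w + sp_val phi i w * (W (tm i.+1) w - W (tm i) w).
  by rewrite /S big_ord_recr.
have -> : S i.+1 = fun w => S i w + sp_val phi i w * (W (tm i.+1) w - W (tm i) w).
  exact/funext.
have N0 := sqint_noise filtrationF brownianW mu sigma x (lexx 0) ti.
have N1 := sqint_noise filtrationF brownianW mu sigma x ti tii.
have FN := noise_adapted filtrationF brownianW mu sigma x (lexx 0) ti.
split.
- apply: (measurable_wrtD (filtration_sigma filtrationF tS)).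
    exact: (filtration_le filtrationF ti tii).
  apply: (measurable_wrtM (filtration_sigma filtrationF tS)).
    exact: (filtration_le filtrationF ti tii).
  apply: (measurable_wrtB (filtration_sigma filtrationF tS)).
    exact: (brownian_adapted brownianW tS).
  apply: (filtration_le filtrationF ti tii).
  exact: (brownian_adapted brownianW ti).
- exact: sqintD.
have A2 := sqintB S2 N0; have B2 := sqintB pdW2 N1.
have FA : measurable_wrt (F (tm i)) (fun w => S i w - gbm_noise 0 (tm i) w).
  exact: measurable_wrtB.
rewrite big_ord_recr/=.
have -> : (fun w => ((S i w + sp_val phi i w * (W (tm i.+1) w - W (tm i) w) -
      gbm_noise 0 (tm i.+1) w) ^+ 2)%:E) =
   (fun w => (((S i w - gbm_noise 0 (tm i) w) +
      (sp_val phi i w * (W (tm i.+1) w - W (tm i) w) - gbm_noise (tm i) (tm i.+1) w)) ^+ 2)%:E).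
  apply/funext => w; congr (_%:E); congr (_ ^+ 2).
  by rewrite (noise_split brownianW mu sigma x w (lexx 0) ti tii); ring.
rewrite (sqint_expectationD A2 B2).
  apply: leeD => //.
  exact: (increment_step_le filtrationF brownianW mu sigma x ti tii Fphi (hM i iN)).
have Ap2 := sqint_bM mphi (hM i iN) A2.
have FAp : measurable_wrt (F (tm i)) (fun w => sp_val phi i w * (S i w - gbm_noise 0 (tm i) w)).
  exact: measurable_wrtM.
have [i1 e1] := increment_independent (g := id) brownianW ti tii FAp
  (sqint_integrable Ap2) (@measurable_id _ _ _) (sqint_integrable dW2).
have i2 := sqintM A2 N1.
have -> : (fun w => (S i w - gbm_noise 0 (tm i) w) *
    (sp_val phi i w * (W (tm i.+1) w - W (tm i) w) - gbm_noise (tm i) (tm i.+1) w)) =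
  (fun w => sp_val phi i w * (S i w - gbm_noise 0 (tm i) w) * id (W (tm i.+1) w - W (tm i) w) -
     (S i w - gbm_noise 0 (tm i) w) * gbm_noise (tm i) (tm i.+1) w).
  by apply/funext => w /=; ring.
rewrite RintegralB// e1 (expectation_increment filtrationF brownianW ti tii) mulr0.
by rewrite (noise_orthogonal filtrationF brownianW mu sigma x ti tii FA A2) subrr.
Qed.

Lemma sqint_simple_integral : sqint P (simple_integral W phi).
Proof. by have [_ + _] := simple_sum_isometry (leqnn n). Qed.

Lemma simple_integral_noise_le :
  (\int[P]_w ((simple_integral W phi w - gbm_noise 0 t w) ^+ 2)%:E <=
   \int[P]_w \int[leb]_(s in `[0%R, t]) ((sigma * gbm s w - simple_value phi s w) ^+ 2)%:E)%E.
Proof.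
have mZ s : 0 <= s -> measurable_fun setT (fun w => sigma * gbm s w).
  move=> s0; apply: measurable_funM => //.
  exact: (measurable_gbm filtrationF brownianW).
have cZ : continuous_paths (fun s w => sigma * gbm s w).
  move=> w s; apply: (@cvgM R (subspace `[0, +oo[)); first exact: cvg_cst.
  exact: (gbm_continuous brownianW).
rewrite (expectation_simple_path_integral mZ cZ).
have [_ _] := simple_sum_isometry (leqnn n).
have -> : tm n = t by case: phiP.
move=> /le_trans; apply; apply: lee_sum => j _.
rewrite le_eqVlt; apply/orP; left; apply/eqP.
by apply: eq_integral => w _; apply: eq_integral => r _; congr (_%:E); ring.
Qed.

End simple_processes.

Lemma ge0_integral_lin d (T : measurableType d) (R : realType)
    (m : {measure set T -> \bar R}) (D : set T) (a b : R) (f g : T -> \bar R) :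
  measurable D -> 0 <= a -> 0 <= b -> measurable_fun D f -> measurable_fun D g ->
  (forall x, D x -> 0 <= f x)%E -> (forall x, D x -> 0 <= g x)%E ->
  (\int[m]_(x in D) (a%:E * f x + b%:E * g x) =
   a%:E * \int[m]_(x in D) f x + b%:E * \int[m]_(x in D) g x)%E.
Proof.
move=> mD a0 b0 mf mg f0 g0.
have maf : measurable_fun D (fun x => a%:E * f x)%E by exact: measurable_funeM.
have mbg : measurable_fun D (fun x => b%:E * g x)%E by exact: measurable_funeM.
rewrite (ge0_integralD m mD _ maf _ mbg).
- by rewrite (ge0_integralZl m mD mf f0)// (ge0_integralZl m mD mg g0).
- by move=> x Dx; rewrite mule_ge0 ?f0 ?lee_fin.
- by move=> x Dx; rewrite mule_ge0 ?g0 ?lee_fin.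
Qed.

Lemma integral_sqrD_le d (T : measurableType d) (R : realType)
    (m : {measure set T -> \bar R}) (D : set T) (f g : T -> R) :
  measurable D -> measurable_fun D f -> measurable_fun D g ->
  (\int[m]_(x in D) ((f x + g x) ^+ 2)%:E <=
   2%:E * \int[m]_(x in D) (f x ^+ 2)%:E + 2%:E * \int[m]_(x in D) (g x ^+ 2)%:E)%E.
Proof.
move=> mD mf mg.
have mf2 : measurable_fun D (fun x => (f x ^+ 2)%:E).
  by apply/measurable_EFinP; exact: measurable_funX.
have mg2 : measurable_fun D (fun x => (g x ^+ 2)%:E).
  by apply/measurable_EFinP; exact: measurable_funX.
have f0 x : D x -> (0 <= (f x ^+ 2)%:E)%E by rewrite lee_fin sqr_ge0.
have g0 x : D x -> (0 <= (g x ^+ 2)%:E)%E by rewrite lee_fin sqr_ge0.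
rewrite -(ge0_integral_lin (a := 2) (b := 2) m)//.
apply: ge0_le_integral => //.
- by move=> x _; rewrite lee_fin sqr_ge0.
- by apply/measurable_EFinP; apply: measurable_funX; exact: measurable_funD.
- by apply: emeasurable_funD; exact: measurable_funeM.
- by move=> x _; rewrite -!EFinM -EFinD lee_fin; exact: sqrD_le2.
Qed.

Section identification.
Context d (Om : measurableType d) (R : realType) (P : probability Om R).
Variables (F : R -> set (set Om)) (W : R -> Om -> R).
Hypotheses (filtrationF : filtration F) (brownianW : brownian_motion P F W).
Local Notation leb := (@lebesgue_measure R).
Variables (mu sigma x : R) (X : R -> Om -> R).
Hypotheses (sigma0 : 0 < sigma)
  (gbmX : geometric_brownian_motion P F W mu sigma x X).
Local Notation gbm := (gbm W mu sigma x).
Local Notation gbm_noise := (gbm_noise W mu sigma x).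

Let mX t : 0 <= t -> measurable_fun setT (X t).
Proof.
move=> t0; case: gbmX => aX _ _ _ _.
exact: (filtration_measurable filtrationF t0 (aX t t0)).
Qed.

Let cX : continuous_paths X. Proof. by case: gbmX. Qed.

Let mY := measurable_gbm filtrationF brownianW mu sigma x.
Let cY : continuous_paths gbm. Proof. exact: (gbm_continuous brownianW). Qed.

Let D t w := X t w - gbm t w.

Let mD t : 0 <= t -> measurable_fun setT (D t).
Proof. by move=> t0; apply: measurable_funB; [exact: mX|exact: mY]. Qed.

Let cD : continuous_paths D.
Proof.
by move=> w s; apply: (@cvgB R R^o (subspace `[0, +oo[)); [exact: cX|exact: cY].
Qed.

Let Q t := (\int[P]_w \int[leb]_(s in `[0%R, t]) (D s w ^+ 2)%:E)%E.

Let mQ t : measurable_fun setT (fun w => \int[leb]_(s in `[0%R, t]) (D s w ^+ 2)%:E)%E.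
Proof. exact: (measurable_path_sqr_integral mD cD). Qed.

Let Q0 t : (0 <= Q t)%E.
Proof. by apply: integral_ge0 => w _; apply: integral_ge0 => s _; rewrite lee_fin sqr_ge0. Qed.

Let mpath (Z : R -> Om -> R) (cZ : continuous_paths Z) t w (k : R) :
  measurable_fun (`[0, t]%classic : set (measurableTypeR R)) (fun s => k * Z s w).
Proof.
apply: measurable_funM => //.
by have /measurable_int/measurable_EFinP := path_integrable cZ t (lexx 0) w.
Qed.

Let sqrM_integral t (k : R) (Z : R -> Om -> R) w : continuous_paths Z ->
  (\int[leb]_(s in `[0%R, t]) ((k * Z s w) ^+ 2)%:E =
  (k ^+ 2)%:E * \int[leb]_(s in `[0%R, t]) (Z s w ^+ 2)%:E)%E.
Proof.
move=> cZ; under eq_integral do rewrite exprMn EFinM.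
rewrite ge0_integralZl//.
- by have /measurable_int := path_sqr_integrable cZ t (lexx 0) w.
- by move=> s _; rewrite lee_fin sqr_ge0.
- by rewrite lee_fin sqr_ge0.
Qed.

Section at_time.
Variables (t : R) (phi : simple_process Om R).
Hypotheses (t0 : 0 <= t) (phiP : simple_process_on F t phi).

Let A := (\int[P]_w \int[leb]_(s in `[0%R, t])
  ((sigma * X s w - simple_value phi s w) ^+ 2)%:E)%E.

Let msX : forall s, 0 <= s -> measurable_fun setT (fun w => sigma * X s w).
Proof. by move=> s s0; apply: measurable_funM => //; exact: mX. Qed.

Let csX : continuous_paths (fun s w => sigma * X s w).
Proof.
move=> w s; apply: (@cvgM R (subspace `[0, +oo[)); first exact: cvg_cst.
exact: cX.
Qed.

Let msY : forall s, 0 <= s -> measurable_fun setT (fun w => sigma * gbm s w).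
Proof. by move=> s s0; apply: measurable_funM => //; exact: mY. Qed.

Let csY : continuous_paths (fun s w => sigma * gbm s w).
Proof.
move=> w s; apply: (@cvgM R (subspace `[0, +oo[)); first exact: cvg_cst.
exact: cY.
Qed.

Let mA := measurable_simple_path_integral filtrationF phiP msX csX.
Let mB := measurable_simple_path_integral filtrationF phiP msY csY.

(** A simple process close to sigma X is close to sigma Y up to the difference sigma D, whose
    contribution is left on the right-hand side for Gronwall. *)
Lemma simple_gbm_error :
  (\int[P]_w \int[leb]_(s in `[0%R, t]) ((sigma * gbm s w - simple_value phi s w) ^+ 2)%:E <=
   2%:E * A + (2 * sigma ^+ 2)%:E * Q t)%E.
Proof.
have q0 (Z : R -> Om -> R) w : (0 <= \int[leb]_(s in `[0%R, t]) (Z s w ^+ 2)%:E)%E.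
  by apply: integral_ge0 => s _; rewrite lee_fin sqr_ge0.
have s20 : 0 <= 2 * sigma ^+ 2 by rewrite mulr_ge0// sqr_ge0.
have hA w := q0 (fun s w => sigma * X s w - simple_value phi s w) w.
rewrite /A /Q -(ge0_integral_lin P measurableT (ler0n _ 2) s20 mA (mQ t)
  (fun w _ => hA w) (fun w _ => q0 D w)).
apply: ge0_le_integral => //.
- by move=> w _; exact: (q0 (fun s w => sigma * gbm s w - simple_value phi s w)).
- by apply: emeasurable_funD; exact: measurable_funeM.
move=> w _.
have mphi : measurable_fun (`[0, t]%classic : set (measurableTypeR R))
    (fun s => simple_value phi s w).
  by apply: measurable_funTS; exact: measurable_simple_value.
have := integral_sqrD_le leb (D := `[0, t])
  (f := fun s => sigma * X s w - simple_value phi s w)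
  (g := fun s => (- sigma) * D s w) (measurable_itv _)
  (measurable_funB (mpath cX w sigma) mphi) (mpath cD w (- sigma)).
rewrite (sqrM_integral _ _ _ cD) sqrrN muleA -EFinM.
apply: le_trans; rewrite le_eqVlt; apply/orP; left; apply/eqP.
by apply: eq_integral => s _; congr (_%:E); rewrite /D; ring.
Qed.

(** Gronwall's iteration needs a finite bound to start from, and finiteness of [Q t] provides it. *)
Lemma error_fin : (A < +oo -> Q t < +oo)%E.
Proof.
move=> Afin; have [M hM] := simple_value_bounded phiP.
have q0 (Z : R -> Om -> R) w : (0 <= \int[leb]_(s in `[0%R, t]) (Z s w ^+ 2)%:E)%E.
  by apply: integral_ge0 => s _; rewrite lee_fin sqr_ge0.
have hA w := q0 (fun s w => sigma * X s w - simple_value phi s w) w.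
have mphi w : measurable_fun (`[0, t]%classic : set (measurableTypeR R))
    (fun s => simple_value phi s w).
  by apply: measurable_funTS; exact: measurable_simple_value.
have phi2 w : (\int[leb]_(s in `[0%R, t]) (simple_value phi s w ^+ 2)%:E <= (M ^+ 2 * t)%:E)%E.
  apply: (@le_trans _ _ (\int[leb]_(s in `[0%R, t]) (M ^+ 2)%:E)%E).
    apply: ge0_le_integral => //.
    - by move=> s _; rewrite lee_fin sqr_ge0.
    - by apply/measurable_EFinP; exact: measurable_funX.
    - move=> s _; rewrite lee_fin -real_normK ?num_real// lerXn2r ?nnegrE//.
      exact: le_trans (hM s w).
  rewrite integral_cst//= lebesgue_measure_itv/= lte_fin; move: t0.
  by rewrite le_eqVlt => /predU1P[<-|->]; rewrite ?ltxx ?mulr0 ?mule0// sube0 EFinM.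
(* [sigma X] is within an L^2 error of a bounded process *)
have Xfin : (\int[P]_w \int[leb]_(s in `[0%R, t]) (X s w ^+ 2)%:E < +oo)%E.
  have mX2 := measurable_path_sqr_integral mX cX t (lexx 0).
  have h w : ((sigma ^+ 2)%:E * \int[leb]_(s in `[0%R, t]) (X s w ^+ 2)%:E <=
      2%:E * \int[leb]_(s in `[0%R, t]) ((sigma * X s w - simple_value phi s w) ^+ 2)%:E +
      (2 * M ^+ 2)%:E * t%:E)%E.
    rewrite -(sqrM_integral _ _ _ cX).
    have := integral_sqrD_le leb (D := `[0, t])
      (f := fun s => sigma * X s w - simple_value phi s w)
      (g := fun s => simple_value phi s w) (measurable_itv _)
      (measurable_funB (mpath cX w sigma) (mphi w)) (mphi w).
    under eq_integral do rewrite subrK.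
    move=> /le_trans; apply; apply: leeD => //.
    by rewrite EFinM -muleA lee_wpmul2l// -EFinM.
  have : ((sigma ^+ 2)%:E * \int[P]_w \int[leb]_(s in `[0%R, t]) (X s w ^+ 2)%:E < +oo)%E.
    apply: (@le_lt_trans _ _ (2%:E * A + (2 * M ^+ 2)%:E * \int[P]_w t%:E)%E).
      rewrite -(ge0_integralZl P measurableT mX2 (fun w _ => q0 X w)) ?lee_fin ?sqr_ge0//.
      have M0 : 0 <= 2 * M ^+ 2 by rewrite mulr_ge0// sqr_ge0.
      rewrite /A -(ge0_integral_lin P measurableT (ler0n _ 2) M0 mA (measurable_cst t%:E)
        (fun w _ => hA w))//.
      apply: ge0_le_integral => //.
      - by move=> w _; rewrite mule_ge0 ?lee_fin ?sqr_ge0//; exact: q0.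
      - exact: measurable_funeM.
      - by apply: emeasurable_funD; exact: measurable_funeM.
    by rewrite integral_cst//= probability_setT mule1 lte_add_pinfty ?ltry// lte_mul_pinfty.
  have s2 : 0 < sigma ^+ 2 by rewrite exprn_gt0.
  set z := (\int[P]_w _)%E; have z0 : (0 <= z)%E by apply: integral_ge0.
  case: z z0 => [r||]//= _; first by rewrite !ltry.
  by rewrite mulry gtr0_sg// mul1e ltxx.
have Yfin := gbm_sqr_integral_fin filtrationF brownianW mu sigma x (lexx 0) t0.
rewrite -(tonelli_path P mY cY t (lexx 0)) in Yfin.
apply: (@le_lt_trans _ _ (2%:E * \int[P]_w \int[leb]_(s in `[0%R, t]) (X s w ^+ 2)%:E +
   2%:E * \int[P]_w \int[leb]_(s in `[0%R, t]) (gbm s w ^+ 2)%:E)%E); last first.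
  by rewrite lte_add_pinfty// lte_mul_pinfty.
have mX2 := measurable_path_sqr_integral mX cX t (lexx 0).
have mY2 := measurable_path_sqr_integral mY cY t (lexx 0).
rewrite /Q -(ge0_integral_lin P measurableT (ler0n _ 2) (ler0n _ 2) mX2 mY2
  (fun w _ => q0 X w) (fun w _ => q0 gbm w)).
apply: ge0_le_integral => //.
  by apply: emeasurable_funD; exact: measurable_funeM.
move=> w _; have := integral_sqrD_le leb (D := `[0, t]) (measurable_itv _)
   (mpath cX w 1) (mpath cY w (- 1)).
rewrite (sqrM_integral _ _ _ cX) (sqrM_integral _ _ _ cY) sqrrN expr1n !mul1e.
by under eq_integral do rewrite mul1r mulN1r.
Qed.

Variable I : Om -> R.
Hypothesis mI : measurable_fun setT I.

(** The simple integral is inserted between the Ito integral of sigma X and the residual of the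
    explicit solution; the isometry bounds its distance to the latter. *)
Lemma ito_noise_error :
  (\int[P]_w ((I w - gbm_noise 0 t w) ^+ 2)%:E <=
   2%:E * \int[P]_w ((I w - simple_integral W phi w) ^+ 2)%:E +
   2%:E * (2%:E * A + (2 * sigma ^+ 2)%:E * Q t))%E.
Proof.
have mS := (sqint_simple_integral filtrationF brownianW phiP mu sigma x).1.
have mN := (sqint_noise filtrationF brownianW mu sigma x (lexx 0) t0).1.
have := integral_sqrD_le P measurableT (measurable_funB mI mS) (measurable_funB mS mN).
under eq_integral do rewrite /= addrA subrK.
move=> /le_trans; apply; apply: leeD => //; rewrite lee_wpmul2l//.
apply: (le_trans _ simple_gbm_error).
exact: (simple_integral_noise_le filtrationF brownianW phiP).
Qed.

End at_time.

Let v s := (\int[P]_w (D s w ^+ 2)%:E)%E.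

Let QE t : Q t = (\int[leb]_(s in `[0%R, t]) v s)%E.
Proof. exact: (tonelli_path P mD cD). Qed.

(** Along the approximating sequence the errors vanish and leave [4 * sigma ^+ 2 * Q t] for the
    squared distance between the stochastic terms. Both processes solve the equation, so D is mu
    times its own integral plus that distance; (a + b)^2 <= 2 a^2 + 2 b^2 and Cauchy-Schwarz in time
    give the constants. *)
Lemma difference_growth t : 0 <= t ->
  (Q t < +oo)%E /\ (v t <= (2 * mu ^+ 2 * t + 8 * sigma ^+ 2)%:E * Q t)%E.
Proof.
move=> t0; case: gbmX => _ _ _ X0 /(_ t t0)[I [mI [phi [phiP c1 c2]]] XE].
have Qfin : (Q t < +oo)%E.
  have [k _ hk] : \forall k \near \oo, (\int[P]_w \int[leb]_(s in `[0%R, t])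
      ((sigma * X s w - simple_value (phi k) s w) ^+ 2)%:E < 1)%E.
    by apply: (c1 (fun u => u < 1)%E); apply: open_ereal_lt'; exact: lte01.
  apply: (error_fin t0 (phiP k)).
  by apply: (lt_trans (hk k (leqnn k))); rewrite ltry.
split => //.
have Qnum : Q t \is a fin_num by rewrite ge0_fin_numE.
have IN : (\int[P]_w ((I w - gbm_noise 0 t w) ^+ 2)%:E <= (4 * sigma ^+ 2)%:E * Q t)%E.
  have cv : (2%:E * \int[P]_w ((I w - simple_integral W (phi k) w) ^+ 2)%:E +
     2%:E * (2%:E * (\int[P]_w \int[leb]_(s in `[0%R, t])
       ((sigma * X s w - simple_value (phi k) s w) ^+ 2)%:E) + (2 * sigma ^+ 2)%:E * Q t)
     @[k --> \oo] --> 2%:E * 0 + 2%:E * (2%:E * 0 + (2 * sigma ^+ 2)%:E * Q t))%E.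
    apply: cvgeD; first by rewrite mule0 fin_num_adde_defr.
      by apply: cvgeMl.
    apply: cvgeMl => //; apply: cvgeD; last exact: cvg_cst.
      by rewrite mule0 fin_num_adde_defr.
    by apply: cvgeMl.
  move: cv; rewrite !mule0 !add0e muleA -EFinM => cv.
  rewrite (_ : 4 * sigma ^+ 2 = 2 * (2 * sigma ^+ 2)); last by ring.
  apply: (cvge_to_ge cv); apply: nearW => k.
  exact: (ito_noise_error t0 (phiP k) mI).
have mN := (sqint_noise filtrationF brownianW mu sigma x (lexx 0) t0).1.
have mDt := measurable_path_integral mD cD t (lexx 0).
pose E w := mu * (\int[leb]_(s in `[0, t]) D s w) + (I w - gbm_noise 0 t w).
have mE1 : measurable_fun setT (fun w => mu * (\int[leb]_(s in `[0, t]) D s w)).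
  exact: measurable_funM.
have DE : {ae P, forall w, D t w = E w}.
  apply: filterS XE => w XtE; rewrite /D /E XtE /gbm_noise (gbm0 brownianW).
  have iX : leb.-integrable `[0, t] (EFin \o (fun s => X s w)).
    exact: (path_integrable cX).
  have iY : leb.-integrable `[0, t] (EFin \o (fun s => gbm s w)).
    exact: (path_integrable cY).
  by rewrite RintegralZl// RintegralB//; ring.
have -> : v t = (\int[P]_w (E w ^+ 2)%:E)%E.
  apply: ge0_ae_eq_integral => //.
  - by apply/measurable_EFinP; apply: measurable_funX; exact: mD.
  - apply/measurable_EFinP; apply: measurable_funX; apply: measurable_funD => //.
    exact: measurable_funB.
  - by move=> w _; rewrite lee_fin sqr_ge0.
  - by move=> w _; rewrite lee_fin sqr_ge0.
  - by apply: filterS DE => w -> _.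
apply: (le_trans (integral_sqrD_le P measurableT mE1 (measurable_funB mI mN))).
have h1 : (\int[P]_w ((mu * \int[leb]_(s in `[0, t]) D s w) ^+ 2)%:E <=
    (mu ^+ 2 * t)%:E * Q t)%E.
  under eq_integral do rewrite exprMn EFinM.
  have mD2 : measurable_fun setT (fun w => ((\int[leb]_(s in `[0, t]) D s w) ^+ 2)%:E).
    by apply/measurable_EFinP; exact: measurable_funX.
  rewrite (ge0_integralZl P measurableT mD2) ?lee_fin ?sqr_ge0//; last first.
    by move=> w _; rewrite lee_fin sqr_ge0.
  rewrite (EFinM (mu ^+ 2) t) -muleA lee_wpmul2l ?lee_fin ?sqr_ge0//.
  have := path_integral_sqr_expectation P mD cD (lexx 0) t0.
  by rewrite subr0 QE.
apply: (@le_trans _ _ (2%:E * ((mu ^+ 2 * t)%:E * Q t) + 2%:E * ((4 * sigma ^+ 2)%:E * Q t))%E).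
  by apply: leeD; rewrite lee_wpmul2l.
rewrite !muleA -!EFinM -(fineK Qnum) -!EFinM -EFinD lee_fin.
by rewrite le_eqVlt; apply/orP; left; apply/eqP; ring.
Qed.

(** The null set depends on [t]. Identities between expectations at fixed times need no more, and
    pathwise arguments use the continuity of X itself. *)
Lemma gbm_unique t : 0 <= t -> {ae P, forall w, X t w = gbm t w}.
Proof.
move=> t0; have [Qfin _] := difference_growth t0.
have s2 : 0 < sigma ^+ 2 by rewrite exprn_gt0.
have C0 : 0 < 2 * mu ^+ 2 * t + 8 * sigma ^+ 2.
  by have := mulr_ge0 (sqr_ge0 mu) t0; lra.
have v0 s : (0 <= v s)%E by apply: integral_ge0 => w _; rewrite lee_fin sqr_ge0.
have vt : v t = 0%E.
  apply: (gronwall_zero C0 t0 v0 _ _ _ t0 (lexx t)).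
  - by move=> mT B mB; exact: (measurable_sqr_expectation P mD cD (lexx 0) mT mB).
  - by rewrite -QE.
  - move=> s s0 st; apply: (le_trans (difference_growth s0).2).
    rewrite QE lee_wpmul2r ?integral_ge0// lee_fin lerD2r.
    by rewrite ler_wpM2l// mulr_ge0// sqr_ge0.
have mD2 : measurable_fun setT (fun w => (D t w ^+ 2)%:E).
  by apply/measurable_EFinP; apply: measurable_funX; exact: mD.
have : ae_eq P setT (fun w => (D t w ^+ 2)%:E) (cst 0%E).
  apply/(ae_eq_integral_abs P measurableT mD2).
  by under eq_integral do rewrite gee0_abs ?lee_fin ?sqr_ge0//.
apply: filterS => w /(_ Logic.I) [] /eqP; rewrite sqrf_eq0 /D subr_eq0 => /eqP.
exact.
Qed.

End identification.

(** * Exponential martingales of the log-price *)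

Section exponential_martingales.
Context d (Om : measurableType d) (R : realType) (P : probability Om R).
Variables (F : R -> set (set Om)) (W : R -> Om -> R).
Hypotheses (filtrationF : filtration F) (brownianW : brownian_motion P F W).
Variables (mu sigma x : R) (X : R -> Om -> R).
Hypotheses (sigma0 : 0 < sigma) (x0 : 0 < x).
Hypothesis gbmX : geometric_brownian_motion P F W mu sigma x X.

(** Taken from X and not from the explicit solution: continuity and adaptedness then hold for every
    path, and the explicit form enters only almost surely, at fixed times. *)
Definition log_price (t : R) (w : Om) : R := ln (X t w / x).

Definition gbm_exponent (p : R) : R :=
  sigma ^+ 2 / 2 * (p ^+ 2 + 2 * nu mu sigma * p).

Definition exp_process (Y : R -> Om -> R) (g : R -> R) (p t : R) (w : Om) : R :=
  expR (p * Y t w - g p * t).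

Lemma log_price0 w : log_price 0 w = 0.
Proof.
by case: gbmX => _ _ _ h _; rewrite /log_price h divff ?ln1// gt_eqF.
Qed.

Lemma log_priceK t w : 0 <= t -> X t w = x * expR (log_price t w).
Proof.
move=> t0; case: gbmX => _ _ h _ _; have Xt := h t w t0.
by rewrite /log_price lnK ?posrE ?divr_gt0// mulrC divfK// gt_eqF.
Qed.

Lemma log_price_adapted : adapted F log_price.
Proof.
move=> t t0; case: gbmX => h _ _ _ _.
apply: (measurable_wrt_comp (f := X t) (h := fun y => ln (y / x))); first exact: h.
by apply: measurableT_comp => //; exact: measurable_funM.
Qed.

Lemma log_price_continuous : continuous_paths log_price.
Proof.
case: gbmX => _ cX X0 _ _ w; apply/continuous_within_itvcyP.
have /continuous_within_itvcyP[c1 c2] := cX w; split.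
  move=> t t0; apply: (@continuous_comp _ _ _ (fun t => X t w / x) (@ln R)).
    by apply: (@cvgM R R); [exact: c1|exact: cvg_cst].
  by apply: continuous_ln; rewrite divr_gt0// X0// ltW//; move: t0; rewrite in_itv/= andbT.
apply: (@cvg_comp _ _ _ (fun t => X t w / x) (@ln R) _ (nbhs (X 0 w / x))).
  by apply: (@cvgM R R); [exact: c2|exact: cvg_cst].
by apply: continuous_ln; rewrite divr_gt0// X0.
Qed.

Let Mg p t w : R := expR (p * sigma * W t w - (p * sigma) ^+ 2 / 2 * t).

Let Mg_ae p t : 0 <= t ->
  {ae P, forall w, exp_process log_price gbm_exponent p t w = Mg p t w}.
Proof.
move=> t0; apply: filterS (gbm_unique filtrationF brownianW sigma0 gbmX t0) => w e.
rewrite /exp_process /Mg /log_price e /gbm [x * _]mulrC mulfK ?gt_eqF// expRK.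
by congr expR; rewrite /gbm_exponent /nu; field; rewrite gt_eqF.
Qed.

Let Mg_split p s t w : Mg p t w = (expR (- ((p * sigma) ^+ 2 / 2 * (t - s))) * Mg p s w) *
  expR (p * sigma * (W t w - W s w)).
Proof. by rewrite /Mg -!expRD; congr expR; ring. Qed.

Let mM p t : 0 <= t -> measurable_fun setT (exp_process log_price gbm_exponent p t).
Proof.
move=> t0; apply: measurableT_comp => //; apply: measurable_funB => //.
apply: measurable_funM => //.
exact: (filtration_measurable filtrationF t0 (log_price_adapted t0)).
Qed.

Let mMg p t : 0 <= t -> measurable_fun setT (Mg p t).
Proof.
move=> t0; apply: measurableT_comp => //; apply: measurable_funB => //.
by apply: measurable_funM => //; exact: (measurable_brownian filtrationF brownianW t0).
Qed.

Let Mg_wrt p t : 0 <= t -> measurable_wrt (F t) (Mg p t).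
Proof.
move=> t0; apply: (measurable_wrt_comp (f := W t)
  (h := fun y => expR (p * sigma * y - (p * sigma) ^+ 2 / 2 * t))).
  exact: (brownian_adapted brownianW t0).
by apply: measurableT_comp => //; apply: measurable_funB => //; exact: measurable_funM.
Qed.

Let Mg_step p s t xi : 0 <= s -> s <= t -> measurable_wrt (F s) xi ->
  P.-integrable setT (EFin \o (fun w => xi w * Mg p s w)) ->
  P.-integrable setT (EFin \o (fun w => xi w * Mg p t w)) /\
  \int[P]_w (xi w * Mg p t w) = \int[P]_w (xi w * Mg p s w).
Proof.
move=> s0 st Fxi ixi; set k := expR (- ((p * sigma) ^+ 2 / 2 * (t - s))).
have E : (fun w => xi w * Mg p t w) = (fun w => (k * (xi w * Mg p s w)) *
    expR (p * sigma * (W t w - W s w))).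
  by apply/funext => w; rewrite (Mg_split p s t) -/k; ring.
have [ie ee] := increment_mgf filtrationF brownianW (p * sigma) s0 st.
have sF := filtration_sigma filtrationF s0.
have [|||i e] := increment_independent brownianW (xi := fun w => k * (xi w * Mg p s w))
  (g := fun y => expR (p * sigma * y)) s0 st _ _ _ ie.
- apply: (measurable_wrt_comp (f := fun w => xi w * Mg p s w) (h := fun y => k * y)).
    exact: measurable_wrtM (Mg_wrt p s0).
  exact: measurable_funM.
- exact: integrableZr_.
- by apply: measurableT_comp => //; exact: measurable_funM.
rewrite E; split=> //; rewrite e RintegralZl// ee mulrAC -expRD.
by rewrite [X in expR X](_ : _ = 0) ?expR0 ?mul1r//; ring.
Qed.

Let Mg1 p t : 0 <= t ->
  P.-integrable setT (EFin \o Mg p t) /\ \int[P]_w Mg p t w = 1.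
Proof.
move=> t0; have sF := filtration_sigma filtrationF (lexx 0).
have E0 : (fun w => 1 * Mg p 0 w) = fun=> 1.
  case: brownianW => _ _ h _ _.
  by apply/funext => w; rewrite /Mg h !mulr0 subr0 expR0 mulr1.
have [||] := @Mg_step p 0 t (fun=> 1) (lexx 0) t0.
- by apply/(measurable_wrtP _ sF).
- by rewrite E0; exact: probability_integrable_cst.
rewrite E0 probability_Rintegral_cst => i e.
have -> : Mg p t = (fun w => 1 * Mg p t w) by apply/funext => w; rewrite mul1r.
by [].
Qed.

(** The martingale property in weak form. The weights will be the indicators of not yet having
    stopped on a grid. *)
Lemma exp_process_martingale p s t xi : 0 <= s -> s <= t ->
  measurable_wrt (F s) xi -> (forall w, 0 <= xi w <= 1) ->
  \int[P]_w (xi w * exp_process log_price gbm_exponent p t w) =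
  \int[P]_w (xi w * exp_process log_price gbm_exponent p s w).
Proof.
move=> s0 st Fxi xi01; have t0 := le_trans s0 st.
have mxi := filtration_measurable filtrationF s0 Fxi.
have E u : 0 <= u -> \int[P]_w (xi w * exp_process log_price gbm_exponent p u w) =
    \int[P]_w (xi w * Mg p u w).
  move=> u0; rewrite /Rintegral; congr fine; apply: ae_eq_integral => //.
  - by apply/measurable_EFinP; apply: measurable_funM => //; exact: mM.
  - by apply/measurable_EFinP; apply: measurable_funM => //; exact: mMg.
  - by apply: filterS (Mg_ae p u0) => w -> _.
rewrite (E t t0) (E s s0); apply: (Mg_step s0 st Fxi _).2.
apply: integrable_dom (Mg1 p s0).1; first exact/measurable_funM/mMg.
move=> w; have /andP[h0 h1] := xi01 w; have M0 := expR_gt0 (p * sigma * W s w - (p * sigma) ^+ 2 / 2 * s).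
rewrite ger0_norm ?mulr_ge0 ?expR_ge0//.
by apply: ler_piMl => //; exact: ltW.
Qed.

Lemma exp_process_expectation p t : 0 <= t ->
  P.-integrable setT (EFin \o exp_process log_price gbm_exponent p t) /\
  \int[P]_w exp_process log_price gbm_exponent p t w = 1.
Proof.
move=> t0; have [i e] := Mg1 p t0.
have E : (\int[P]_w (exp_process log_price gbm_exponent p t w)%:E = 1)%E.
  rewrite -e -Rintegral_EFin//; apply: ae_eq_integral => //.
  - by apply/measurable_EFinP; exact: mM.
  - by apply/measurable_EFinP; exact: mMg.
  - by apply: filterS (Mg_ae p t0) => w -> _.
split; last by rewrite /Rintegral E.
apply: (ge0_integrable (c := 1%E)); first exact: mM.
- by move=> w; exact: expR_ge0.
- by rewrite E.
- exact: ltry.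
Qed.

End exponential_martingales.

(** * Hitting times *)

Section hitting_times.
Context (R : realType).
Implicit Types (A B C U : set R) (z : R -> R).

(** The quantity [rho] for a single path: the two unfold to the same infimum, over strictly positive
    times. *)
Definition hit A z : \bar R :=
  ereal_inf [set t%:E | t in [set t : R | 0 < t /\ A (z t)]].

Lemma hit_ge0 A z : (0 <= hit A z)%E.
Proof. by apply: le_ereal_inf_tmp => _ [t [t0 _] <-]; rewrite lee_fin ltW. Qed.

Lemma hit_le A z t : 0 < t -> A (z t) -> (hit A z <= t%:E)%E.
Proof. by move=> t0 At; apply: ereal_inf_lbound; exists t. Qed.
Arguments hit_le A z {t}.

Lemma hit_gt A z t : 0 < t -> (t%:E < hit A z)%E -> ~ A (z t).
Proof. by move=> t0 th At; have := hit_le A z t0 At; rewrite leNgt th. Qed.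
Arguments hit_gt A z {t}.

Lemma hit_ltP A z (y : \bar R) : (hit A z < y)%E ->
  exists2 t, 0 < t /\ A (z t) & (t%:E < y)%E.
Proof. by move/ereal_inf_lt => [_ [t At <-] ty]; exists t. Qed.

Lemma hit_subset A B z z' : (forall t, 0 < t -> A (z t) -> B (z' t)) ->
  (hit B z' <= hit A z)%E.
Proof.
move=> AB; apply: ereal_inf_le_tmp => _ [t [t0 At] <-].
by exists t => //; split=> //; exact: AB.
Qed.

Lemma hit_eq A B z z' : (forall t, 0 < t -> A (z t) <-> B (z' t)) ->
  hit A z = hit B z'.
Proof.
by move=> AB; apply/eqP; rewrite eq_le; apply/andP; split;
  apply: hit_subset => t t0; rewrite AB.
Qed.

Lemma hit_dichotomy A z : hit A z = +oo%E \/ exists2 t, 0 <= t & hit A z = t%:E.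
Proof.
have := hit_ge0 A z; case: (hit A z) => [t t0||//]; last by left.
by right; exists t.
Qed.

(** The infimum need not be attained, but points of [A] are visited at times arbitrarily close to
    [t] from above, and continuity carries membership in the closed set to the limit. This includes
    [t = 0]. *)
Lemma hit_closed A C z t : closed C -> A `<=` C ->
  {within `[0, +oo[, continuous z} -> hit A z = t%:E -> C (z t).
Proof.
move=> cC AC /continuous_clamp cz ht; apply: contrapT => nC.
have t0 : 0 <= t by have := hit_ge0 A z; rewrite ht lee_fin.
have oC : open (~` C) by rewrite openC.
have nt : (~` C) (z (Num.max t 0)) by rewrite max_l.
have /nbhs_ballP[e /= e0 eC] : nbhs t ((fun s => z (Num.max s 0)) @^-1` (~` C)).
  by apply: cz; exact: open_nbhs_nbhs.
have : (hit A z < (t + e)%:E)%E by rewrite ht lte_fin; have := e0; lra.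
move=> /hit_ltP[s [s0 As] se].
have ts : t <= s by have := hit_le A z s0 As; rewrite ht lee_fin.
have /eC : ball t e s by rewrite /ball /= ltr_norml; move: se; rewrite lte_fin; lra.
by rewrite /= max_l ?ltW//; apply; exact: AC.
Qed.

(* The time the path, observed at the times [h, 2h, ..., kh], is first seen in [U],
   and [kh] if it is not; written as a sum to make it measurable along with the
   path stopped at this time. *)
Definition alive U z (h : R) (k : nat) : R :=
  \prod_(j < k) \1_(~` U) (z (h * j.+1%:R)).

Definition grid_time U z (h : R) (k : nat) : R :=
  h * \sum_(j < k) alive U z h j.

Lemma alive_cases U z h k :
  [/\ alive U z h k = 1, grid_time U z h k = h * k%:R &
      forall j, (j < k)%N -> ~ U (z (h * j.+1%:R))] \/
  alive U z h k = 0 /\ exists j, [/\ (j < k)%N,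
    grid_time U z h k = h * j.+1%:R, U (z (h * j.+1%:R)) &
    forall i, (i < j)%N -> ~ U (z (h * i.+1%:R))].
Proof.
elim: k => [|k IH].
  by left; rewrite /alive /grid_time !big_ord0 mulr0; split.
rewrite /alive /grid_time !big_ord_recr/= -/(alive U z h k) mulrDr -/(grid_time U z h k).
case: IH => [[-> -> h3]|[-> [j [jk -> h3 h4]]]]; last first.
  by right; rewrite mul0r mulr0 addr0; split=> //; exists j; split=> //; exact: ltnW.
rewrite mul1r mulr1 -[X in _ + X]mulr1 -mulrDr natr1 indicE.
have [Uk|Uk] := pselect (U (z (h * k.+1%:R))).
  right; rewrite memNset//.
  by split=> //; exists k; split.
left; rewrite mem_set//; split=> // j; rewrite ltnS leq_eqVlt => /predU1P[->//|].
exact: h3.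
Qed.

(** Telescoping: a quantity stopped on the grid is a sum of its increments weighted by the
    indicators [alive]. Measurability of stopped quantities and discrete optional stopping both come
    from this identity. *)
Lemma grid_time_step (phi : R -> R) U z h k :
  phi (grid_time U z h k.+1) = phi (grid_time U z h k) +
  alive U z h k * (phi (h * k.+1%:R) - phi (h * k%:R)).
Proof.
have -> : grid_time U z h k.+1 = grid_time U z h k + h * alive U z h k.
  by rewrite /grid_time big_ord_recr/= mulrDr.
case: (alive_cases U z h k) => [[-> -> _]|[-> _]].
  by rewrite mulr1 mul1r -[X in _ + X]mulr1 -mulrDr natr1 addrC subrK.
by rewrite mulr0 mul0r !addr0.
Qed.

Lemma grid_time0 U z h : grid_time U z h 0 = 0.
Proof. by rewrite /grid_time big_ord0 mulr0. Qed.

Lemma alive01 U z h k : 0 <= alive U z h k <= 1.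
Proof. by case: (alive_cases U z h k) => [[-> _ _]|[-> _]]; rewrite ?lexx ler01. Qed.

Definition stop_time U z (t : R) : R := fine (mine (hit U z) t%:E).

Lemma stop_timeE U z t : 0 <= t -> (stop_time U z t)%:E = mine (hit U z) t%:E.
Proof.
move=> t0; rewrite /stop_time fineK//.
case: (hit_dichotomy U z) => [->|[s s0 ->]]; first by rewrite min_r// leey.
by rewrite -EFin_min.
Qed.

Lemma stop_time_ge0 U z t : 0 <= t -> 0 <= stop_time U z t.
Proof.
move=> t0; rewrite -lee_fin stop_timeE// le_min hit_ge0/=.
by rewrite lee_fin.
Qed.

Lemma stop_time_le U z t : 0 <= t -> stop_time U z t <= t.
Proof. by move=> t0; rewrite -lee_fin stop_timeE// ge_min lexx orbT. Qed.

Lemma stop_time_hit U z t s : 0 <= t -> hit U z = s%:E -> s <= t ->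
  stop_time U z t = s.
Proof.
move=> t0 hs st; apply/eqP; rewrite -eqe stop_timeE// hs min_l ?lee_fin//.
Qed.

Lemma stop_time_nohit U z t : 0 <= t -> (t%:E <= hit U z)%E ->
  stop_time U z t = t.
Proof. by move=> t0 th; apply/eqP; rewrite -eqe stop_timeE// min_r. Qed.

Lemma stop_time_notin U z t s : 0 <= t -> 0 < s -> s < stop_time U z t -> ~ U (z s).
Proof.
move=> t0 s0 st; apply: (hit_gt U z) => //.
by rewrite -lte_fin stop_timeE// lt_min in st; case/andP: st.
Qed.

Lemma grid_time_ge0 U z h k : 0 <= h -> 0 <= grid_time U z h k.
Proof.
move=> h0; apply: mulr_ge0 => //; apply: sumr_ge0 => j _.
by case/andP: (alive01 U z h j).
Qed.

Lemma grid_time_le U z h k : 0 <= h -> grid_time U z h k <= h * k%:R.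
Proof.
move=> h0; rewrite ler_wpM2l// -[k in leRHS]card_ord -sum1_card natr_sum.
by apply: ler_sum => j _; case/andP: (alive01 U z h j).
Qed.

(** The grid time is never earlier than the true one. Conversely, shortly after the hitting time
    there is a visit at some s, and since [U] is open the path stays in it around s long enough for
    a fine grid to notice. *)
Lemma grid_time_cvg U z t : open U -> {within `[0, +oo[, continuous z} ->
  0 < t -> grid_time U z (t / n.+1%:R) n.+1 @[n --> \oo] --> stop_time U z t.
Proof.
move=> oU /continuous_clamp cz t0.
have h0 n : 0 < t / n.+1%:R by rewrite divr_gt0.
have lo n : stop_time U z t <= grid_time U z (t / n.+1%:R) n.+1.
  case: (alive_cases U z (t / n.+1%:R) n.+1) => [[_ -> _]|[_ [j [_ -> Uj _]]]].
    by rewrite divfK ?pnatr_eq0//; exact/stop_time_le/ltW.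
  by rewrite -lee_fin (stop_timeE _ _ (ltW t0)) ge_min (hit_le U z)// mulr_gt0.
apply/cvgrPdist_lt => e e0.
have [ht|ht] := leP t%:E (hit U z).
  near=> n; rewrite ltr_norml; have := lo n; rewrite (stop_time_nohit (ltW t0) ht).
  have := grid_time_le U z n.+1 (ltW (h0 n)); rewrite divfK ?pnatr_eq0//.
  by have := e0; lra.
have tau : (stop_time U z t)%:E = hit U z by rewrite (stop_timeE _ _ (ltW t0)) min_l// ltW.
have : (hit U z < (Num.min t (stop_time U z t + e / 2))%:E)%E.
  by rewrite EFin_min lt_min ht/= -tau lte_fin ltrDl divr_gt0.
move=> /hit_ltP[s [s0 Us]]; rewrite lte_fin lt_min => /andP[st se].
have Us' : U (z (Num.max s 0)) by rewrite max_l// ltW.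
have /nbhs_ballP[eta /= eta0 etaU] : nbhs s ((fun s => z (Num.max s 0)) @^-1` U).
  by apply: cz; exact: open_nbhs_nbhs.
have small : \forall n \near \oo, t / n.+1%:R < Num.min eta (e / 2).
  have t_0 : (fun n => t / n.+1%:R) @ \oo --> (0 : R).
    by rewrite -(mulr0 t); apply: cvgM; [exact: cvg_cst|exact: cvg_harmonic].
  have m0 : 0 < Num.min eta (e / 2) by rewrite lt_min eta0/= divr_gt0.
  exact: (cvgr_lt _ t_0 _ m0).
near=> n.
have : t / n.+1%:R < Num.min eta (e / 2) by near: n.
rewrite lt_min; set h := t / n.+1%:R => /andP[hh1 hh2].
pose j := Num.truncn (s / h).
have hh0 : 0 < h := h0 n.
have /andP[j1 j2] : (j%:R <= s / h < j.+1%:R).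
  by apply: truncn_itv; rewrite divr_ge0// ltW.
rewrite ler_pdivlMr// in j1; rewrite ltr_pdivrMr// in j2.
have jn : (j < n.+1)%N.
  rewrite -(ltr_nat R) -(ltr_pM2r hh0); apply: (le_lt_trans j1); apply: (lt_le_trans st).
  by rewrite /h mulrC divfK ?pnatr_eq0.
have jS : j.+1%:R * h = j%:R * h + h by rewrite -natr1 mulrDl mul1r.
have Uj : U (z (h * j.+1%:R)).
  have /etaU : ball s eta (h * j.+1%:R).
    by rewrite /ball/= ltr_norml [h * _]mulrC; have := j1; have := j2; have := jS; have := hh1; lra.
  by rewrite /= max_l// mulr_ge0// ltW.
have up : grid_time U z h n.+1 <= h * j.+1%:R.
  case: (alive_cases U z h n.+1) => [[_ _ /(_ _ jn)]//|[_ [i [_ -> _ hi]]]].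
  rewrite (ler_wpM2l (ltW hh0))// ler_nat ltnS leqNgt; apply/negP => ji.
  exact: (hi _ ji).
rewrite distrC ger0_norm ?subr_ge0 ?lo//.
by rewrite [h * _]mulrC in up; have := up; have := jS; have := j1; have := se; have := hh2; lra.
Unshelve. all: by end_near.
Qed.

(** Were [z t] in [U], so would be [z s] for some positive s slightly before t. Hence at its hitting
    time a path started outside an open set is still outside. *)
Lemma open_first_notin U z t : open U -> {within `[0, +oo[, continuous z} ->
  0 <= t -> ~ U (z 0) -> (forall s, 0 < s -> s < t -> ~ U (z s)) -> ~ U (z t).
Proof.
move=> oU /continuous_clamp cz; rewrite le_eqVlt => /predU1P[<-//|t0] _ nU Ut.
have Ut' : U (z (Num.max t 0)) by rewrite max_l// ltW.
have /nbhs_ballP[e /= e0 eU] : nbhs t ((fun s => z (Num.max s 0)) @^-1` U).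
  by apply: cz; exact: open_nbhs_nbhs.
pose s := Num.max (t / 2) (t - e / 2).
have st : s < t by rewrite /s gt_max; apply/andP; split; have := e0; have := t0; lra.
have s_ge : t / 2 <= s /\ t - e / 2 <= s by rewrite /s; split; rewrite le_max lexx ?orbT.
have s0 : 0 < s by have := s_ge.1; have := t0; lra.
apply: (nU s s0 st).
have : ball t e s by rewrite /ball/= ltr_norml; have := s_ge.2; have := st; have := e0; lra.
by move/eU; rewrite /= max_l// ltW.
Qed.

(** The value 0 on paths that never reach [U] agrees with the limit at infinity of the discounted
    payoff and of exp(-s t) for s > 0. *)
Definition at_hit U z (zeta : R -> R) : R :=
  if hit U z == +oo%E then 0 else zeta (fine (hit U z)).

Lemma at_hitE U z zeta t : hit U z = t%:E -> at_hit U z zeta = zeta t.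
Proof. by rewrite /at_hit => ->. Qed.

Lemma at_hit_oo U z zeta : hit U z = +oo%E -> at_hit U z zeta = 0.
Proof. by rewrite /at_hit => ->. Qed.

Lemma at_hit_cvg U z zeta :
  (if stop_time U z n%:R < n%:R then zeta (stop_time U z n%:R) else 0)
    @[n --> \oo] --> at_hit U z zeta.
Proof.
case: (hit_dichotomy U z) => [h|[t t0 h]].
  rewrite (at_hit_oo _ h); under eq_fun do
    rewrite stop_time_nohit ?h ?leey ?ler0n// ltxx.
  exact: cvg_cst.
rewrite (at_hitE _ h); apply: cvg_near_cst.
near=> n; have tn : t < n%:R by near: n; exact: nbhs_infty_gtr.
by rewrite (stop_time_hit (ler0n _ _) h (ltW tn)) tn.
Unshelve. all: by end_near.
Qed.

End hitting_times.

(** * Limits of expectations and stopped processes *)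

Section fatou_bounds.
Context d (T : measurableType d) (R : realType).

Lemma fatou_le (mu : {measure set T -> \bar R}) (f_ : (T -> R)^nat) (f : T -> R)
    (c : \bar R) :
  (forall n, measurable_fun setT (f_ n)) -> (forall n x, 0 <= f_ n x) ->
  (forall x, f_ n x @[n --> \oo] --> f x) ->
  (forall n, \int[mu]_x (f_ n x)%:E <= c)%E -> (\int[mu]_x (f x)%:E <= c)%E.
Proof.
move=> mf f0 cf fc.
have := @fatou _ _ _ mu setT measurableT (fun n x => (f_ n x)%:E) _ _.
have -> : (\int[mu]_x limn_einf (fun n => (f_ n x)%:E) = \int[mu]_x (f x)%:E)%E.
  apply: eq_integral => x _; apply: (cvg_limn_einf_sup _).1.
  by apply: cvg_EFin; [exact: nearW|exact: cf].
move=> h; apply: (le_trans (h _ _)).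
- by move=> n; exact/measurable_EFinP.
- by move=> n x _; rewrite lee_fin.
rewrite limn_einf_lim; apply: lime_le; first exact: is_cvg_einfs.
apply: nearW => n; rewrite /einfs; apply: ge_ereal_inf.
by exists (\int[mu]_x (f_ n x)%:E)%E => //; exists n => /=.
Qed.

(** Counterpart of [fatou_le]: a lower bound passes to the limit only under a uniform bound, here by
    dominated convergence. *)
Lemma bounded_fatou_ge (P : probability T R) (f_ : (T -> R)^nat) (f : T -> R)
    (L c : R) :
  (forall n, measurable_fun setT (f_ n)) -> (forall n x, 0 <= f_ n x <= L) ->
  (forall x, f_ n x @[n --> \oo] --> f x) ->
  (forall n, c%:E <= \int[P]_x (f_ n x)%:E)%E -> (c%:E <= \int[P]_x (f x)%:E)%E.
Proof.
move=> mf fL cf fc.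
have [|||||_ _ h] := @dominated_convergence _ _ _ P setT measurableT
  (fun n x => (f_ n x)%:E) (fun x => (f x)%:E) (fun=> L%:E).
- by move=> n; exact/measurable_EFinP.
- by apply/measurable_EFinP; exact: (measurable_fun_cvg mf (fun x _ => cf x)).
- by apply: aeW => x _; apply: cvg_EFin; [exact: nearW|exact: cf].
- exact: probability_integrable_cst.
- by apply: aeW => x n _; rewrite lee_fin ger0_norm; case/andP: (fL n x).
by apply: (cvge_to_ge h); exact: nearW.
Qed.

End fatou_bounds.

Section stopped_processes.
Context d (Om : measurableType d) (R : realType).
Variables (F : R -> set (set Om)) (Y : R -> Om -> R) (U : set R).
Hypotheses (filtrationF : filtration F) (aY : adapted F Y) (cY : continuous_paths Y)
  (oU : open U).
Local Notation path w := (fun t => Y t w).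

Lemma alive_adapted h k : 0 <= h ->
  measurable_wrt (F (h * k%:R)) (fun w => alive U (path w) h k).
Proof.
move=> h0; have hk j : 0 <= h * j%:R by rewrite mulr_ge0.
elim: k => [|k IH].
  under eq_fun do rewrite /alive big_ord0.
  by apply/(measurable_wrtP _ (filtration_sigma filtrationF (hk _))).
under eq_fun do rewrite /alive big_ord_recr/= -/(alive U _ h k).
apply: measurable_wrtM; first exact: (filtration_sigma filtrationF (hk _)).
  by apply: (filtration_le filtrationF _ _ IH) => //; rewrite ler_wpM2l// ler_nat.
apply: (measurable_wrt_comp (f := Y _) (h := \1_(~` U))); first exact: aY.
by apply: measurable_indic; apply: measurableC; exact: open_measurable.
Qed.

Let malive h k : 0 <= h -> measurable_fun setT (fun w => alive U (path w) h k).
Proof.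
move=> h0; apply: (filtration_measurable filtrationF _ (alive_adapted k h0)).
by rewrite mulr_ge0.
Qed.

Variable Z : R -> Om -> R.
Hypothesis mZ : forall t, 0 <= t -> measurable_fun setT (Z t).

Lemma measurable_grid h k : 0 <= h ->
  measurable_fun setT (fun w => Z (grid_time U (path w) h k) w).
Proof.
move=> h0; elim: k => [|k IH].
  by under eq_fun do rewrite grid_time0; exact: mZ.
under eq_fun => w do rewrite (grid_time_step (Z^~ w)).
apply: measurable_funD => //; apply: measurable_funM; first exact: malive.
by apply: measurable_funB; apply: mZ; rewrite mulr_ge0.
Qed.

Hypothesis cZ : continuous_paths Z.

Lemma grid_path_cvg t w : 0 < t ->
  Z (grid_time U (path w) (t / n.+1%:R) n.+1) w @[n --> \oo] -->
  Z (stop_time U (path w) t) w.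
Proof.
move=> t0; have cz := continuous_clamp (@cZ w).
have h := cvg_comp _ _ (grid_time_cvg oU (@cY w) t0) (cz (stop_time U (path w) t)).
have s0 : 0 <= stop_time U (path w) t by apply: stop_time_ge0; exact: ltW.
have g0 n : 0 <= grid_time U (path w) (t / n.+1%:R) n.+1.
  by apply: grid_time_ge0; rewrite divr_ge0// ltW.
move: h; rewrite /= (max_l s0); apply: cvg_trans; apply: near_eq_cvg.
by apply: nearW => n /=; rewrite (max_l (g0 n)).
Qed.

Lemma measurable_stopped t : 0 <= t ->
  measurable_fun setT (fun w => Z (stop_time U (path w) t) w).
Proof.
rewrite le_eqVlt => /predU1P[<-|t0].
  under eq_fun => w do rewrite stop_time_nohit ?hit_ge0//.
  exact: mZ.
apply: (@measurable_fun_cvg _ _ _ setT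
  (fun n w => Z (grid_time U (path w) (t / n.+1%:R) n.+1) w)).
  by move=> n; apply: measurable_grid; rewrite divr_ge0// ltW.
by move=> w _; exact: grid_path_cvg.
Qed.

End stopped_processes.

Section hitting_functionals.
Context d (Om : measurableType d) (R : realType).
Variables (F : R -> set (set Om)) (Y : R -> Om -> R) (U : set R).
Hypotheses (filtrationF : filtration F) (aY : adapted F Y) (cY : continuous_paths Y)
  (oU : open U).
Local Notation path w := (fun t => Y t w).

Lemma measurable_stop_time t : 0 <= t ->
  measurable_fun setT (fun w => stop_time U (path w) t).
Proof.
apply: (measurable_stopped filtrationF aY cY oU (Z := fun t _ => t)) => //.
by move=> w; apply: continuous_subspaceT => s; exact: cvg_id.
Qed.

Variable Z : R -> Om -> R.
Hypothesis mZ : forall t, 0 <= t -> measurable_fun setT (Z t).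
Hypothesis cZ : continuous_paths Z.

Lemma measurable_at_hit_trunc n : measurable_fun setT (fun w =>
  if stop_time U (path w) n%:R < n%:R then Z (stop_time U (path w) n%:R) w else 0).
Proof.
apply: measurable_fun_ifT => //.
- by apply: measurable_fun_ltr => //; exact: measurable_stop_time.
- exact: (measurable_stopped filtrationF aY cY oU mZ cZ).
Qed.

Lemma measurable_at_hit : measurable_fun setT (fun w => at_hit U (path w) (Z^~ w)).
Proof.
apply: (@measurable_fun_cvg _ _ _ setT (fun n w =>
    if stop_time U (path w) n%:R < n%:R then Z (stop_time U (path w) n%:R) w else 0)).
  by move=> n; exact: measurable_at_hit_trunc.
by move=> w _; exact: at_hit_cvg.
Qed.

Lemma at_hit_expectation_le (P : probability Om R) (c : \bar R) :
  (forall t w, 0 <= t -> 0 <= Z t w) ->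
  (forall t : R, 0 <= t ->
    (\int[P]_w (Z (stop_time U (path w) t) w)%:E <= c)%E) ->
  (\int[P]_w (at_hit U (path w) (Z^~ w))%:E <= c)%E.
Proof.
move=> Z0 Zc; apply: (fatou_le (f_ := fun n w =>
    if stop_time U (path w) n%:R < n%:R then Z (stop_time U (path w) n%:R) w else 0)).
- by move=> n; exact: measurable_at_hit_trunc.
- by move=> n w; case: ifPn => // _; apply: Z0; exact: stop_time_ge0.
- by move=> w; exact: at_hit_cvg.
move=> n; apply: le_trans (Zc n%:R _) => //.
apply: ge0_le_integral => //.
- by move=> w _; case: ifPn => // _; rewrite lee_fin Z0// stop_time_ge0.
- by apply/measurable_EFinP; exact: measurable_at_hit_trunc.
- by apply/measurable_EFinP; exact: (measurable_stopped filtrationF aY cY oU mZ cZ).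
by move=> w _; rewrite lee_fin; case: ifPn => // _; rewrite Z0// stop_time_ge0.
Qed.

End hitting_functionals.

(** * Optional stopping *)

Section optional_stopping.
Context d (Om : measurableType d) (R : realType) (P : probability Om R).
Variables (F : R -> set (set Om)) (Y : R -> Om -> R) (g : R -> R).
Hypotheses (filtrationF : filtration F) (aY : adapted F Y) (cY : continuous_paths Y).
Hypothesis Y0 : forall w, Y 0 w = 0.
Hypothesis exp1 : forall p t, 0 <= t ->
  P.-integrable setT (EFin \o exp_process Y g p t) /\
  \int[P]_w exp_process Y g p t w = 1.
Hypothesis exp_martingale : forall p s t xi, 0 <= s -> s <= t ->
  measurable_wrt (F s) xi -> (forall w, 0 <= xi w <= 1) ->
  \int[P]_w (xi w * exp_process Y g p t w) = \int[P]_w (xi w * exp_process Y g p s w).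
Hypothesis g_convex : forall p, 2 * g p <= g (2 * p).
Local Notation path w := (fun t => Y t w).
Local Notation M := (exp_process Y g).

Lemma measurable_exp_process p t : 0 <= t -> measurable_fun setT (M p t).
Proof. by move=> t0; exact: integrable_measurable (exp1 p t0).1. Qed.

Lemma exp_process_continuous p : continuous_paths (M p).
Proof.
move=> w t; apply: (@cvg_comp _ _ _ _ (@expR R)); last exact: continuous_expR.
apply: (@cvgB R R^o (subspace `[0, +oo[)).
  by apply: (@cvgM R (subspace `[0, +oo[)); [exact: cvg_cst|exact: (@cY w)].
by apply: continuous_subspaceT => s; apply: (@cvgM R R); [exact: cvg_cst|exact: cvg_id].
Qed.

Lemma exp_process0 p w : M p 0 w = 1.
Proof. by rewrite /exp_process Y0 !mulr0 subr0 expR0. Qed.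

(** Discrete optional stopping: each increment in [grid_time_step] is weighted by an indicator known
    at its left end, hence has zero expectation. *)
Lemma exp_grid_expectation U p h k : open U -> 0 <= h ->
  P.-integrable setT (EFin \o (fun w => M p (grid_time U (path w) h k) w)) /\
  \int[P]_w M p (grid_time U (path w) h k) w = 1.
Proof.
move=> oU h0; elim: k => [|k [i e]].
  under eq_fun do rewrite grid_time0 exp_process0.
  by rewrite probability_Rintegral_cst; split=> //; exact: probability_integrable_cst.
pose a w := alive U (path w) h k.
have hk j : 0 <= h * j%:R by rewrite mulr_ge0.
have hk1 : h * k%:R <= h * k.+1%:R by rewrite ler_wpM2l// ler_nat.
have Fa : measurable_wrt (F (h * k%:R)) a := alive_adapted filtrationF aY oU k h0.
have a01 w : 0 <= a w <= 1 := alive01 U (path w) h k.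
have ia j : P.-integrable setT (EFin \o (fun w => a w * M p (h * j%:R) w)).
  apply: integrable_dom (exp1 p (hk j)).1.
    apply: measurable_funM; last exact: measurable_exp_process.
    exact: (filtration_measurable filtrationF (hk k) Fa).
  move=> w; have /andP[h1 h2] := a01 w.
  by rewrite ger0_norm ?mulr_ge0 ?expR_ge0// ler_piMl// expR_ge0.
have E : (fun w => M p (grid_time U (path w) h k.+1) w) = (fun w =>
    M p (grid_time U (path w) h k) w + (a w * M p (h * k.+1%:R) w - a w * M p (h * k%:R) w)).
  by apply/funext => w; rewrite (grid_time_step (fun t => M p t w)) mulrBr.
rewrite E; split; first exact: (integrableDr i (integrableBr (ia _) (ia _))).
rewrite RintegralD//; last exact: (integrableBr (ia _) (ia _)).
rewrite RintegralB// (exp_martingale _ (hk k) hk1 Fa a01) subrr addr0.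
exact: e.
Qed.

(** The square of the process of exponent p is that of exponent 2 p times exp((g(2 p) - 2 g(p)) s);
    by [g_convex] this factor is largest at the final time. *)
Lemma exp_grid_sqr_le U p h k : open U -> 0 <= h ->
  (\int[P]_w (M p (grid_time U (path w) h k) w ^+ 2)%:E <=
   (expR ((g (2 * p) - 2 * g p) * (h * k%:R)))%:E)%E.
Proof.
move=> oU h0; have [i e] := exp_grid_expectation (2 * p) k oU h0.
set C := expR _.
have mg q := measurable_grid filtrationF aY oU (fun t => @measurable_exp_process q t) k h0.
have -> : C%:E = (\int[P]_w (C%:E * (M (2 * p) (grid_time U (path w) h k) w)%:E))%E.
  rewrite ge0_integralZl ?lee_fin ?expR_ge0//.
  - by rewrite (Rintegral_EFin i) e mule1.
  - by apply/measurable_EFinP; exact: mg.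
  - by move=> w _; rewrite lee_fin expR_ge0.
apply: ge0_le_integral => //.
- by move=> w _; rewrite lee_fin sqr_ge0.
- by apply/measurable_EFinP; apply: measurable_funX; exact: mg.
- by apply: measurable_funeM; apply/measurable_EFinP; exact: mg.
move=> w _; rewrite -EFinM lee_fin /C /exp_process -expRD expr2 -expRD ler_expR.
set s := grid_time _ _ _ _.
have : (g (2 * p) - 2 * g p) * s <= (g (2 * p) - 2 * g p) * (h * k%:R).
  by rewrite ler_wpM2l ?subr_ge0//; exact: grid_time_le.
by lra.
Qed.

Lemma stopped_exp_le1 U p t : open U -> 0 <= t ->
  (\int[P]_w (M p (stop_time U (path w) t) w)%:E <= 1)%E.
Proof.
move=> oU; rewrite le_eqVlt => /predU1P[<-|t0].
  under eq_integral => w _ do rewrite stop_time_nohit ?hit_ge0// exp_process0.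
  by rewrite integral_cst//= probability_setT mule1.
have h0 n : 0 <= t / n.+1%:R by rewrite divr_ge0// ltW.
apply: (fatou_le (f_ := fun n w => M p (grid_time U (path w) (t / n.+1%:R) n.+1) w)).
- move=> n; apply: (measurable_grid filtrationF aY oU _ _ (h0 n)).
  exact: measurable_exp_process.
- by move=> n w; exact: expR_ge0.
- by move=> w; apply: (grid_path_cvg cY oU (@exp_process_continuous p)).
- by move=> n; have [i e] := exp_grid_expectation p n.+1 oU (h0 n); rewrite Rintegral_EFin// e.
Qed.

Lemma exp_at_hit_le1 U p : open U ->
  (\int[P]_w (at_hit U (path w) ((M p)^~ w))%:E <= 1)%E.
Proof.
move=> oU; apply: (at_hit_expectation_le filtrationF aY cY oU) => //.
- by move=> t t0; exact: measurable_exp_process.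
- exact: exp_process_continuous.
- by move=> t w _; exact: expR_ge0.
- by move=> t t0; exact: stopped_exp_le1.
Qed.

(** Half-lines are written [c < p * y] so that one argument treats both directions: the sign of [p]
    decides between an upward and a downward crossing, and [p] is also the exponent of the
    martingale used. *)
Lemma open_level (p c : R) : open [set y : R | c < p * y].
Proof.
rewrite (_ : [set y | _] = (fun y => p * y) @^-1` [set y | c < y])//.
apply: open_comp; last exact: open_gt.
by move=> y _; apply: (@cvgM R R); [exact: cvg_cst|exact: cvg_id].
Qed.

Lemma stopped_level_le p c t w : 0 <= t -> 0 <= c ->
  p * Y (stop_time [set y : R | c < p * y] (path w) t) w <= c.
Proof.
set U := [set y : R | _] => t0 c0; rewrite leNgt; apply/negP.
suff : ~ U (Y (stop_time U (path w) t) w) by [].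
apply: (open_first_notin (U := U) (z := path w) (@open_level p c) (@cY w) (stop_time_ge0 U (path w) t0)).
  by rewrite /U /= Y0 mulr0 ltNge c0.
by move=> s; exact: (stop_time_notin t0).
Qed.

(* Stopped when [p Y] first exceeds [c], the martingale is bounded, and its second
   moment, that of the martingale of exponent [2 p] up to a bounded factor,
   controls the overshoot of the discretisation. *)
Lemma stopped_exp_bounded_ge1 p c t : 0 <= c -> 0 <= g p -> 0 < t ->
  (1 <= \int[P]_w (M p (stop_time [set y | c < p * y] (path w) t) w)%:E)%E.
Proof.
move=> c0 gp0 t0; set U := [set y : R | _].
have oU : open U by exact: open_level.
have h0 n : 0 <= t / n.+1%:R by rewrite divr_ge0// ltW.
have Mc w : M p (stop_time U (path w) t) w <= expR c.
  rewrite /exp_process ler_expR.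
  have gs0 : 0 <= g p * stop_time U (path w) t by rewrite mulr_ge0// stop_time_ge0// ltW.
  by have := stopped_level_le p w (ltW t0) c0; lra.
pose C := expR ((g (2 * p) - 2 * g p) * t).
(* Truncation at L loses at most C / L, since M <= min(M, L) + M^2 / L. The limit, being at most
   exp(c) <= L, is unaffected by it, and L is then sent to infinity. *)
have key L : expR c <= L -> 0 < L ->
    ((1 - C / L)%:E <= \int[P]_w (M p (stop_time U (path w) t) w)%:E)%E.
  move=> cL L0; apply: (bounded_fatou_ge (L := L) (f_ := fun n w =>
      Num.min (M p (grid_time U (path w) (t / n.+1%:R) n.+1) w) L)).
  - move=> n; apply: measurable_minr => //.
    apply: (measurable_grid filtrationF aY oU _ _ (h0 n)).
    exact: measurable_exp_process.
  - by move=> n w; rewrite le_min expR_ge0 ltW//= ge_min lexx orbT.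
  - move=> w.
    rewrite -[X in _ --> X](@min_l _ _ _ L); last exact: (le_trans (Mc w) cL).
    have cm := grid_path_cvg cY oU (@exp_process_continuous p) (w := w) t0.
    apply: (cvg_comp _ (fun y : R => Num.min y L) cm).
    apply: (@continuous_min R R id (cst L)); first exact: cvg_id.
    exact: cvg_cst.
  move=> n; have [i e] := exp_grid_expectation p n.+1 oU (h0 n).
  have mG : measurable_fun setT (fun w => M p (grid_time U (path w) (t / n.+1%:R) n.+1) w).
    exact: integrable_measurable i.
  have q := exp_grid_sqr_le p n.+1 oU (h0 n).
  rewrite divfK ?pnatr_eq0// -/C in q.
  set G := (fun w => M p _ w) in i e mG q *.
  have i2 : P.-integrable setT (EFin \o (fun w => G w ^+ 2)).
    apply: (ge0_integrable (c := C%:E)) => //; first exact: measurable_funX.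
      by move=> w; exact: sqr_ge0.
    exact: ltry.
  have im : P.-integrable setT (EFin \o (fun w => Num.min (G w) L)).
    apply: integrable_dom i; first exact: measurable_minr.
    move=> w; rewrite ger0_norm ?ge_min ?lexx// le_min expR_ge0/=; exact: ltW.
  rewrite (Rintegral_EFin im) lee_fin.
  rewrite (Rintegral_EFin i2) lee_fin in q.
  have : 1 <= \int[P]_w Num.min (G w) L + L^-1 * \int[P]_w (G w ^+ 2).
    rewrite -e -RintegralZl// -RintegralD//; last exact: integrableZr_.
    apply: le_Rintegral => //.
      exact: (integrableDr im (integrableZr_ _ i2)).
    move=> w _; have G0 : 0 <= G w := expR_ge0 _.
    have [GL|GL] := leP (G w) L.
      by rewrite lerDl mulr_ge0 ?invr_ge0 ?sqr_ge0// ltW.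
    have : G w <= L^-1 * G w ^+ 2.
      by rewrite mulrC ler_pdivlMr// expr2 ler_wpM2l// ltW.
    move=> h; apply: (le_trans h); rewrite lerDr; exact: ltW.
  have : L^-1 * \int[P]_w (G w ^+ 2) <= C / L.
    by rewrite mulrC ler_pM2r ?invr_gt0.
  by lra.
apply/lee_addgt0Pr => e e0.
have C0 : 0 < C := expR_gt0 _.
pose L := Num.max (expR c) (C / e).
have L1 : expR c <= L by rewrite le_max lexx.
have L2 : C / e <= L by rewrite le_max lexx orbT.
have L0 : 0 < L := lt_le_trans (expR_gt0 _) L1.
have CL : C / L <= e by rewrite ler_pdivrMr// mulrC -ler_pdivrMr.
apply: (@le_trans _ _ ((1 - C / L)%:E + e%:E)%E).
  by rewrite -EFinD lee_fin; have := CL; lra.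
by rewrite leeD2r// key.
Qed.

End optional_stopping.

(* No [h] fits strictly between [f] and the [g_ n] since [inf g_ n] and [f] have
   the same integral. *)
Lemma ae_le_inf d (T : measurableType d) (R : realType) (P : probability T R)
    (f : T -> R) (g_ : (T -> R)^nat) (e_ : R^nat) :
  P.-integrable setT (EFin \o f) -> (forall n, P.-integrable setT (EFin \o g_ n)) ->
  (forall n x, f x <= g_ n x) ->
  (forall n, \int[P]_x g_ n x <= \int[P]_x f x + e_ n) -> e_ @ \oo --> 0 ->
  {ae P, forall x, forall h, (forall n, h <= g_ n x) -> h <= f x}.
Proof.
move=> if_ ig fg gf e0.
(* On [E k] every [g_ n] exceeds [f] by 1/(k + 1), so the probability of [E k] is at most (k + 1)
   e_n for all n, hence zero. *)
pose E k := \bigcap_n [set x | f x + k.+1%:R^-1 <= g_ n x].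
have mE k : measurable (E k).
  apply: bigcapT_measurable => n.
  have := @measurable_fun_ler _ _ _ setT (fun x => f x + k.+1%:R^-1) (g_ n) _ _.
  move=> h; rewrite (_ : [set x | _] = setT `&` (fun x => f x + k.+1%:R^-1 <= g_ n x) @^-1` [set true]).
    apply: h => //; last exact: integrable_measurable (ig n).
    by apply: measurable_funD => //; exact: integrable_measurable if_.
  by rewrite setTI.
have E0 k : P (E k) = 0.
  apply/eqP; rewrite eq_le measure_ge0 andbT.
  have ek n : (fine (P (E k)) <= k.+1%:R * e_ n)%R.
    have k0 : 0 < k.+1%:R :> R by rewrite ltr0n.
    rewrite -(ler_pdivrMl _ _ k0).
    have i1 : P.-integrable setT (EFin \o \1_(E k)).
      apply: integrable_dom (probability_integrable_cst P 1); first exact: measurable_indic.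
      by move=> x; rewrite indicE; case: (_ \in _); rewrite ?normr1 ?normr0.
    have -> : fine (P (E k)) = \int[P]_x \1_(E k) x.
      by rewrite /Rintegral integral_indic// setIT.
    rewrite -RintegralZl//.
    apply: (@le_trans _ _ (\int[P]_x (g_ n x - f x))).
      apply: le_Rintegral => //.
      - exact: integrableZr_.
      - exact: integrableBr.
      move=> x _; rewrite indicE; case: (boolP (x \in E k)) => [/set_mem /(_ n Logic.I) /= h|_].
        by rewrite mulr1 lerBrDl.
      by rewrite mulr0 subr_ge0.
    by rewrite RintegralB//; have := gf n; lra.
  have ek0 : (fun n => k.+1%:R * e_ n) @ \oo --> (0 : R).
    by rewrite -(mulr0 k.+1%:R); apply: cvgM => //; exact: cvg_cst.
  have : fine (P (E k)) <= 0 by apply: (cvgr_to_ge ek0); exact: nearW.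
  by rewrite -lee_fin fineK ?fin_num_measure.
have : P.-negligible (\bigcup_k E k).
  by apply: negligible_bigcup => k; exact: ((negligibleP P (mE k)).2 (E0 k)).
apply: negligibleS => x /= nh; apply: contrapT => nE; apply: nh => h hg.
apply/ler_addgt0Pr => e e_gt0.
have [k ke] : exists k : nat, k.+1%:R^-1 < e.
  exists (Num.truncn e^-1); rewrite invf_plt ?posrE ?ltr0n//.
  by case/andP: (truncn_itv (ltW (etrans (invr_gt0 e) e_gt0))).
have : ~ E k x by move=> Ek; apply: nE; exists k.
move=> /existsNP[n] /not_implyP[_ /= /negP]; rewrite -ltNge => nk.
by apply: (le_trans (hg n)); apply: ltW; apply: (lt_trans nk); rewrite ltrD2l.
Qed.

(** * Laplace transforms of hitting times and regularity of levels *)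

Section discounted_hitting.
Context (R : realType).
Implicit Types (A B : set R) (z : R -> R).

Lemma at_hit_exp01 A z s : 0 <= s -> 0 <= at_hit A z (fun t => expR (- s * t)) <= 1.
Proof.
move=> s0; case: (hit_dichotomy A z) => [h|[t t0 h]].
  by rewrite (at_hit_oo _ h) lexx ler01.
by rewrite (at_hitE _ h) expR_ge0/= -expR0 ler_expR mulNr oppr_le0 mulr_ge0.
Qed.

Lemma at_hit_exp_le A B z z' s : 0 <= s -> (hit A z <= hit B z')%E ->
  at_hit B z' (fun t => expR (- s * t)) <= at_hit A z (fun t => expR (- s * t)).
Proof.
move=> s0; case: (hit_dichotomy B z') => [h _|[t t0 h]].
  by rewrite (at_hit_oo _ h); case/andP: (at_hit_exp01 A z s0).
case: (hit_dichotomy A z) => [h'|[t' t0' h']]; rewrite h h' // lee_fin => tt.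
by rewrite (at_hitE _ h) (at_hitE _ h') ler_expR !mulNr lerN2 ler_wpM2l.
Qed.

Lemma hit_le_at_hit A B z z' s : 0 < s ->
  at_hit B z' (fun t => expR (- s * t)) <= at_hit A z (fun t => expR (- s * t)) ->
  (hit A z <= hit B z')%E.
Proof.
move=> s0; case: (hit_dichotomy B z') => [-> _|[t t0 h]]; first exact: leey.
rewrite (at_hitE _ h).
case: (hit_dichotomy A z) => [h'|[t' t0' h']].
  by rewrite (at_hit_oo _ h') leNgt expR_gt0.
by rewrite (at_hitE _ h') ler_expR !mulNr lerN2 ler_pM2l// h h' lee_fin.
Qed.

Lemma stop_time_exp_cvg A z s : 0 < s ->
  expR (- s * stop_time A z n.+1%:R) @[n --> \oo] -->
  at_hit A z (fun t => expR (- s * t)).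
Proof.
move=> s0; case: (hit_dichotomy A z) => [h|[t t0 h]].
  rewrite (at_hit_oo _ h); under eq_fun do
    rewrite stop_time_nohit ?h ?leey ?ler0n//.
  have := @cvg_geometric R 1 (expR (- s)) _.
  rewrite ger0_norm ?expR_ge0// -expR0 ltr_expR oppr_lt0 => /(_ s0).
  rewrite -cvg_shiftS; apply: cvg_trans; apply: near_eq_cvg; apply: nearW => n /=.
  by rewrite /geometric/= expR0 mul1r -expRM_natl mulrC.
rewrite (at_hitE _ h); apply: cvg_near_cst.
near=> n; have tn : t < n%:R by near: n; exact: nbhs_infty_gtr.
have tn1 : t <= n.+1%:R by rewrite -natr1; have := tn; lra.
by rewrite (stop_time_hit (ler0n _ _) h tn1).
Unshelve. all: by end_near.
Qed.

End discounted_hitting.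

Section one_sided_hitting.
Context d (Om : measurableType d) (R : realType) (P : probability Om R).
Variables (F : R -> set (set Om)) (W : R -> Om -> R).
Hypotheses (filtrationF : filtration F) (brownianW : brownian_motion P F W).
Variables (mu sigma x : R) (X : R -> Om -> R).
Hypotheses (sigma0 : 0 < sigma) (x0 : 0 < x).
Hypothesis gbmX : geometric_brownian_motion P F W mu sigma x X.
Local Notation Y := (log_price x X).
Local Notation g := (gbm_exponent mu sigma).
Local Notation path w := (fun t => Y t w).

Lemma gbm_exponent_convex p : 2 * g p <= g (2 * p).
Proof.
rewrite -subr_ge0 (_ : _ - _ = (sigma * p) ^+ 2); first exact: sqr_ge0.
by rewrite /gbm_exponent; field.
Qed.

Let aY := log_price_adapted gbmX.
Let cY := log_price_continuous x0 gbmX.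
Let Y0 := log_price0 x0 gbmX.
Let exp1 := exp_process_expectation filtrationF brownianW sigma0 x0 gbmX.
Let exp_mart := exp_process_martingale filtrationF brownianW sigma0 x0 gbmX.

Lemma measurable_gbm_at_hit U (Z : R -> Om -> R) : open U ->
  (forall t, 0 <= t -> measurable_fun setT (Z t)) -> continuous_paths Z ->
  measurable_fun setT (fun w => at_hit U (path w) (Z^~ w)).
Proof. by move=> oU mZ cZ; exact: (measurable_at_hit filtrationF aY cY oU mZ cZ). Qed.

Lemma measurable_gbm_at_hit_time U (h : R -> R) : open U -> continuous h ->
  measurable_fun setT (fun w => at_hit U (path w) h).
Proof.
move=> oU ch; apply: (measurable_gbm_at_hit (Z := fun t _ => h t)) => //.
by move=> w; exact: continuous_subspaceT.
Qed.

Lemma gbm_exp_at_hit_le1 U p : open U -> (\int[P]_w (at_hit U (path w)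
  (fun t => expR (p * Y t w - g p * t)))%:E <= 1)%E.
Proof. by move=> oU; exact: (exp_at_hit_le1 filtrationF aY cY Y0 exp1 exp_mart p oU). Qed.

Let U p c : set R := [set y | c < p * y].

Lemma hit_level_value p c w t : 0 <= c -> hit (U p c) (path w) = t%:E -> c <= p * Y t w.
Proof.
move=> c0 ht; suff h : closed [set y : R | c <= p * y].
  by apply: (hit_closed h _ (@cY w) ht) => y /=; exact: ltW.
rewrite (_ : [set y | _] = (fun y => p * y) @^-1` [set y | c <= y])//.
apply: closed_comp; last exact: closed_ge.
by move=> y _; apply: (@cvgM R R); [exact: cvg_cst|exact: cvg_id].
Qed.

Let D p c w := at_hit (U p c) (path w) (fun t => expR (- g p * t)).

Let mD p c : measurable_fun setT (D p c).
Proof.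
apply: measurable_gbm_at_hit_time; first exact: open_level.
move=> t; apply: (@cvg_comp _ _ _ _ (@expR R)); last exact: continuous_expR.
by apply: (@cvgM R R); [exact: cvg_cst|exact: cvg_id].
Qed.

Let iD p c : 0 < g p -> P.-integrable setT (EFin \o D p c).
Proof.
move=> gp; apply: integrable_dom (probability_integrable_cst P 1) => //.
by move=> w; have /andP[h0 h1] := at_hit_exp01 (U p c) (path w) (ltW gp); rewrite ger0_norm.
Qed.

(** Upper bound: at the hitting time p Y is at least c, so exp(c) times the transform is dominated
    by the stopped exponential, of expectation at most 1. Lower bound: before the hitting time p Y
    is at most c, so the expectation 1 of the martingale stopped at n.+1 is at most exp(c) times
    that of the discount; then n tends to infinity. *)
Lemma hit_laplace p c : 0 < g p -> 0 <= c ->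
  (\int[P]_w (at_hit [set y | c < p * y] (path w) (fun t => expR (- g p * t)))%:E =
   (expR (- c))%:E)%E.
Proof.
move=> gp c0; rewrite -/(U p c); have oU : open (U p c) by exact: open_level.
have e0 : 0 < expR c := expR_gt0 c.
apply/eqP; rewrite eq_le; apply/andP; split.
  have h : (\int[P]_w ((expR c * D p c w)%R)%:E <= 1)%E.
    apply: le_trans (gbm_exp_at_hit_le1 p oU).
    apply: ge0_le_integral => //.
    - move=> w _; rewrite lee_fin mulr_ge0 ?expR_ge0//.
      by case/andP: (at_hit_exp01 (U p c) (path w) (ltW gp)).
    - by apply/measurable_EFinP; exact: measurable_funM.
    - apply/measurable_EFinP; apply: (measurable_gbm_at_hit (Z := exp_process Y g p)) => //.
        by move=> t t0; exact: (measurable_exp_process exp1).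
      exact: exp_process_continuous.
    move=> w _; rewrite lee_fin /D; case: (hit_dichotomy (U p c) (path w)) => [e|[t t0 e]].
      by rewrite !(at_hit_oo _ e) mulr0.
    rewrite !(at_hitE _ e) -expRD ler_expR.
    by have := hit_level_value c0 e; lra.
  have iDe := Rintegral_EFin (iD c gp); rewrite [leLHS]iDe.
  move: h; under eq_integral do rewrite EFinM.
  have mDe : measurable_fun setT (EFin \o D p c) by exact/measurable_EFinP.
  have D0 w : setT w -> (0 <= (EFin \o D p c) w)%E.
    by move=> _; rewrite lee_fin; case/andP: (at_hit_exp01 (U p c) (path w) (ltW gp)).
  have e0' : (0 <= (expR c)%:E)%E by rewrite lee_fin expR_ge0.
  rewrite (ge0_integralZl P measurableT mDe D0 e0').
  rewrite iDe -EFinM !lee_fin expRN.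
  by rewrite -ler_pdivlMl// mulr1.
apply: (bounded_fatou_ge (L := 1) (f_ := fun n w =>
    expR (- g p * stop_time (U p c) (path w) n.+1%:R))).
- move=> n; apply: measurableT_comp => //; apply: measurable_funM => //.
  exact: (measurable_stop_time filtrationF aY cY oU).
- move=> n w; rewrite expR_ge0/= -expR0 ler_expR mulNr oppr_le0 mulr_ge0 ?stop_time_ge0//.
  exact: ltW.
- by move=> w; exact: stop_time_exp_cvg.
move=> n; have mS : measurable_fun setT (fun w => stop_time (U p c) (path w) n.+1%:R).
  exact: (measurable_stop_time filtrationF aY cY oU).
have mE : measurable_fun setT (fun w =>
    (expR (- g p * stop_time (U p c) (path w) n.+1%:R))%:E).
  apply/measurable_EFinP; apply: measurableT_comp => //; exact: measurable_funM.
have h : (1 <= (expR c)%:E * \int[P]_w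
    (expR (- g p * stop_time (U p c) (path w) n.+1%:R))%:E)%E.
  have E0 w : setT w -> (0 <= (expR (- g p * stop_time (U p c) (path w) n.+1%:R))%:E)%E.
    by move=> _; rewrite lee_fin expR_ge0.
  have e0' : (0 <= (expR c)%:E)%E by rewrite lee_fin expR_ge0.
  rewrite -(ge0_integralZl P measurableT mE E0 e0').
  have n0 : 0 < n.+1%:R :> R by rewrite ltr0n.
  apply: (le_trans (stopped_exp_bounded_ge1 filtrationF aY cY Y0 exp1 exp_mart
    gbm_exponent_convex c0 (ltW gp) n0)).
  apply: ge0_le_integral => //.
  - by move=> w _; rewrite lee_fin expR_ge0.
  - apply/measurable_EFinP; apply: (measurable_stopped filtrationF aY cY oU) => //.
      by move=> t t0; exact: (measurable_exp_process exp1).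
    exact: exp_process_continuous.
  - exact: measurable_funeM.
  move=> w _; rewrite -EFinM lee_fin /exp_process -expRD ler_expR.
  by have := stopped_level_le cY Y0 p w (ltW n0) c0; lra.
have ce : (expR (- c))%:E = ((expR (- c))%:E * 1)%E by rewrite mule1.
rewrite ce; apply: (le_trans (lee_wpmul2l _ h)); first by rewrite lee_fin expR_ge0.
by rewrite muleA -EFinM -expRD addNr expR0 mul1e.
Qed.

Let eD p c : 0 < g p -> 0 <= c -> \int[P]_w D p c w = expR (- c).
Proof. by move=> gp c0; rewrite /Rintegral hit_laplace. Qed.

(** The transform for the closed level lies between those for the open level c and for the open
    levels c_n increasing to c. Their expectations exp(-c_n) tend to exp(-c), so [ae_le_inf] leaves
    no room, and equal transforms mean equal times. *)
Lemma hit_level_closed p c : 0 < g p -> 0 < c ->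
  {ae P, forall w, hit [set y | c <= p * y] (path w) = hit [set y | c < p * y] (path w)}.
Proof.
move=> gp c0; pose cn (n : nat) := c * (1 - n.+1%:R^-1).
have inv0 n : 0 < n.+1%:R^-1 :> R by rewrite invr_gt0.
have inv1 n : n.+1%:R^-1 <= 1 :> R by rewrite invf_le1// ler1n.
have cn0 n : 0 <= cn n by rewrite mulr_ge0 ?subr_ge0// ltW.
have cnc n : cn n < c by rewrite -[ltRHS]mulr1 ltr_pM2l// ltrBlDr ltrDl.
have cn_cvg : cn @ \oo --> c.
  rewrite -[X in _ --> X]mulr1; apply: cvgM; first exact: cvg_cst.
  rewrite -[X in _ --> X]subr0; apply: (@cvgB _ R^o); first exact: cvg_cst.
  exact: cvg_harmonic.
apply: filterS (ae_le_inf (P := P) (f := D p c) (g_ := fun n => D p (cn n))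
  (e_ := fun n => expR (- cn n) - expR (- c)) _ _ _ _ _).
- move=> w hw; apply/eqP; rewrite eq_le; apply/andP; split.
    by apply: hit_subset => t _ /=; exact: ltW.
  apply: (hit_le_at_hit gp); apply: hw => n.
  apply: at_hit_exp_le; first exact: ltW.
  by apply: hit_subset => t _ /= h; apply: lt_le_trans (cnc n) h.
- exact: iD.
- by move=> n; exact: iD.
- move=> n w; apply: at_hit_exp_le; first exact: ltW.
  by apply: hit_subset => t _ /= h; apply: lt_trans (cnc n) h.
- by move=> n; rewrite (eD gp (cn0 n)) (eD gp (ltW c0)) addrC subrK.
rewrite -(subrr (expR (- c))); apply: (@cvgB _ R^o); last exact: cvg_cst.
apply: (cvg_comp (fun n => - cn n) (@expR R)); last exact: continuous_expR.
by apply: (@cvgN _ R^o).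
Qed.

(** The transform at level 0 is at least the one at each level c_n > 0, whose expectation exp(-c_n)
    tends to 1. It is therefore 1 almost surely, which forces the time to be 0. *)
Lemma hit_level0 p : 0 < g p ->
  {ae P, forall w, hit [set y | 0 < p * y] (path w) = 0%E}.
Proof.
move=> gp; pose cn (n : nat) : R := n.+1%:R^-1.
have cn0 n : 0 < cn n by rewrite invr_gt0.
apply: filterS (ae_le_inf (P := P) (f := fun=> 0) (g_ := fun n w => 1 - D p (cn n) w)
  (e_ := fun n => 1 - expR (- cn n)) _ _ _ _ _).
- move=> w hw; apply/eqP; rewrite eq_le hit_ge0 andbT.
  have : 1 - D p 0 w <= 0.
    apply: hw => n; rewrite lerD2l lerN2; apply: at_hit_exp_le; first exact: ltW.
    by apply: hit_subset => t _ /= h; apply: lt_trans h.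
  rewrite subr_le0 /D; case: (hit_dichotomy (U p 0) (path w)) => [e|[t t0 e]].
    by rewrite (at_hit_oo _ e) ler10.
  rewrite (at_hitE _ e) -expR0 ler_expR mulNr oppr_ge0 pmulr_rle0// => t_le.
  by rewrite [X in (X <= _)%E]e lee_fin.
- exact: probability_integrable_cst.
- by move=> n; apply: integrableBr; [exact: probability_integrable_cst|exact: iD].
- move=> n w; rewrite subr_ge0.
  by case/andP: (at_hit_exp01 (U p (cn n)) (path w) (ltW gp)).
- move=> n; rewrite RintegralB//; last exact: iD.
    by rewrite !probability_Rintegral_cst (eD gp (ltW (cn0 n))) add0r.
  exact: probability_integrable_cst.
rewrite -(subrr 1); apply: (@cvgB _ R^o); first exact: cvg_cst.
rewrite -expR0 -[X in expR X]oppr0.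
apply: (cvg_comp (fun n => - cn n) (@expR R)); last exact: continuous_expR.
by apply: (@cvgN _ R^o); exact: cvg_harmonic.
Qed.

End one_sided_hitting.

Import HBNNSimple.

(** No measurability of the two functions is assumed. The integral of a nonnegative function is a
    supremum over simple functions below it, and such a simple function can be cut off on the null
    set. This is how J is estimated for arbitrary Borel regions. *)
Lemma ge0_ae_le_integral d (T : measurableType d) (R : realType)
    (mu : {measure set T -> \bar R}) (f h : T -> \bar R) :
  (forall x, 0 <= f x)%E -> (forall x, 0 <= h x)%E ->
  {ae mu, forall x, f x <= h x}%E -> (\int[mu]_x f x <= \int[mu]_x h x)%E.
Proof.
move=> f0 h0 [N [mN N0 fN]].
rewrite (ge0_integralTE _ f0); apply: ge_ereal_sup => _ [s /= sf <-].
pose s' := mul_nnsfun s (indic_nnsfun R (measurableC mN)).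
have s'E x : s' x = s x * \1_(~` N) x by [].
have -> : sintegral mu s = sintegral mu s'.
  rewrite -!integralT_nnsfun; apply: ae_eq_integral => //.
  - by apply/measurable_EFinP; exact: measurable_funP.
  - by apply/measurable_EFinP; exact: measurable_funP.
  exists N; split=> // x /=; apply: contra_notP => nN _.
  by change ((s x)%:E = (s' x)%:E); rewrite s'E indicE mem_set// mulr1.
rewrite (ge0_integralTE _ h0); apply: ereal_sup_ubound; exists s' => // x.
rewrite s'E indicE; have [nN|xN] := boolP (x \in ~` N); last by rewrite mulr0.
rewrite mulr1; apply: (le_trans (sf x)); apply: contrapT => fh.
by move/set_mem: nN; apply; exact: fN.
Qed.

(** * The put payoff under hyperbolic discounting *)

Section put_option.
Context (R : realType).
Variables (K beta : R).
Hypotheses (K0 : 0 < K) (beta0 : 0 < beta).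
Local Notation f := (put_payoff K).
Local Notation delta := (hyperbolic_discount beta).

Lemma put_payoff_ge0 y : 0 <= f y.
Proof. by rewrite /put_payoff le_max lexx orbT. Qed.

Lemma put_payoff_le y z : y <= z -> f z <= f y.
Proof. by move=> yz; rewrite /put_payoff ge_max le_max lerD2l lerN2 yz/= le_max lexx orbT. Qed.

Lemma put_payoffE y : y <= K -> f y = K - y.
Proof. by move=> yK; rewrite /put_payoff max_l// subr_ge0. Qed.

Lemma put_payoff_leK y : 0 <= y -> f y <= K.
Proof. by move=> y0; rewrite /put_payoff ge_max lerBlDr lerDl y0 ltW. Qed.

Lemma discount_gt0 t : 0 <= t -> 0 < delta t.
Proof.
by move=> t0; rewrite /hyperbolic_discount divr_gt0// ltr_pwDl// mulr_ge0// ltW.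
Qed.

Lemma discount_le s t : 0 <= s -> s <= t -> delta t <= delta s.
Proof.
move=> s0 st; rewrite /hyperbolic_discount !mul1r lef_pV2 ?posrE ?ltr_pwDl ?mulr_ge0//.
- by rewrite lerD2l ler_wpM2l// ltW.
- exact: ltW.
- exact: (le_trans s0 st).
- exact: ltW.
Qed.

Lemma discount0 : delta 0 = 1.
Proof. by rewrite /hyperbolic_discount mulr0 addr0 divr1. Qed.

Lemma discount_le1 t : 0 <= t -> delta t <= 1.
Proof. by move=> t0; rewrite -discount0 discount_le. Qed.

Lemma continuous_discount_clamp : continuous (fun t : R => delta (Num.max t 0)).
Proof.
move=> t; apply: (@cvgM R R); first exact: cvg_cst.
apply: cvgV; first by rewrite gt_eqF// ltr_pwDl// mulr_ge0 ?(ltW beta0)// le_max lexx orbT.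
apply: (@cvgD R R^o); first exact: cvg_cst.
apply: (@cvgM R R); first exact: cvg_cst.
by apply: (@continuous_max R R id (cst 0)); [exact: cvg_id|exact: cvg_cst].
Qed.

(** The payoff is at most K and the discount tends to 0, so the convention on paths that never stop
    contributes nothing and the stopped payoff becomes an [at_hit]. *)
Lemma discounted_payoff_limsup (z : R -> R) : (forall t, 0 <= t -> 0 <= z t) ->
  limf_esup (fun t => (delta t * f (z t))%:E) (pinfty_nbhs R) = 0%E.
Proof.
move=> z0; apply/eqP; rewrite eq_le; apply/andP; split.
  apply/lee_addgt0Pr => e e0; rewrite add0e limf_esupE.
  (* Beyond this time K <= e (1 + beta t), that is, delta(t) K <= e. *)
  pose T := K / (beta * e).
  have T0 : 0 < T by rewrite divr_gt0// mulr_gt0.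
  apply: ge_ereal_inf; exists (ereal_sup ((fun t => (delta t * f (z t))%:E) @` [set t | T < t])).
    by exists [set t | T < t] => //; exists T; split=> //; exact: num_real.
  apply: ge_ereal_sup => _ [t /= Tt <-]; rewrite lee_fin.
  have t0 : 0 <= t by apply: ltW; exact: lt_trans Tt.
  apply: (@le_trans _ _ (delta t * K)).
    by rewrite ler_wpM2l ?put_payoff_leK ?z0// ltW// discount_gt0.
  rewrite /hyperbolic_discount mul1r mulrC ler_pdivrMr; last first.
    by rewrite ltr_pwDl// mulr_ge0// ltW.
  move: Tt; rewrite /T ltr_pdivrMr ?mulr_gt0// => Tt.
  by have := ltW e0; have := Tt; lra.
rewrite limf_esupE; apply: le_ereal_inf_tmp => _ [A [M [_ MA]] <-].
pose t := Num.max M 0 + 1.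
have tM : M < t /\ 0 <= t by rewrite /t; have [] := leP M 0 => h; split; lra.
apply: (@le_trans _ _ (delta t * f (z t))%:E).
  by rewrite lee_fin mulr_ge0 ?put_payoff_ge0// ltW// discount_gt0// tM.2.
by apply: ereal_sup_ubound; exists t => //; apply: MA; exact: tM.1.
Qed.

Lemma stopped_payoffE (Om : Type) (X : R -> R -> Om -> R) x A w :
  (forall t, 0 <= t -> 0 <= X x t w) ->
  stopped_payoff X f delta x A w =
  (at_hit A (fun t => X x t w) (fun t => delta t * f (X x t w)))%:E.
Proof.
move=> X0; rewrite /stopped_payoff /at_hit -/(hit A (fun t => X x t w)).
case: ifP => // _; exact: discounted_payoff_limsup.
Qed.

Lemma at_hit_payoff_ge0 A z z' : 0 <= at_hit A z (fun t => delta t * f (z' t)).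
Proof.
case: (hit_dichotomy A z) => [h|[t t0 h]]; first by rewrite at_hit_oo.
by rewrite (at_hitE _ h) mulr_ge0 ?put_payoff_ge0// ltW// discount_gt0.
Qed.

End put_option.

(** * Exponential mixtures *)

Section unit_exponential.
Context (R : realType).

Lemma unit_exponential_law :
  {Q : probability (measurableTypeR R) R | forall A, Q A = exponential_prob 1 A}.
Proof.
by unshelve eexists (exponential_prob 1); first exact: ltr01.
Qed.

Definition unit_exponential := sval unit_exponential_law.
Local Notation Q := unit_exponential.

Lemma unit_exponentialE A : Q A = exponential_prob 1 A.
Proof. exact: (svalP unit_exponential_law). Qed.

Lemma integral_unit_exponential (h : R -> R) : measurable_fun setT h ->
  (forall s, 0 <= h s) ->
  (\int[Q]_s (h s)%:E =
   \int[lebesgue_measure]_(s in `[0%R, +oo[) (expR (- s) * h s)%:E)%E.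
Proof.
move=> mh h0.
have mp : measurable_fun setT (exponential_pdf (1 : R)) by exact: measurable_exponential_pdf.
have p0 s : 0 <= exponential_pdf 1 s :> R by apply: exponential_pdf_ge0; exact: ler01.
have QE A : measurable A -> Q A = (\int[lebesgue_measure]_(s in A) (exponential_pdf 1 s)%:E)%E.
  by move=> _; rewrite unit_exponentialE.
have mhe : measurable_fun setT (EFin \o h) by exact/measurable_EFinP.
have h0e s : (0 <= (EFin \o h) s)%E by rewrite lee_fin.
rewrite (@integral_density _ (measurableTypeR R) R lebesgue_measure Q
  (exponential_pdf 1) (EFin \o h) mp p0 QE mhe h0e).
rewrite [RHS]integral_mkcond; apply: eq_integral => s _.
rewrite patchE /exponential_pdf patchE; case: ifPn => _; last by rewrite mule0.
by rewrite -EFinM mul1r mulN1r mulrC.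
Qed.

Lemma unit_exponential_mgf c : c < 1 ->
  (\int[Q]_s (expR (c * s))%:E = ((1 - c)^-1)%:E)%E.
Proof.
move=> c1; have c0 : 0 < 1 - c by lra.
rewrite integral_unit_exponential//; last first.
  by apply: measurableT_comp => //; exact: measurable_funM.
have mp : measurable_fun setT (exponential_pdf (1 - c)) by exact: measurable_exponential_pdf.
have p0 s : 0 <= exponential_pdf (1 - c) s by apply: exponential_pdf_ge0; exact: ltW.
have mpe : measurable_fun setT (EFin \o exponential_pdf (1 - c)) by exact/measurable_EFinP.
transitivity (((1 - c)^-1)%:E * \int[lebesgue_measure]_s (exponential_pdf (1 - c) s)%:E)%E; last first.
  by rewrite integral_exponential_pdf// mule1.
have p0e (s : R) : setT s -> (0 <= (EFin \o exponential_pdf (1 - c)) s)%E.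
  by move=> _; rewrite lee_fin.
have k0 : (0 <= ((1 - c)^-1)%:E)%E by rewrite lee_fin invr_ge0 ltW.
rewrite -(@ge0_integralZl _ (measurableTypeR R) R lebesgue_measure setT measurableT
  (EFin \o exponential_pdf (1 - c)) mpe _ p0e k0).
rewrite [LHS]integral_mkcond; apply: eq_integral => s _.
rewrite patchE /exponential_pdf /= patchE; case: ifPn => _; last by rewrite mule0.
by rewrite -EFinM mulrA mulVf ?gt_eqF// mul1r -expRD; congr (expR _)%:E; ring.
Qed.

End unit_exponential.

(** * Mixing the roots of the exponent over an exponential variable *)

Section exponent_mixture.
Context (R : realType).
Variables mu sigma beta : R.
Hypotheses (sigma0 : 0 < sigma) (beta0 : 0 < beta).
Local Notation Q := (unit_exponential R).
Local Notation v := (nu mu sigma).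
Local Notation lam := (lambda mu sigma beta).

(** For q > 0 the equation g(p) = q has one negative and one positive root; they are
    [- lower_root q] and [upper_root q]. *)
Definition lower_root (q : R) : R := Num.sqrt (v ^+ 2 + 2 * q / sigma ^+ 2) + v.

Definition upper_root (q : R) : R := Num.sqrt (v ^+ 2 + 2 * q / sigma ^+ 2) - v.

Let s20 : 0 < sigma ^+ 2. Proof. exact: exprn_gt0. Qed.

Let rad_ge0 q : 0 <= q -> 0 <= v ^+ 2 + 2 * q / sigma ^+ 2.
Proof. by move=> q0; rewrite addr_ge0 ?sqr_ge0// divr_ge0 ?mulr_ge0// ltW. Qed.

Lemma gbm_exponent_lower q : 0 <= q -> gbm_exponent mu sigma (- lower_root q) = q.
Proof.
move=> q0; rewrite /gbm_exponent /lower_root.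
have := sqr_sqrtr (rad_ge0 q0); set r := Num.sqrt _ => r2.
transitivity (sigma ^+ 2 / 2 * (r ^+ 2 - v ^+ 2)); first by ring.
by rewrite r2; field; rewrite gt_eqF.
Qed.

Lemma gbm_exponent_upper q : 0 <= q -> gbm_exponent mu sigma (upper_root q) = q.
Proof.
move=> q0; rewrite /gbm_exponent /upper_root.
have := sqr_sqrtr (rad_ge0 q0); set r := Num.sqrt _ => r2.
transitivity (sigma ^+ 2 / 2 * (r ^+ 2 - v ^+ 2)); first by ring.
by rewrite r2; field; rewrite gt_eqF.
Qed.

Let rad_gt q : 0 < q -> `|v| < Num.sqrt (v ^+ 2 + 2 * q / sigma ^+ 2).
Proof.
move=> q0; rewrite -sqrtr_sqr ltr_sqrt; first by rewrite ltrDl divr_gt0// mulr_gt0.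
by rewrite ltr_pwDr ?sqr_ge0// divr_gt0// mulr_gt0.
Qed.

Lemma lower_root_gt0 q : 0 < q -> 0 < lower_root q.
Proof. by move/rad_gt; rewrite /lower_root ltr_norml => /andP[]; lra. Qed.

Lemma upper_root_gt0 q : 0 < q -> 0 < upper_root q.
Proof. by move/rad_gt; rewrite /upper_root ltr_norml => /andP[]; lra. Qed.

Lemma lower_root_le q q' : q <= q' -> lower_root q <= lower_root q'.
Proof.
move=> qq; rewrite /lower_root lerD2r ler_wsqrtr// lerD2l ler_pM2r ?invr_gt0//.
by rewrite ler_pM2l.
Qed.

Lemma lower_root_ge0 q : 0 <= q -> 0 <= lower_root q.
Proof.
rewrite le_eqVlt => /predU1P[<-|/lower_root_gt0/ltW//].
rewrite /lower_root mulr0 mul0r addr0 sqrtr_sqr.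
by have := ler_norm (- v); rewrite normrN; lra.
Qed.

(* The law [Q] lives on [s >= 0]; the clamp makes pointwise statements hold for all [s]. *)
Definition rate (s : R) : R := beta * Num.max s 0.

Definition alpha (s : R) : R := lower_root (rate s).

Lemma rate_ge0 s : 0 <= rate s.
Proof. by rewrite /rate mulr_ge0 ?(ltW beta0)// le_max lexx orbT. Qed.

Lemma measurable_rate : measurable_fun setT rate.
Proof. by apply: measurable_funM => //; exact: measurable_maxr. Qed.

Lemma alpha_ge0 s : 0 <= alpha s.
Proof. exact/lower_root_ge0/rate_ge0. Qed.

Lemma gbm_exponent_alpha s : gbm_exponent mu sigma (- alpha s) = rate s.
Proof. exact/gbm_exponent_lower/rate_ge0. Qed.

Lemma measurable_alpha : measurable_fun setT alpha.
Proof.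
rewrite /alpha /lower_root; apply: measurable_funD => //.
apply: (@measurableT_comp _ _ _ _ _ _ (@Num.sqrt R)).
  by apply: continuous_measurable_fun; exact: sqrt_continuous.
apply: measurable_funD => //; apply: measurable_funM => //.
by apply: measurable_funM => //; exact: measurable_rate.
Qed.

Let B := 1 + v ^+ 2 + `|v| + 8 * beta / sigma ^+ 2.

(** Combines sqrt(y) <= 1 + y with m <= 4 exp(m/4). The rate 1/4 is chosen so that the square of the
    bound grows like exp(s/2), which is integrable against the unit exponential law. *)
Lemma alpha_bound s : alpha s <= B * expR (Num.max s 0 / 4).
Proof.
set m := Num.max s 0; have m0 : 0 <= m by rewrite le_max lexx orbT.
have e1 : 1 <= expR (m / 4) by rewrite -expR0 ler_expR divr_ge0.
have em : m <= 4 * expR (m / 4) by have := expR_ge1Dx (m / 4); lra.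
set y := v ^+ 2 + 2 * rate s / sigma ^+ 2.
have y0 : 0 <= y by apply: rad_ge0; exact: rate_ge0.
have sy : Num.sqrt y <= 1 + y.
  have := sqr_ge0 (Num.sqrt y - 1); have := sqr_sqrtr y0.
  by have := sqrtr_ge0 y; nra.
have k0 : 0 <= 2 * beta / sigma ^+ 2 by rewrite divr_ge0 ?mulr_ge0// ltW.
have yE : y = v ^+ 2 + 2 * beta / sigma ^+ 2 * m by rewrite /y /rate -/m; ring.
have h1 : 2 * beta / sigma ^+ 2 * m <= 8 * beta / sigma ^+ 2 * expR (m / 4).
  have := ler_wpM2l k0 em; congr (_ <= _); ring.
have c0 : 0 <= 1 + v ^+ 2 + `|v| by rewrite !addr_ge0 ?sqr_ge0.
have h2 : 1 + v ^+ 2 + `|v| <= (1 + v ^+ 2 + `|v|) * expR (m / 4).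
  by rewrite ler_peMr.
have vn := ler_norm v.
rewrite /alpha /lower_root -/y /B mulrDl.
by have := sy; rewrite yE; lra.
Qed.

Lemma integrable_Q_dom (h : R -> R) (M : R) : measurable_fun setT h ->
  (forall s, `|h s| <= M * (1 + expR (2^-1 * s))) -> Q.-integrable setT (EFin \o h).
Proof.
move=> mh hM; apply: (@integrable_dom _ (measurableTypeR R) R Q h (fun s => M * (1 + expR (2^-1 * s)))) => //.
apply: integrableZr_; apply: integrableDr; first exact: probability_integrable_cst.
apply: (ge0_integrable (c := ((1 - 2^-1)^-1)%:E)) => //.
- by apply: measurableT_comp => //; exact: measurable_funM.
- by rewrite unit_exponential_mgf//; lra.
- exact: ltry.
Qed.

Lemma integrable_Q_bounded (h : R -> R) (M : R) : measurable_fun setT h ->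
  (forall s, `|h s| <= M) -> Q.-integrable setT (EFin \o h).
Proof.
move=> mh hM; apply: (@integrable_dom _ (measurableTypeR R) R Q h (fun=> M)) => //.
exact: probability_integrable_cst.
Qed.

Lemma integrable_alpha_sqr : Q.-integrable setT (EFin \o (fun s => alpha s ^+ 2)).
Proof.
apply: (integrable_Q_dom (M := B ^+ 2)).
  by apply: measurable_funX; exact: measurable_alpha.
move=> s; rewrite ger0_norm ?sqr_ge0//.
apply: (@le_trans _ _ ((B * expR (Num.max s 0 / 4)) ^+ 2)).
  by rewrite ler_sqr ?nnegrE ?alpha_ge0 ?alpha_bound// (le_trans (alpha_ge0 s) (alpha_bound s)).
rewrite exprMn ler_wpM2l ?sqr_ge0// expr2 -expRD.
have [s0|s0] := leP s 0.
  by rewrite mul0r addr0 expR0 lerDl expR_ge0.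
rewrite (_ : s / 4 + s / 4 = 2^-1 * s); first by rewrite lerDr.
by field.
Qed.

Lemma sqint_alpha : sqint Q alpha.
Proof. by split; [exact: measurable_alpha|exact: integrable_alpha_sqr]. Qed.

Lemma integrable_alpha : Q.-integrable setT (EFin \o alpha).
Proof. exact: (sqint_integrable sqint_alpha). Qed.

Lemma lambdaE : lam = \int[Q]_s alpha s.
Proof.
rewrite /Rintegral /lambda /Rintegral; congr fine.
have -> : (\int[Q]_x (alpha x)%:E = \int[lebesgue_measure]_(s in `[0%R, +oo[) (expR (- s) * alpha s)%:E)%E.
  by rewrite integral_unit_exponential//; [exact: measurable_alpha|exact: alpha_ge0].
apply: eq_integral => s; rewrite inE/= in_itv/= andbT => s0.
by rewrite /alpha /lower_root /rate max_l// mulrA.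
Qed.

Lemma discount_mixture t : 0 <= t ->
  (\int[Q]_s (expR (- rate s * t))%:E = (hyperbolic_discount beta t)%:E)%E.
Proof.
move=> t0; have bt : 0 <= beta * t by rewrite mulr_ge0// ltW.
transitivity (\int[Q]_s (expR (- (beta * t) * s))%:E)%E; last first.
  by rewrite unit_exponential_mgf ?opprK// ?/hyperbolic_discount ?mul1r//; lra.
rewrite !integral_unit_exponential//.
- apply: eq_integral => s; rewrite inE/= in_itv/= andbT => s0.
  by rewrite /rate max_l//; congr (_ * expR _)%:E; ring.
- by apply: measurableT_comp => //; exact: measurable_funM.
- apply: measurableT_comp => //; apply: measurable_funM => //.
  by apply: measurableT_comp => //; exact: measurable_rate.
Qed.

Lemma integrable_discount_mixture t : 0 <= t ->
  Q.-integrable setT (EFin \o (fun s => expR (- rate s * t))).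
Proof.
move=> t0; apply: (integrable_Q_bounded (M := 1)).
  apply: measurableT_comp => //; apply: measurable_funM => //.
  by apply: measurableT_comp => //; exact: measurable_rate.
move=> s; rewrite ger0_norm ?expR_ge0// -expR0 ler_expR mulNr oppr_le0 mulr_ge0//.
exact: rate_ge0.
Qed.

(** [alpha] is bounded below by [alpha h] times 1 - exp(h - s): this is nonpositive for s < h, and
    for s >= h monotonicity applies. Its expectation is [alpha h] times 1 - exp(h)/2, positive
    because exp(h) = 3/2 is less than 2. *)
Lemma lambda_gt0 : 0 < lam.
Proof.
pose h := ln (3 / 2 : R); have eh : expR h = 3 / 2 by rewrite lnK// posrE.
have h0 : 0 < h by rewrite ln_gt0; lra.
have rh : 0 < rate h by rewrite /rate max_l ?mulr_gt0// ltW.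
have ah : 0 < alpha h by exact: lower_root_gt0.
have E : \int[Q]_s (expR (-1 * s)) = 2^-1.
  by rewrite /Rintegral unit_exponential_mgf//= opprK.
have i1 : Q.-integrable setT (EFin \o (fun s => expR (-1 * s))).
  apply: (ge0_integrable (c := (2^-1)%:E)) => //.
  - by apply: measurableT_comp => //; exact: measurable_funM.
  - by rewrite unit_exponential_mgf ?opprK//; lra.
  - exact: ltry.
have i2 : Q.-integrable setT (EFin \o (fun s => alpha h * (1 - 3 / 2 * expR (-1 * s)))).
  apply: integrableZr_; apply: integrableBr; first exact: probability_integrable_cst.
  exact: integrableZr_.
have : \int[Q]_s (alpha h * (1 - 3 / 2 * expR (-1 * s))) <= lam.
  rewrite lambdaE; apply: le_Rintegral => //; first exact: integrable_alpha.
  move=> s _; rewrite -eh -expRD.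
  have [hs|sh] := leP h s.
    have := lower_root_le (_ : rate h <= rate s); rewrite -/(alpha h) -/(alpha s) => al.
    apply: (le_trans _ (al _)).
      by rewrite ler_piMr ?(ltW ah)// lerBlDr lerDl expR_ge0.
    by rewrite /rate ler_pM2l// ge_max !le_max hs lexx ?orbT.
  apply: (le_trans _ (alpha_ge0 s)); rewrite pmulr_rle0// subr_le0 -[leLHS]expR0 ler_expR.
  by have := ltW sh; lra.
rewrite RintegralZl//; last first.
  by apply: integrableBr; [exact: probability_integrable_cst|exact: integrableZr_].
rewrite RintegralB//; [|exact: probability_integrable_cst|exact: integrableZr_].
rewrite RintegralZl// E probability_Rintegral_cst; apply: lt_le_trans.
by rewrite mulr_gt0//; lra.
Qed.

(* [mixture t u] is the mixture over [s] of the values at time [t], log-distance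
   [u] above the barrier, of the discounted hitting functionals. *)
Definition mixture (t u : R) : R := \int[Q]_s (expR (- rate s * t) * expR (- alpha s * u)).

Lemma integrable_mixture t u : 0 <= t -> 0 <= u ->
  Q.-integrable setT (EFin \o (fun s => expR (- rate s * t) * expR (- alpha s * u))).
Proof.
move=> t0 u0; apply: (integrable_Q_bounded (M := 1)).
  apply: measurable_funM; apply: measurableT_comp => //; apply: measurable_funM => //;
  by apply: measurableT_comp => //; (exact: measurable_rate || exact: measurable_alpha).
move=> s; rewrite ger0_norm ?mulr_ge0 ?expR_ge0// -expRD -expR0 ler_expR.
by have := mulr_ge0 (rate_ge0 s) t0; have := mulr_ge0 (alpha_ge0 s) u0; lra.
Qed.

Lemma mixture0_ge u : 0 <= u -> expR (- lam * u) <= mixture 0 u.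
Proof.
move=> u0; have i := integrable_mixture (lexx 0) u0.
have il : Q.-integrable setT (EFin \o (fun s => alpha s - lam)).
  by apply: integrableBr; [exact: integrable_alpha|exact: probability_integrable_cst].
have ir : Q.-integrable setT (EFin \o (fun s => 1 - u * (alpha s - lam))).
  by apply: integrableBr; [exact: probability_integrable_cst|exact: integrableZr_].
(* The tangent line of a -> exp(-a u) at a = lambda, averaged over s: its linear part has mean
   zero. *)
have E : \int[Q]_s (expR (- lam * u) * (1 - u * (alpha s - lam))) = expR (- lam * u).
  rewrite RintegralZl// RintegralB//; [|exact: probability_integrable_cst|exact: integrableZr_].
  rewrite RintegralZl// RintegralB//; [|exact: integrable_alpha|exact: probability_integrable_cst].
  by rewrite !probability_Rintegral_cst -lambdaE subrr mulr0 subr0 mulr1.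
rewrite -[leLHS]E; apply: le_Rintegral => //; first exact: integrableZr_.
move=> s _; rewrite mulr0 expR0 mul1r.
have -> : expR (- alpha s * u) = expR (- lam * u) * expR (- (u * (alpha s - lam))).
  by rewrite -expRD; congr expR; ring.
by rewrite ler_wpM2l ?expR_ge0//; exact: expR_ge1Dx.
Qed.

Lemma expRN_le z : 0 <= z -> expR (- z) <= 1 - z + z ^+ 2 / 2 :> R.
Proof.
move=> z0; pose h (y : R) := 1 - y + y ^+ 2 / 2 - expR (- y).
pose h' (y : R) := - 1 + y + expR (- y).
have dh (y : R) : is_derive y 1 h (h' y).
  rewrite /h /h'; apply: is_derive_eq; rewrite /GRing.scale/=; by field.
have h'0 (y : R) : 0 <= y -> 0 <= h' y.
  by move=> _; rewrite /h'; have := expR_ge1Dx (- y); lra.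
have := derive_ge0_le z0 dh h'0.
by rewrite /h oppr0 expR0; lra.
Qed.

(** Second-order control just above the barrier, with a finite second moment of [alpha] as
    coefficient. It is used when a gap is excluded. *)
Lemma mixture0_le u : 0 <= u ->
  mixture 0 u <= 1 - lam * u + (\int[Q]_s (alpha s ^+ 2)) / 2 * u ^+ 2.
Proof.
move=> u0; have i := integrable_mixture (lexx 0) u0.
have i1 : Q.-integrable setT (EFin \o (fun s => 1 - u * alpha s)).
  apply: integrableBr; first exact: probability_integrable_cst.
  by apply: integrableZr_; exact: integrable_alpha.
have i2 : Q.-integrable setT (EFin \o (fun s => u ^+ 2 / 2 * alpha s ^+ 2)).
  by apply: integrableZr_; exact: integrable_alpha_sqr.
have -> : 1 - lam * u + (\int[Q]_s (alpha s ^+ 2)) / 2 * u ^+ 2 =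
    \int[Q]_s ((1 - u * alpha s) + u ^+ 2 / 2 * alpha s ^+ 2).
  rewrite RintegralD// RintegralB//; last 2 first.
  - exact: probability_integrable_cst.
  - by apply: integrableZr_; exact: integrable_alpha.
  rewrite !RintegralZl//; [|exact: integrable_alpha_sqr|exact: integrable_alpha].
  by rewrite probability_Rintegral_cst -lambdaE; ring.
apply: le_Rintegral => //; first exact: integrableDr.
move=> s _; rewrite mulr0 expR0 mul1r mulNr.
apply: (le_trans (expRN_le (mulr_ge0 (alpha_ge0 s) u0))).
by rewrite le_eqVlt; apply/orP; left; apply/eqP; ring.
Qed.

Lemma integrable_discount_alpha t : 0 <= t ->
  Q.-integrable setT (EFin \o (fun s => expR (- rate s * t) * alpha s)).
Proof.
move=> t0; apply: integrable_dom integrable_alpha.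
  apply: measurable_funM; last exact: measurable_alpha.
  exact: integrable_measurable (integrable_discount_mixture t0).
move=> s; rewrite ger0_norm ?mulr_ge0 ?expR_ge0 ?alpha_ge0//.
by rewrite ler_piMl ?alpha_ge0// -expR0 ler_expR mulNr oppr_le0 mulr_ge0 ?rate_ge0.
Qed.

(* Chebyshev's correlation inequality: in [s], the discount factor decreases
   while [alpha] increases. *)
Lemma discount_alpha_le t : 0 <= t ->
  \int[Q]_s (expR (- rate s * t) * alpha s) <= hyperbolic_discount beta t * lam.
Proof.
move=> t0; set D := hyperbolic_discount beta t.
have D0 : 0 < D by exact: discount_gt0.
have D1 : D <= 1 by exact: discount_le1.
have ie := integrable_discount_mixture t0.
have iea := integrable_discount_alpha t0.
have eD : \int[Q]_s expR (- rate s * t) = D by rewrite /Rintegral discount_mixture.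
(* For t > 0 the discount factor crosses its mean D at the rate q with exp(-q t) = D. With a0 the
   root at q the two factors have opposite signs at every s; at t = 0 the first factor vanishes. *)
have [a0 h0] : exists a0, forall s, (expR (- rate s * t) - D) * (alpha s - a0) <= 0.
  move: t0; rewrite le_eqVlt => /predU1P[t0|t0].
    by exists 0 => s; rewrite /D -t0 discount0 mulr0 expR0 subrr mul0r.
  pose q := - ln D / t; exists (lower_root q) => s.
  have eq : expR (- q * t) = D.
    by rewrite /q mulNr divfK ?gt_eqF// opprK lnK ?posrE.
  rewrite -eq; have [rq|/ltW rq] := leP (rate s) q.
    apply: mulr_ge0_le0; last by rewrite subr_le0 lower_root_le.
    by rewrite subr_ge0 ler_expR !mulNr lerN2 ler_pM2r.
  apply: mulr_le0_ge0; last by rewrite subr_ge0 lower_root_le.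
  by rewrite subr_le0 ler_expR !mulNr lerN2 ler_pM2r.
have : \int[Q]_s (expR (- rate s * t) * alpha s) <=
    \int[Q]_s (D * alpha s + a0 * (expR (- rate s * t) - D)).
  apply: le_Rintegral => //.
    apply: integrableDr; first by apply: integrableZr_; exact: integrable_alpha.
    by apply: integrableZr_; apply: integrableBr => //; exact: probability_integrable_cst.
  by move=> s _; have := h0 s; lra.
have i2 : Q.-integrable setT (EFin \o (fun s => expR (- rate s * t) - D)).
  by apply: integrableBr => //; exact: probability_integrable_cst.
rewrite RintegralD//; [|by apply: integrableZr_; exact: integrable_alpha|exact: integrableZr_].
rewrite !RintegralZl//; last exact: integrable_alpha.
rewrite RintegralB//; last exact: probability_integrable_cst.
by rewrite probability_Rintegral_cst -lambdaE eD subrr mulr0 addr0.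
Qed.

(** Here exp(u) stands for y/b. The bound exp(-a u) >= 1 - a u >= 1 - a (exp(u) - 1) is averaged
    against the discount factor, and [discount_alpha_le] replaces the mean of the product by the
    product of the means. *)
Lemma mixture_ge t u : 0 <= t -> 0 <= u ->
  hyperbolic_discount beta t * Num.max (1 - lam * (expR u - 1)) 0 <= mixture t u.
Proof.
move=> t0 u0; have i := integrable_mixture t0 u0.
have [neg|_] := leP (1 - lam * (expR u - 1)) 0.
  by rewrite mulr0 /mixture; apply: Rintegral_ge0 => s _; rewrite mulr_ge0 ?expR_ge0.
have ie := integrable_discount_mixture t0.
have iea := integrable_discount_alpha t0.
have eu : u <= expR u - 1 by have := expR_ge1Dx u; lra.
have : \int[Q]_s (expR (- rate s * t) - (expR u - 1) * (expR (- rate s * t) * alpha s))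
    <= mixture t u.
  apply: le_Rintegral => //; first by apply: integrableBr => //; exact: integrableZr_.
  move=> s _; set e := expR (- rate s * t); have e0 : 0 <= e := expR_ge0 _.
  have h1 := expR_ge1Dx (- alpha s * u).
  have h2 := ler_wpM2l (alpha_ge0 s) eu.
  rewrite (_ : e - _ = e * (1 - (expR u - 1) * alpha s)); last by ring.
  by rewrite ler_wpM2l//; lra.
rewrite RintegralB//; last exact: integrableZr_.
rewrite RintegralZl//; apply: le_trans.
have -> : \int[Q]_s expR (- rate s * t) = hyperbolic_discount beta t.
  by rewrite /Rintegral discount_mixture.
have := ler_wpM2l (le_trans u0 eu) (discount_alpha_le t0).
by lra.
Qed.

End exponent_mixture.

(** * Hitting functionals of the price *)

Lemma at_hit_ext (R : realType) (U : set R) (z zeta zeta' : R -> R) :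
  (forall t, 0 <= t -> hit U z = t%:E -> zeta t = zeta' t) ->
  at_hit U z zeta = at_hit U z zeta'.
Proof.
move=> h; case: (hit_dichotomy U z) => [e|[t t0 e]]; first by rewrite !at_hit_oo.
by rewrite !(at_hitE _ e) h.
Qed.

Lemma at_hit_ge0 (R : realType) (U : set R) (z zeta : R -> R) :
  (forall t, 0 <= t -> hit U z = t%:E -> 0 <= zeta t) -> 0 <= at_hit U z zeta.
Proof.
move=> h; case: (hit_dichotomy U z) => [e|[t t0 e]]; first by rewrite at_hit_oo.
by rewrite (at_hitE _ e) h.
Qed.

(** For s <= 0 the clamped rate is 0, so the indicator of this set is below exp(-rate t) for every
    t; its probability is thus at most 1/(1 + t) for every t. *)
Lemma unit_exponential_gt0 (R : realType) : {ae unit_exponential R, forall s, 0 < s}.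
Proof.
pose A := [set s : measurableTypeR R | s <= 0].
have mA : measurable A.
  rewrite (_ : A = [set` `]-oo, (0 : R)]]); first exact: measurable_itv.
  by apply/seteqP; split=> s /=; rewrite in_itv.
have QA : unit_exponential R A = 0%E.
  have le_c (c : R) : 0 <= c -> (unit_exponential R A <=
      (hyperbolic_discount 1 c)%:E)%E.
    move=> c0; rewrite -(discount_mixture ltr01 c0).
    rewrite -[X in unit_exponential R X]setIT -integral_indic//.
    apply: ge0_le_integral => //.
    - by apply/measurable_EFinP; exact: measurable_indic.
    - apply/measurable_EFinP; apply: measurableT_comp => //; apply: measurable_funM => //.
      by apply: measurableT_comp => //; exact: measurable_rate.
    move=> s _; rewrite lee_fin indicE; case: (boolP (s \in _)) => [/set_mem /= s0|_].
      by rewrite /rate max_r// mulr0 oppr0 mul0r expR0.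
    exact: expR_ge0.
  apply/eqP; rewrite eq_le measure_ge0 andbT; apply/lee_addgt0Pr => e e0; rewrite add0e.
  apply: (le_trans (le_c e^-1 _)); first by rewrite invr_ge0 ltW.
  rewrite lee_fin /hyperbolic_discount !mul1r -[leRHS]invrK lef_pV2 ?posrE ?invr_gt0//.
    by rewrite lerDr.
  by rewrite addr_gt0 ?invr_gt0.
exists A; split=> // s /=.
by move/negP; rewrite -leNgt.
Qed.

Section price_hitting.
Context d (Om : measurableType d) (R : realType) (P : probability Om R).
Variables (F : R -> set (set Om)) (W : R -> Om -> R).
Hypotheses (filtrationF : filtration F) (brownianW : brownian_motion P F W).
Variables (mu sigma beta x : R) (X : R -> Om -> R).
Hypotheses (sigma0 : 0 < sigma) (beta0 : 0 < beta) (x0 : 0 < x).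
Hypothesis gbmX : geometric_brownian_motion P F W mu sigma x X.
Local Notation Y := (log_price x X).
Local Notation Q := (unit_exponential R).
Local Notation path w := (fun t => X t w).
Local Notation alpha := (alpha mu sigma beta).
Local Notation rate := (rate beta).
Local Notation mixture := (mixture mu sigma beta).
Local Notation lroot := (lower_root mu sigma).
Local Notation uroot := (upper_root mu sigma).

Lemma price_gt0 t w : 0 <= t -> 0 < X t w.
Proof. by case: gbmX => _ _ h _ _; exact: h. Qed.

Lemma price0 w : X 0 w = x.
Proof. by case: gbmX. Qed.

Lemma price_continuous : continuous_paths X.
Proof. by case: gbmX. Qed.

Lemma price_adapted : adapted F X.
Proof. by case: gbmX. Qed.

Lemma measurable_price t : 0 <= t -> measurable_fun setT (X t).
Proof. by move=> t0; exact: (filtration_measurable filtrationF t0 (price_adapted t0)). Qed.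

Lemma hit_log U w : hit U (path w) = hit [set y | U (x * expR y)] (fun t => Y t w).
Proof. by apply: hit_eq => t t0 /=; rewrite -(log_priceK x0 gbmX w (ltW t0)). Qed.

Lemma at_hit_log U w zeta : at_hit U (path w) zeta =
  at_hit [set y | U (x * expR y)] (fun t => Y t w) zeta.
Proof. by rewrite /at_hit hit_log. Qed.

Lemma open_log (U : set R) : open U -> open [set y | U (x * expR y)].
Proof.
move=> oU; rewrite (_ : [set y | _] = (fun y => x * expR y) @^-1` U)//.
apply: open_comp => // y _.
by apply: (@cvgM R R); [exact: cvg_cst|exact: continuous_expR].
Qed.

Lemma measurable_price_at_hit U (Z : R -> Om -> R) : open U ->
  (forall t, 0 <= t -> measurable_fun setT (Z t)) -> continuous_paths Z ->
  measurable_fun setT (fun w => at_hit U (path w) (Z^~ w)).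
Proof.
by move=> oU mZ cZ; exact: (measurable_at_hit filtrationF price_adapted price_continuous oU mZ cZ).
Qed.

Lemma price_exp_at_hit_le1 U p : open U -> (\int[P]_w (at_hit U (path w)
  (fun t => expR (p * Y t w - gbm_exponent mu sigma p * t)))%:E <= 1)%E.
Proof.
move=> oU; under eq_integral do rewrite at_hit_log.
exact: (gbm_exp_at_hit_le1 filtrationF brownianW sigma0 x0 gbmX p (open_log oU)).
Qed.

Section tonelli.
Variables (U : set R) (phi : R -> Om -> R).
Hypotheses (oU : open U) (mphi : forall t, 0 <= t -> measurable_fun setT (phi t))
  (cphi : continuous_paths phi) (phi0 : forall t w, 0 <= phi t w).

Let h s w := at_hit U (path w) (fun t => expR (- rate s * t) * expR (- alpha s * phi t w)).

Let one w := at_hit U (path w) (fun=> 1).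
Let tau w := at_hit U (path w) id.
Let phi_tau w := at_hit U (path w) (phi^~ w).

(** Written in terms of three functionals of w alone, the integrand becomes jointly measurable in
    (s, w). The factor [one] is 0 on paths that never reach [U], where [tau] has no meaning. *)
Let hE s w : h s w = one w * (expR (- rate s * tau w) * expR (- alpha s * phi_tau w)).
Proof.
rewrite /h /one /tau /phi_tau; case: (hit_dichotomy U (path w)) => [e|[t t0 e]].
  by rewrite !(at_hit_oo _ e) mul0r.
by rewrite !(at_hitE _ e) mul1r.
Qed.

Let mh : measurable_fun setT (fun z : measurableTypeR R * Om => (h z.1 z.2)%:E).
Proof.
have m1 : measurable_fun setT one.
  apply: (measurable_price_at_hit (Z := fun _ _ => 1)) => // w.
  by apply: continuous_subspaceT => t; exact: cvg_cst.
have mtau : measurable_fun setT tau.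
  apply: (measurable_price_at_hit (Z := fun t _ => t)) => // w.
  by apply: continuous_subspaceT => t; exact: cvg_id.
have mphit : measurable_fun setT phi_tau by exact: measurable_price_at_hit.
apply/measurable_EFinP; under eq_fun do rewrite hE.
apply: measurable_funM; first exact: (measurableT_comp m1 measurable_snd).
apply: measurable_funM; apply: measurableT_comp => //; apply: measurable_funM.
- apply: measurableT_comp => //.
  exact: (measurableT_comp (measurable_rate beta) measurable_fst).
- exact: (measurableT_comp mtau measurable_snd).
- apply: measurableT_comp => //.
  exact: (measurableT_comp (measurable_alpha mu sigma beta) measurable_fst).
- exact: (measurableT_comp mphit measurable_snd).
Qed.

Let h0 (z : measurableTypeR R * Om) : (0 <= (h z.1 z.2)%:E)%E.
Proof. by rewrite lee_fin; apply: at_hit_ge0 => t _ _; rewrite mulr_ge0 ?expR_ge0. Qed.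

Lemma mixture_at_hit :
  (\int[P]_w (at_hit U (path w) (fun t => mixture t (phi t w)))%:E =
   \int[Q]_s \int[P]_w (h s w)%:E)%E.
Proof.
have -> := @fubini_tonelli _ _ _ _ _ Q P _ mh h0.
apply: eq_integral => w _; rewrite /h.
case: (hit_dichotomy U (path w)) => [e|[t t0 e]].
  by rewrite (at_hit_oo _ e) integral0_eq// => s _; rewrite at_hit_oo.
rewrite (at_hitE _ e) /mixture -Rintegral_EFin.
  by apply: eq_integral => s _; rewrite (at_hitE _ e).
exact: integrable_mixture.
Qed.

Lemma measurable_mixture_inner :
  measurable_fun setT (fun s : measurableTypeR R => \int[P]_w (h s w)%:E)%E.
Proof. exact: (@measurable_fun_fubini_tonelli_F _ _ _ _ _ P _ mh h0). Qed.

Lemma measurable_at_hit_mixture :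
  measurable_fun setT (fun w => at_hit U (path w) (fun t => mixture t (phi t w))).
Proof.
have := @measurable_fun_fubini_tonelli_G _ _ _ _ _ Q _ mh h0.
move=> mG; apply/measurable_EFinP; move: mG; congr (measurable_fun _ _).
apply/funext => w /=; rewrite /fubini_G /h/=.
case: (hit_dichotomy U (path w)) => [e|[t t0 e]].
  by rewrite (at_hit_oo _ e) integral0_eq// => s _; rewrite at_hit_oo.
rewrite (at_hitE _ e) /mixture -Rintegral_EFin.
  by apply: eq_integral => s _; rewrite (at_hitE _ e).
exact: integrable_mixture.
Qed.

End tonelli.

(** The positive part keeps the second argument of [mixture] nonnegative for every path and time,
    which makes its integrand bounded; where the value matters, the price is at least b. *)
Lemma measurable_log_excess b t : 0 <= t ->
  measurable_fun setT (fun w => Num.max (ln (X t w / b)) 0).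
Proof.
move=> t0; apply: measurable_maxr => //; apply: measurableT_comp => //.
by apply: measurable_funM => //; exact: measurable_price.
Qed.

Lemma log_excessE b t w : 0 < b -> 0 <= t -> ln (X t w / b) = Y t w + ln (x / b).
Proof.
move=> b0 t0; rewrite [in LHS](log_priceK x0 gbmX w t0) mulrAC.
by rewrite [LHS]lnM ?posrE ?divr_gt0 ?expR_gt0// expRK addrC.
Qed.

Lemma log_excess_continuous b : 0 < b ->
  continuous_paths (fun t w => Num.max (ln (X t w / b)) 0).
Proof.
move=> b0 w.
have E : {in `[0, +oo[%classic, (fun t => Num.max (Y t w + ln (x / b)) 0) =1
    (fun t => Num.max (ln (X t w / b)) 0)}.
  by move=> t; rewrite inE/= in_itv/= andbT => t0; rewrite log_excessE.
apply: (subspace_eq_continuous E).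
move=> t; apply: (@cvg_comp _ _ _ _ (fun y : R => Num.max (y + ln (x / b)) 0)); last first.
  apply: (@continuous_max R R (fun y => y + ln (x / b)) (cst 0)); last exact: cvg_cst.
  by apply: (@cvgD R R^o); [exact: cvg_id|exact: cvg_cst].
exact: (log_price_continuous x0 gbmX).
Qed.

(** For each s the exponent - alpha s has g equal to the rate at s, so the integrand is exp(-
    alpha_s ln(x/b)) times an exponential martingale at the hitting time, and exponentials stopped
    there have expectation at most 1. The mixture over s is exchanged with the expectation by
    Tonelli. *)
Lemma mixture_supermartingale U b : open U -> 0 < b -> b <= x ->
  (forall w t, 0 <= t -> hit U (path w) = t%:E -> b <= X t w) ->
  (\int[P]_w (at_hit U (path w)
     (fun t => mixture t (Num.max (ln (X t w / b)) 0)))%:E <=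
   (mixture 0 (ln (x / b)))%:E)%E.
Proof.
move=> oU b0 bx bX.
have u0 : 0 <= ln (x / b) by rewrite ln_ge0// ler_pdivlMr ?mul1r.
have e0 t w : 0 <= Num.max (ln (X t w / b)) 0 by rewrite le_max lexx orbT.
have ce := log_excess_continuous b0.
have mI := measurable_mixture_inner oU (measurable_log_excess b) ce.
rewrite (mixture_at_hit oU (measurable_log_excess b) ce e0).
have -> : (mixture 0 (ln (x / b)))%:E =
    (\int[Q]_s (expR (- rate s * 0) * expR (- alpha s * ln (x / b)))%:E)%E.
  by rewrite Rintegral_EFin//; exact: integrable_mixture.
apply: ge0_ae_le_integral.
- move=> s; apply: integral_ge0 => w _; rewrite lee_fin.
  by apply: at_hit_ge0 => t _ _; rewrite mulr_ge0 ?expR_ge0.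
- by move=> s; rewrite lee_fin mulr_ge0 ?expR_ge0.
apply: aeW => s; rewrite mulr0 expR0 mul1r.
set A := expR (- alpha s * ln (x / b)).
set M := fun w => at_hit U (path w)
  (fun t => expR (- alpha s * Y t w - gbm_exponent mu sigma (- alpha s) * t)).
have M0 w : 0 <= M w by apply: at_hit_ge0 => t _ _; exact: expR_ge0.
have mM : measurable_fun setT (EFin \o M).
  apply/measurable_EFinP; apply: (measurable_price_at_hit
    (Z := exp_process Y (gbm_exponent mu sigma) (- alpha s))) => //.
    by move=> t t0; exact: (measurable_exp_process (exp_process_expectation filtrationF brownianW sigma0 x0 gbmX)).
  by apply: exp_process_continuous; exact: (log_price_continuous x0 gbmX).
have M0' w : setT w -> (0 <= (EFin \o M) w)%E by move=> _; rewrite lee_fin.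
have A0 : (0 <= A%:E)%E by rewrite lee_fin expR_ge0.
apply: (@le_trans _ _ (A%:E * \int[P]_w (M w)%:E)%E); last first.
  rewrite -[leRHS]mule1 lee_wpmul2l//; exact: price_exp_at_hit_le1.
rewrite -(ge0_integralZl P measurableT mM M0' A0).
apply: ge0_ae_le_integral.
- move=> w; rewrite lee_fin; apply: at_hit_ge0 => t _ _.
  by rewrite mulr_ge0 ?expR_ge0.
- by move=> w; rewrite -EFinM lee_fin mulr_ge0 ?expR_ge0.
apply: aeW => w; rewrite -EFinM lee_fin /M.
case: (hit_dichotomy U (path w)) => [e|[t t0 e]].
  by rewrite !(at_hit_oo _ e) mulr0.
rewrite !(at_hitE _ e) (gbm_exponent_alpha mu sigma0 beta0) /A -!expRD ler_expR.
have Xb := bX w t t0 e.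
rewrite max_l; last by rewrite ln_ge0// ler_pdivlMr ?mul1r.
rewrite log_excessE//.
by rewrite le_eqVlt; apply/orP; left; apply/eqP; ring.
Qed.

Lemma level_below p l y : p < 0 -> 0 < l -> (x * expR y < l) = (p * ln (l / x) < p * y).
Proof.
move=> p0 l0; rewrite [RHS]ltr_nM2l// -[RHS]ltr_expR lnK ?posrE ?divr_gt0//.
by rewrite ltr_pdivlMr// mulrC.
Qed.

Lemma level_above p l y : 0 < p -> 0 < l -> (l < x * expR y) = (p * ln (l / x) < p * y).
Proof.
move=> p0 l0; rewrite [RHS]ltr_pM2l// -[RHS]ltr_expR lnK ?posrE ?divr_gt0//.
by rewrite ltr_pdivrMr// mulrC.
Qed.

Lemma level_below_le p l y : p < 0 -> 0 < l ->
  (x * expR y <= l) = (p * ln (l / x) <= p * y).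
Proof.
move=> p0 l0; rewrite [RHS]ler_nM2l// -[RHS]ler_expR lnK ?posrE ?divr_gt0//.
by rewrite ler_pdivlMr// mulrC.
Qed.

Lemma level_above_le p l y : 0 < p -> 0 < l ->
  (l <= x * expR y) = (p * ln (l / x) <= p * y).
Proof.
move=> p0 l0; rewrite [RHS]ler_pM2l// -[RHS]ler_expR lnK ?posrE ?divr_gt0//.
by rewrite ler_pdivrMr// mulrC.
Qed.

(** The rate 1 is an arbitrary positive choice: the almost sure statements below only use the signs
    of the two exponents and the positivity of g there. *)
Let lr0 : 0 < lroot 1. Proof. exact: lower_root_gt0. Qed.
Let ur0 : 0 < uroot 1. Proof. exact: upper_root_gt0. Qed.
Let gl : 0 < gbm_exponent mu sigma (- lroot 1).
Proof. by rewrite gbm_exponent_lower. Qed.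
Let gu : 0 < gbm_exponent mu sigma (uroot 1).
Proof. by rewrite gbm_exponent_upper. Qed.

Lemma hit_below_closed l : 0 < l -> l < x ->
  {ae P, forall w, hit [set y | y <= l] (path w) = hit [set y | y < l] (path w)}.
Proof.
move=> l0 lx; have nl : - lroot 1 < 0 by rewrite oppr_lt0.
have c0 : 0 < - lroot 1 * ln (l / x).
  by rewrite nmulr_rgt0// ln_lt0// divr_gt0//= ltr_pdivrMr// mul1r.
apply: filterS (hit_level_closed filtrationF brownianW sigma0 x0 gbmX gl c0) => w.
rewrite !hit_log; congr (_ = _); congr hit; apply/seteqP; split=> y /=;
  by rewrite ?(level_below _ nl l0) ?(level_below_le _ nl l0).
Qed.

Lemma hit_above_closed r : x < r ->
  {ae P, forall w, hit [set y | r <= y] (path w) = hit [set y | r < y] (path w)}.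
Proof.
move=> xr; have r0 : 0 < r := lt_trans x0 xr.
have c0 : 0 < uroot 1 * ln (r / x).
  by rewrite mulr_gt0// ln_gt0// ltr_pdivlMr// mul1r.
apply: filterS (hit_level_closed filtrationF brownianW sigma0 x0 gbmX gu c0) => w.
rewrite !hit_log; congr (_ = _); congr hit; apply/seteqP; split=> y /=;
  by rewrite ?(level_above _ ur0 r0) ?(level_above_le _ ur0 r0).
Qed.

Lemma hit_below_start : {ae P, forall w, hit [set y | y < x] (path w) = 0%E}.
Proof.
have nl : - lroot 1 < 0 by rewrite oppr_lt0.
apply: filterS (hit_level0 filtrationF brownianW sigma0 x0 gbmX gl) => w <-.
rewrite hit_log; congr hit; apply/seteqP; split=> y /=;
  by rewrite (level_below _ nl x0) divff ?gt_eqF// ln1 mulr0.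
Qed.

Lemma hit_above_start : {ae P, forall w, hit [set y | x < y] (path w) = 0%E}.
Proof.
apply: filterS (hit_level0 filtrationF brownianW sigma0 x0 gbmX gu) => w <-.
rewrite hit_log; congr hit; apply/seteqP; split=> y /=;
  by rewrite (level_above _ ur0 x0) divff ?gt_eqF// ln1 mulr0.
Qed.

Lemma hit_below_laplace q l : 0 < q -> 0 < l -> l <= x ->
  (\int[P]_w (at_hit [set y | (y < l)%R] (path w) (fun t => expR (- q * t)))%:E =
   (expR (- lroot q * ln (x / l)))%:E)%E.
Proof.
move=> q0 l0 lx; have nl : - lroot q < 0 by rewrite oppr_lt0 lower_root_gt0.
have c0 : 0 <= - lroot q * ln (l / x).
  by rewrite nmulr_rge0// ln_le0// ler_pdivrMr// mul1r.
have gq : gbm_exponent mu sigma (- lroot q) = q by rewrite gbm_exponent_lower// ltW.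
have g0 : 0 < gbm_exponent mu sigma (- lroot q) by rewrite gq.
have := hit_laplace filtrationF brownianW sigma0 x0 gbmX g0 c0.
rewrite gq -[x / l]invf_div lnV ?posrE ?divr_gt0// mulrN => <-.
apply: eq_integral => w _; rewrite at_hit_log; congr (at_hit _ _ _)%:E.
by apply/seteqP; split=> y /=; rewrite (level_below _ nl l0).
Qed.

(** The discount is the mixture at excess 0, so its expectation is the mean over s of the Laplace
    transforms in [hit_below_laplace]. Those require a positive rate, which holds for almost every
    s. *)
Lemma hit_below_discount b : 0 < b -> b <= x ->
  ((mixture 0 (ln (x / b)))%:E <= \int[P]_w (at_hit [set y | (y < b)%R] (path w)
     (hyperbolic_discount beta))%:E)%E.
Proof.
move=> b0 bx; have oU : open [set y : R | y < b] by exact: open_lt.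
have u0 : 0 <= ln (x / b) by rewrite ln_ge0// ler_pdivlMr ?mul1r.
have -> : (\int[P]_w (at_hit [set y | (y < b)%R] (path w)
    (hyperbolic_discount beta))%:E = \int[P]_w (at_hit [set y | (y < b)%R] (path w)
    (fun t => mixture t ((fun _ _ => 0%R) t w)))%:E)%E.
  apply: eq_integral => w _; congr _%:E; apply: at_hit_ext => t t0 _.
  rewrite /mixture; under eq_Rintegral do rewrite mulr0 expR0 mulr1.
  by rewrite /Rintegral discount_mixture.
rewrite (mixture_at_hit oU) //; last first.
  by move=> w; apply: continuous_subspaceT => t; exact: cvg_cst.
have -> : (mixture 0 (ln (x / b)))%:E =
    (\int[Q]_s (expR (- rate s * 0) * expR (- alpha s * ln (x / b)))%:E)%E.
  by rewrite Rintegral_EFin//; exact: integrable_mixture.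
apply: ge0_ae_le_integral.
- by move=> s; rewrite lee_fin mulr_ge0 ?expR_ge0.
- move=> s; apply: integral_ge0 => w _; rewrite lee_fin.
  by apply: at_hit_ge0 => t _ _; rewrite mulr_ge0 ?expR_ge0.
have [N [mN N0 sN]] := unit_exponential_gt0 R; exists N; split=> //.
apply: subset_trans sN => s /=; apply: contra_not => s0.
have rs0 : 0 < rate s by rewrite /rate max_l ?mulr_gt0// ltW.
rewrite mulr0 expR0 mul1r -(hit_below_laplace rs0 b0 bx).
rewrite le_eqVlt; apply/orP; left; apply/eqP; apply: eq_integral => w _; congr _%:E.
by apply: at_hit_ext => t _ _; rewrite mulr0 expR0 mulr1.
Qed.

End price_hitting.

(** * Crossing arguments for continuous paths *)

Section crossing.
Context (R : realType).
Implicit Types (B U : set R) (x y : R) (z : R -> R).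

Lemma closure_between B x y y' : closure B x -> y < x -> x < y' ->
  exists2 b, B b & y < b < y'.
Proof.
move=> clB yx xy; suff [b [Bb [/= h1 h2]]] : B `&` ([set u | y < u] `&` [set u | u < y']) !=set0.
  by exists b => //; rewrite h1 h2.
apply: clB; apply: open_nbhs_nbhs; split=> //.
by apply: openI; [exact: open_gt|exact: open_lt].
Qed.

Lemma not_closure_dist B x : ~ closure B x ->
  exists2 e : R, 0 < e & forall b, B b -> e <= `|x - b|.
Proof.
move/existsNP => [N /not_implyP[/nbhs_ballP[e /= e0 eN] /set0P/negP]].
rewrite negbK => /eqP BN; exists e => // b Bb; rewrite leNgt; apply/negP => be.
by suff : (B `&` N) b; [rewrite BN|split=> //; exact: eN].
Qed.

Lemma hit_open_notin U z t : open U -> {within `[0, +oo[, continuous z} ->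
  ~ U (z 0) -> hit U z = t%:E -> ~ U (z t).
Proof.
move=> oU cz nU0 ht.
have t0 : 0 <= t by have := hit_ge0 U z; rewrite ht lee_fin.
apply: (open_first_notin oU cz t0 nU0) => s s0 st.
have sh : (s%:E < hit U z)%E by rewrite ht lte_fin.
exact: (@hit_gt R U z s s0 sh).
Qed.

Lemma path_crossing z s t b : {within `[0, +oo[, continuous z} ->
  0 <= s -> 0 <= t -> z s <= b -> b <= z t ->
  exists2 c, Num.min s t <= c <= Num.max s t & z c = b.
Proof.
move=> /continuous_clamp cz s0 t0 zs zt.
have zE c : 0 <= c -> z (Num.max c 0) = z c by move=> c0; rewrite max_l.
have [st|/ltW ts] := leP s t.
  have [||c] := @IVT R (fun c => z (Num.max c 0)) s t b st.
  - exact: continuous_subspaceT.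
  - by rewrite !zE// ge_min le_max zs zt orbT.
  rewrite in_itv/= => /andP[sc ct] zc.
  by exists c; [rewrite sc ct|rewrite -zc zE// (le_trans s0 sc)].
have [||c] := @IVT R (fun c => z (Num.max c 0)) t s b ts.
- exact: continuous_subspaceT.
- by rewrite !zE// ge_min le_max zs zt orbT.
rewrite in_itv/= => /andP[tc cs] zc.
by exists c; [rewrite tc cs|rewrite -zc zE// (le_trans t0 tc)].
Qed.

(* The points that a path started at [x] cannot reach without first visiting [B]. *)
Definition beyond B (x : R) : set R :=
  [set y | exists2 b, B b & (y < b < x) || (x < b < y)].

Lemma open_beyond B x : open (beyond B x).
Proof.
rewrite (_ : beyond B x = \bigcup_(b in B) ([set y | y < b < x] `|` [set y | x < b < y])).
  apply: bigcup_open => b _; apply: openU.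
    have [bx|bx] := boolP (b < x).
      by rewrite (_ : [set y | _] = [set y | y < b]) ?open_lt//; apply/seteqP; split=> y /=; rewrite andbT.
    by rewrite (_ : [set y | _] = set0) ?open0//; apply/seteqP; split=> y //=; rewrite andbF.
  have [bx|bx] := boolP (x < b).
    by rewrite (_ : [set y | _] = [set y | b < y]) ?open_gt//; apply/seteqP; split=> y /=.
  by rewrite (_ : [set y | _] = set0) ?open0//; apply/seteqP; split=> y //=.
apply/seteqP; split=> y.
  by move=> [b Bb /orP[h|h]]; exists b => //; [left|right].
by move=> [b Bb [h|h]]; exists b => //; apply/orP; [left|right].
Qed.

Lemma hit_le_beyond B z : {within `[0, +oo[, continuous z} ->
  (hit B z <= hit (beyond B (z 0%R)) z)%E.
Proof.
move=> cz; apply: le_ereal_inf_tmp => _ [t [t0 [b Bb h]] <-].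
have [c ct zc] : exists2 c, 0 < c <= t & z c = b.
  case/orP: h => /andP[h1 h2].
    have [c] := path_crossing cz (ltW t0) (lexx 0) (ltW h1) (ltW h2).
    rewrite (min_r (ltW t0)) (max_l (ltW t0)) => /andP[c0 ct] zc; exists c => //; rewrite ct andbT.
    by rewrite lt_neqAle c0 andbT; apply/eqP => c0'; move: h2; rewrite -zc -c0' ltxx.
  have [c] := path_crossing cz (lexx 0) (ltW t0) (ltW h1) (ltW h2).
  rewrite (min_l (ltW t0)) (max_r (ltW t0)) => /andP[c0 ct] zc; exists c => //; rewrite ct andbT.
  by rewrite lt_neqAle c0 andbT; apply/eqP => c0'; move: h1; rewrite -zc -c0' ltxx.
case/andP: ct => c0 ct; apply: (@le_trans _ _ c%:E); last by rewrite lee_fin.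
by apply: (@hit_le R B z c c0); rewrite zc.
Qed.

(** Within any short time the path is seen strictly below and strictly above its start; some point
    of B lies between the two values and is crossed in the meantime. *)
Lemma hit_closure_start B z : {within `[0, +oo[, continuous z} -> closure B (z 0) ->
  hit [set y | y < z 0] z = 0%E -> hit [set y | z 0 < y] z = 0%E -> hit B z = 0%E.
Proof.
move=> cz clB h1 h2; apply/eqP; rewrite eq_le hit_ge0 andbT.
apply/lee_addgt0Pr => e e0; rewrite add0e.
have : (hit [set y | (y < z 0)%R] z < e%:E)%E by rewrite h1 lte_fin.
move=> /hit_ltP[s [s0 /= zs]]; rewrite lte_fin => se.
have : (hit [set y | (z 0 < y)%R] z < e%:E)%E by rewrite h2 lte_fin.
move=> /hit_ltP[t [t0 /= zt]]; rewrite lte_fin => te.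
have [b Bb /andP[b1 b2]] := closure_between clB zs zt.
have [c /andP[c1 c2] zc] := path_crossing cz (ltW s0) (ltW t0) (ltW b1) (ltW b2).
have c0 : 0 < c by apply: lt_le_trans c1; rewrite lt_min s0 t0.
apply: (@le_trans _ _ c%:E); first by apply: (@hit_le R B z c c0); rewrite zc.
by rewrite lee_fin (le_trans c2)// ge_max !ltW.
Qed.

End crossing.

(** * Stopping regions of the put *)

Section put_regions.
Context d (Om : measurableType d) (R : realType) (P : probability Om R).
Variables (F : R -> set (set Om)) (W : R -> Om -> R) (X : R -> R -> Om -> R).
Variables mu sigma K beta : R.
Hypotheses (sigma0 : 0 < sigma) (K0 : 0 < K) (beta0 : 0 < beta).
Hypotheses (filtrationF : filtration F) (brownianW : brownian_motion P F W).
Hypothesis gbmX : forall x : R, 0 < x -> geometric_brownian_motion P F W mu sigma x (X x).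
Local Notation f := (put_payoff K).
Local Notation delta := (hyperbolic_discount beta).
Local Notation lam := (lambda mu sigma beta).
Local Notation J := (J P X f delta).
Local Notation path x w := (fun t => X x t w).
Local Notation mixture := (mixture mu sigma beta).
Implicit Types (B : set R) (x : R).

Lemma J_at_hit x B : 0 < x -> J x B =
  (\int[P]_w (at_hit B (path x w) (fun t => (delta t * f (X x t w))%R))%:E)%E.
Proof.
move=> x0; apply: eq_integral => w _; apply: stopped_payoffE => // t t0.
by apply: ltW; exact: (price_gt0 (gbmX x0)).
Qed.

Lemma J_le x B (k : Om -> R) : 0 < x -> (forall w, 0 <= k w) ->
  {ae P, forall w, at_hit B (path x w) (fun t => delta t * f (X x t w)) <= k w} ->
  (J x B <= \int[P]_w (k w)%:E)%E.
Proof.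
move=> x0 k0 hk; rewrite (J_at_hit _ x0); apply: ge0_ae_le_integral.
- by move=> w; rewrite lee_fin; exact: (at_hit_payoff_ge0 K beta0).
- by move=> w; rewrite lee_fin.
- by apply: filterS hk => w; rewrite lee_fin.
Qed.

(** By regularity of the starting point the region is hit at once, almost surely, and the payoff
    collected is f(x). *)
Lemma J_closure x B : 0 < x -> closure B x -> (J x B <= (f x)%:E)%E.
Proof.
move=> x0 clB.
have -> : (f x)%:E = (\int[P]_w (f x)%:E)%E.
  by rewrite integral_cst//= probability_setT mule1.
apply: J_le => //; first by move=> w; exact: put_payoff_ge0.
near=> w.
have X0 : X x 0 w = x := price0 (gbmX x0) w.
have h1 : hit [set y | y < x] (path x w) = 0%E.
  by near: w; exact: (hit_below_start filtrationF brownianW sigma0 x0 (gbmX x0)).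
have h2 : hit [set y | x < y] (path x w) = 0%E.
  by near: w; exact: (hit_above_start filtrationF brownianW sigma0 x0 (gbmX x0)).
have cX := price_continuous (gbmX x0) (w := w).
rewrite (@at_hitE _ _ _ _ 0).
  by rewrite discount0 mul1r X0.
by apply: (hit_closure_start cX); rewrite X0.
Unshelve. all: by end_near.
Qed.

(** Waiting until the price reaches a region above c pays at most K - c, while stopping at x < c
    pays K - x. *)
Lemma J_lower_bound x B (c : R) : 0 < x -> x < c -> c < K -> B `<=` [set y | c <= y] ->
  (J x B < (f x)%:E)%E.
Proof.
move=> x0 xc cK Bc; apply: (@le_lt_trans _ _ (K - c)%:E); last first.
  by rewrite lte_fin put_payoffE ?(ltW (lt_trans xc cK))// ltrD2l ltrN2.
have -> : (K - c)%:E = (\int[P]_w (K - c)%:E)%E.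
  by rewrite integral_cst//= probability_setT mule1.
have Kc : 0 <= K - c by rewrite subr_ge0 ltW.
apply: J_le => //; apply: aeW => w.
case: (hit_dichotomy B (path x w)) => [e|[t t0 e]]; first by rewrite at_hit_oo.
have Xc : c <= X x t w.
  have := hit_closed (@closed_ge R c) Bc (price_continuous (gbmX x0) (w := w)) e.
  by [].
rewrite (at_hitE _ e) -[leRHS]mul1r ler_pM ?put_payoff_ge0 ?(ltW (discount_gt0 _ _))//.
  exact: discount_le1.
by rewrite (le_trans (put_payoff_le K Xc))// put_payoffE// ltW.
Qed.

(** Off its closure, B stays at a positive distance from x, below some sup L < x and above some inf
    L > x. A visit to B is a visit to one of the closed half-lines at these levels, almost surely
    reached at the same time as the open one, and entering the open half-line already means passing
    a point of B. The converse inequality is the intermediate value theorem. *)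
Lemma hit_gap x B : 0 < x -> B `<=` [set y | 0 < y] -> ~ closure B x ->
  {ae P, forall w, hit B (path x w) = hit (beyond B x) (path x w)}.
Proof.
move=> x0 B0 nB.
have [e e0 eB] := not_closure_dist nB.
have le_beyond w : (hit B (path x w) <= hit (beyond B x) (path x w))%E.
  have := hit_le_beyond B (price_continuous (gbmX x0) (w := w)).
  by rewrite (price0 (gbmX x0)).
have below : {ae P, forall w t, 0 < t -> B (X x t w) -> X x t w < x ->
    (hit (beyond B x) (path x w) <= t%:E)%E}.
  pose L := [set b | B b /\ b < x].
  have [[b0 Lb0]|L0] := pselect (L !=set0); last first.
    by apply: aeW => w t t0 Bt tx; exfalso; apply: L0; exists (X x t w).
  have Lx : ubound L (x - e).
    move=> b [Bb bx]; have := eB b Bb; rewrite ger0_norm ?subr_ge0 ?(ltW bx)//; lra.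
  have hsL : has_sup L by split; [exists b0|exists (x - e)].
  have lx : sup L < x by have := ge_sup (ex_intro _ _ Lb0) Lx; have := e0; lra.
  have l0 : 0 < sup L.
    apply: lt_le_trans (ub_le_sup hsL.2 Lb0); exact: B0 Lb0.1.
  apply: filterS (hit_below_closed filtrationF brownianW sigma0 x0 (gbmX x0) l0 lx) => w hw.
  move=> t t0 Bt tx; have tl : X x t w <= sup L by exact: (ub_le_sup hsL.2 (conj Bt tx)).
  apply: (le_trans _ (@hit_le R [set y | y <= sup L] (path x w) t t0 tl)).
  rewrite hw; apply: hit_subset => s s0 /= sl.
  have [b [Bb bx] sb] := sup_gt (ex_intro _ _ Lb0) sl.
  by exists b => //; rewrite sb bx.
have above : {ae P, forall w t, 0 < t -> B (X x t w) -> x < X x t w ->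
    (hit (beyond B x) (path x w) <= t%:E)%E}.
  pose L := [set b | B b /\ x < b].
  have [[b0 Lb0]|L0] := pselect (L !=set0); last first.
    by apply: aeW => w t t0 Bt tx; exfalso; apply: L0; exists (X x t w).
  have Lx : lbound L (x + e).
    move=> b [Bb bx]; have := eB b Bb; rewrite ltr0_norm ?subr_lt0// opprB; lra.
  have hiL : has_inf L by split; [exists b0|exists (x + e)].
  have lx : x < inf L by have := lb_le_inf (ex_intro _ _ Lb0) Lx; have := e0; lra.
  apply: filterS (hit_above_closed filtrationF brownianW sigma0 x0 (gbmX x0) lx) => w hw.
  move=> t t0 Bt tx; have tl : inf L <= X x t w by exact: (ge_inf hiL.2 (conj Bt tx)).
  apply: (le_trans _ (@hit_le R [set y | inf L <= y] (path x w) t t0 tl)).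
  rewrite hw; apply: hit_subset => s s0 /= sl.
  have [b [Bb bx] sb] := inf_lt (ex_intro _ _ Lb0) sl.
  by exists b => //; rewrite sb bx orbT.
near=> w; apply/eqP; rewrite eq_le le_beyond/=.
apply: le_ereal_inf_tmp => _ [t [t0 Bt] <-].
have [tx|tx|tx] := ltgtP (X x t w) x.
- by move: t t0 Bt tx; near: w.
- by move: t t0 Bt tx; near: w.
- by have := eB _ Bt; rewrite tx subrr normr0 leNgt e0.
Unshelve. all: by end_near.
Qed.

Lemma beyond_notin x B w t : 0 < x -> hit (beyond B x) (path x w) = t%:E ->
  ~ beyond B x (X x t w).
Proof.
move=> x0; apply: hit_open_notin.
- exact: open_beyond.
- exact: (price_continuous (gbmX x0)).
rewrite (price0 (gbmX x0)) => -[b _ /orP[/andP[h1 h2]|/andP[h1 h2]]].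
  by have := lt_trans h1 h2; rewrite ltxx.
by have := lt_trans h1 h2; rewrite ltxx.
Qed.

(** Below c the path would have passed points of B close to c, and so would lie in the open set
    [beyond B x]; at its hitting time it does not yet. *)
Lemma closure_le_hit x B c w t : 0 < x -> closure B c -> c < x ->
  hit (beyond B x) (path x w) = t%:E -> c <= X x t w.
Proof.
move=> x0 clB cx ht; rewrite leNgt; apply/negP => Xc; apply: (beyond_notin x0 ht).
have [b Bb /andP[b1 b2]] := closure_between clB Xc cx.
by exists b => //; rewrite b1 b2.
Qed.

Lemma continuous_discount_paths : continuous_paths (fun t (_ : Om) => delta t).
Proof.
move=> w.
have E : {in `[0, +oo[%classic, (fun t : R => delta (Num.max t 0)) =1 delta}.
  by move=> t; rewrite inE/= in_itv/= andbT => t0; rewrite max_l.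
apply: (subspace_eq_continuous E); apply: continuous_subspaceT.
exact: continuous_discount_clamp.
Qed.

Lemma measurable_at_hit_discount x U : 0 < x -> open U ->
  measurable_fun setT (fun w => at_hit U (path x w) delta).
Proof.
move=> x0 oU; apply: (measurable_price_at_hit filtrationF (gbmX x0) (Z := fun t _ => delta t)) => //.
exact: continuous_discount_paths.
Qed.

(** Above c the payoff is K - c times 1 - k (y/c - 1) with k = c/(K - c). Writing k = q lambda
    splits it into the constant 1, with weight 1 - q, and the function bounded by the mixture, with
    weight q. *)
Lemma put_payoff_split c q y : 0 < c -> c < K -> 0 <= q <= 1 -> q * lam = c / (K - c) ->
  c <= y -> f y <= (K - c) * ((1 - q) + q * Num.max (1 - lam * (expR (ln (y / c)) - 1)) 0).
Proof.
move=> c0 cK /andP[q0 q1] ql cy; have Kc : 0 < K - c by rewrite subr_gt0.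
have y0 : 0 < y := lt_le_trans c0 cy.
rewrite lnK ?posrE ?divr_gt0//; set m := Num.max _ _.
have m0 : 0 <= m by rewrite /m le_max lexx orbT.
have m1 : 1 - lam * (y / c - 1) <= m by rewrite /m le_max lexx.
rewrite /put_payoff ge_max; apply/andP; split; last first.
  by rewrite mulr_ge0 ?(ltW Kc)// addr_ge0 ?subr_ge0// mulr_ge0.
apply: (@le_trans _ _ ((K - c) * ((1 - q) + q * (1 - lam * (y / c - 1))))); last first.
  by rewrite (ler_wpM2l (ltW Kc))// lerD2l ler_wpM2l.
rewrite (_ : 1 - q + q * (1 - lam * (y / c - 1)) = 1 - q * lam * (y / c - 1)); last by ring.
by rewrite ql le_eqVlt; apply/orP; left; apply/eqP; field; rewrite !gt_eqF.
Qed.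

(** The weight q goes to the mixture, a supermartingale; the weight 1 - q to the bare discount,
    bounded by E. Optimality uses q = 1, the exclusion of gaps uses q < 1. *)
Lemma J_beyond_le x B c q E : 0 < x -> B `<=` [set y | 0 < y] -> ~ closure B x ->
  0 < c -> c <= x -> c < K ->
  (forall w t, hit (beyond B x) (path x w) = t%:E -> c <= X x t w) ->
  0 <= q <= 1 -> q * lam = c / (K - c) ->
  (\int[P]_w (at_hit (beyond B x) (path x w) delta)%:E <= E%:E)%E ->
  (J x B <= ((K - c) * ((1 - q) * E + q * mixture 0 (ln (x / c))))%:E)%E.
Proof.
move=> x0 B0 nB c0 cx cK cX q01 ql dE; have /andP[q0 q1] := q01.
have Kc : 0 < K - c by rewrite subr_gt0.
pose U := beyond B x; have oU : open U by exact: open_beyond.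
pose D w := at_hit U (path x w) delta.
pose M w := at_hit U (path x w) (fun t => mixture t (Num.max (ln (X x t w / c)) 0)).
have e0 t w : 0 <= Num.max (ln (X x t w / c)) 0 by rewrite le_max lexx orbT.
have ce := log_excess_continuous x0 (gbmX x0) c0.
have mDe : measurable_fun setT (EFin \o D).
  by apply/measurable_EFinP; exact: measurable_at_hit_discount.
have mMe : measurable_fun setT (EFin \o M).
  apply/measurable_EFinP.
  exact: (measurable_at_hit_mixture filtrationF sigma0 beta0 (gbmX x0) oU
    (measurable_log_excess filtrationF (gbmX x0) c) ce e0).
have D0 w : 0 <= D w by apply: at_hit_ge0 => t t0 _; exact/ltW/discount_gt0.
have M0 w : 0 <= M w.
  by apply: at_hit_ge0 => t t0 _; apply: Rintegral_ge0 => s _; rewrite mulr_ge0 ?expR_ge0.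
pose k1 := (K - c) * (1 - q); pose k2 := (K - c) * q.
have k10 : 0 <= k1 by rewrite mulr_ge0 ?subr_ge0// ltW.
have k20 : 0 <= k2 by rewrite mulr_ge0// ltW.
apply: (@le_trans _ _ (\int[P]_w (k1 * D w + k2 * M w)%:E)%E).
  apply: J_le => //; first by move=> w; rewrite addr_ge0// mulr_ge0.
  apply: filterS (hit_gap x0 B0 nB) => w hw.
  rewrite (_ : at_hit B _ _ = at_hit U (path x w) (fun t => delta t * f (X x t w))).
    rewrite /D /M; case: (hit_dichotomy U (path x w)) => [e|[t t0 e]].
      by rewrite !(at_hit_oo _ e) !mulr0 addr0.
    rewrite !(at_hitE _ e); have Xc := cX w t e.
    have u0 : 0 <= ln (X x t w / c) by rewrite ln_ge0// ler_pdivlMr ?mul1r.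
    rewrite max_l//.
    have dt := discount_gt0 beta0 t0.
    have h1 := ler_wpM2l (ltW dt) (put_payoff_split c0 cK q01 ql Xc).
    have h2 := ler_wpM2l k20 (mixture_ge mu sigma0 beta0 t0 u0).
    apply: (le_trans h1); move: h2; rewrite /k1 /k2; set m := Num.max _ _.
    set dl := delta t; set mx := mixture _ _ => h2.
    rewrite (_ : dl * _ = (K - c) * (1 - q) * dl + (K - c) * q * (dl * m)); last by ring.
    by rewrite lerD2l.
  by rewrite /at_hit hw.
have Z w : (k1 * D w + k2 * M w)%:E = (k1%:E * (EFin \o D) w + k2%:E * (EFin \o M) w)%E by [].
under eq_integral do rewrite Z.
have D0e w : setT w -> (0 <= (EFin \o D) w)%E by move=> _; rewrite lee_fin.
have M0e w : setT w -> (0 <= (EFin \o M) w)%E by move=> _; rewrite lee_fin.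
have k10e : (0 <= k1%:E)%E by rewrite lee_fin.
have k20e : (0 <= k2%:E)%E by rewrite lee_fin.
have m1 : measurable_fun setT (fun w => k1%:E * (EFin \o D) w)%E by exact: measurable_funeM.
have m2 : measurable_fun setT (fun w => k2%:E * (EFin \o M) w)%E by exact: measurable_funeM.
have p1 w : setT w -> (0 <= k1%:E * (EFin \o D) w)%E by move=> _; rewrite mule_ge0 ?lee_fin.
have p2 w : setT w -> (0 <= k2%:E * (EFin \o M) w)%E by move=> _; rewrite mule_ge0 ?lee_fin.
rewrite (ge0_integralD P measurableT p1 m1 p2 m2).
rewrite (ge0_integralZl P measurableT mDe D0e k10e) (ge0_integralZl P measurableT mMe M0e k20e).
rewrite (_ : ((K - c) * ((1 - q) * E + q * mixture 0 (ln (x / c))))%:E = (k1%:E * E%:E + k2%:E * (mixture 0 (ln (x / c)))%:E)%E); last first.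
  by rewrite -!EFinM -EFinD /k1 /k2; congr _%:E; ring.
apply: leeD; apply: lee_wpmul2l => //.
apply: (mixture_supermartingale filtrationF brownianW sigma0 beta0 x0 (gbmX x0) oU c0 cx) => w t _.
exact: cX.
Qed.

End put_regions.

(** * Elementary estimates near the lower end of a gap *)

Section expansions.
Context (R : realType).

(** The hyperbolic discount of an exit time has no simple expectation; a single exponential rate has
    one. The bound amounts to (1 + z)(1 + exp(-z)) >= 2. *)
Lemma discount_le_expR (beta t : R) : 0 < beta -> 0 <= t ->
  hyperbolic_discount beta t <= (1 + expR (- beta * t)) / 2.
Proof.
move=> beta0 t0; set z := beta * t; have z0 : 0 <= z by rewrite mulr_ge0// ltW.
rewrite /hyperbolic_discount -/z mulNr -/z mul1r.
pose h (y : R) := (1 + y) * (1 + expR (- y)) - 2.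
pose h' (y : R) := 1 - y * expR (- y).
have dh (y : R) : is_derive y 1 h (h' y).
  by rewrite /h /h'; apply: is_derive_eq; rewrite /GRing.scale/=; ring.
have h'0 (y : R) : 0 <= y -> 0 <= h' y.
  move=> y0; rewrite /h' subr_ge0 expRN ler_pdivrMr ?expR_gt0// mul1r.
  by have := expR_ge1Dx y; lra.
have := derive_ge0_le z0 dh h'0.
rewrite /h oppr0 expR0 addr0 mul1r subrr subr_ge0 => h2.
rewrite -[leLHS]mul1r ler_pdivrMr ?ltr_pwDl//.
by have := h2; lra.
Qed.

Lemma expR_le_quad (z : R) : 0 <= z -> z <= 2^-1 -> expR z <= 1 + z + 2 * z ^+ 2.
Proof.
move=> z0 z1; have h := expR_ge1Dx (- z).
have p : 0 < 1 - z by lra.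
rewrite -[leLHS]invrK -expRN; apply: (@le_trans _ _ (1 - z)^-1).
  by rewrite lef_pV2 ?posrE ?expR_gt0.
rewrite -[leLHS]mul1r ler_pdivrMr//.
have : 0 <= z ^+ 2 * (1 - 2 * z) by rewrite mulr_ge0 ?sqr_ge0//; lra.
by lra.
Qed.

(** A exp(-a u) + B exp(b u) equals 1 at both ends of [0, D]: it is the Laplace transform at rate
    beta of the exit time from the interval, when a and b are the two roots. The last clause says
    that it starts with a negative slope, by strict convexity of exp. *)
Lemma exit_weights (a b D : R) : 0 < a -> 0 < b -> 0 < D ->
  exists A B : R, [/\ 0 <= A, 0 <= B, A + B = 1,
    A * expR (- a * D) + B * expR (b * D) = 1 & b * B < a * A].
Proof.
move=> a0 b0 D0; have aD : 0 < a * D by exact: mulr_gt0.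
have bD : 0 < b * D by exact: mulr_gt0.
have e1 : expR (- a * D) < 1 by rewrite -expR0 ltr_expR mulNr oppr_lt0.
have e2 : 1 < expR (b * D) by rewrite -expR0 ltr_expR.
have D1 : 0 < expR (b * D) - expR (- a * D) by lra.
exists ((expR (b * D) - 1) / (expR (b * D) - expR (- a * D))),
  ((1 - expR (- a * D)) / (expR (b * D) - expR (- a * D))); split.
- by rewrite divr_ge0//; lra.
- by rewrite divr_ge0//; lra.
- by field; rewrite gt_eqF.
- by field; rewrite gt_eqF.
rewrite !mulrA ltr_pM2r ?invr_gt0//.
have h1 : 1 - a * D < expR (- a * D).
  by rewrite mulNr; apply: expR_gt1Dx; rewrite oppr_eq0 gt_eqF.
have h2 : 1 + b * D < expR (b * D) by apply: expR_gt1Dx; rewrite gt_eqF.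
apply: (@lt_trans _ _ (b * (a * D))).
  by rewrite ltr_pM2l//; lra.
by rewrite mulrCA ltr_pM2l//; lra.
Qed.

(** The constant terms agree, and since q lambda = k the slopes differ by exactly -(1 - q) (a A - b
    B)/2, which is negative. [C] collects all the quadratic errors. *)
Lemma gap_expansion (a b A B lam Q2 q k : R) : 0 < a -> 0 < b ->
  0 <= A -> 0 <= B -> A + B = 1 -> b * B < a * A -> 0 <= Q2 ->
  0 <= q < 1 -> q * lam = k -> 0 <= k ->
  exists2 u0 : R, 0 < u0 & forall u, 0 < u -> u < u0 ->
    (1 - q) * ((1 + (A * expR (- a * u) + B * expR (b * u))) / 2) +
      q * (1 - lam * u + Q2 / 2 * u ^+ 2) < 1 - k * (expR u - 1).
Proof.
move=> a0 b0 A0 B0 AB ab Q20 /andP[q0 q1] ql k0.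
pose kap := a * A - b * B; have kap0 : 0 < kap by rewrite subr_gt0.
pose C0 := A * a ^+ 2 / 2 + 2 * B * b ^+ 2.
have C00 : 0 <= C0.
  apply: addr_ge0; first by rewrite divr_ge0// mulr_ge0// sqr_ge0.
  by apply: mulr_ge0; [exact: mulr_ge0|exact: sqr_ge0].
pose C := (1 - q) * C0 / 2 + q * Q2 / 2 + 2 * k.
have C1 : 0 <= C.
  have q2 : 0 <= 1 - q by rewrite subr_ge0 ltW.
  by apply: addr_ge0; [apply: addr_ge0; apply: divr_ge0 => //; exact: mulr_ge0|exact: mulr_ge0].
have s0 : 0 < (1 - q) * kap / 2 by rewrite divr_gt0// mulr_gt0 ?subr_gt0.
have C10 : 0 < C + 1 by have := C1; lra.
(* The first two bounds validate [expR_le_quad] for u and for b u; below the third the linear gain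
   exceeds the quadratic errors. The 1 added to [C] keeps the denominator positive. *)
exists (Num.min (Num.min 2^-1 (2^-1 / b)) ((1 - q) * kap / 2 / (C + 1))).
  by rewrite !lt_min invr_gt0 ltr0n (divr_gt0 _ b0) ?invr_gt0// (divr_gt0 s0 C10).
move=> u u0; rewrite !lt_min => /andP[/andP[u1 u2] u3].
rewrite ltr_pdivlMr// in u2; rewrite ltr_pdivlMr// in u3.
have hA : A * expR (- a * u) <= A * (1 - a * u + (a * u) ^+ 2 / 2).
  by rewrite ler_wpM2l// mulNr; apply: expRN_le; rewrite mulr_ge0 ?(ltW a0)// ltW.
have hB : B * expR (b * u) <= B * (1 + b * u + 2 * (b * u) ^+ 2).
  rewrite ler_wpM2l//; apply: expR_le_quad; first by rewrite mulr_ge0 ?(ltW b0)// ltW.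
  by rewrite mulrC ltW.
have hu : k * (expR u - 1) <= k * (u + 2 * u ^+ 2).
  by rewrite ler_wpM2l//; have := expR_le_quad (ltW u0) (ltW u1); lra.
have hs : A * expR (- a * u) + B * expR (b * u) <= 1 - kap * u + C0 * u ^+ 2.
  apply: (le_trans (lerD hA hB)); rewrite /kap /C0 le_eqVlt; apply/orP; left; apply/eqP.
  have -> : B = 1 - A by rewrite -AB; ring.
  by field.
have h1q : 0 <= 1 - q by rewrite subr_ge0 ltW.
have := ler_wpM2l h1q hs; set S := A * _ + B * _ => hS.
have uu : 0 < u * ((1 - q) * kap / 2 - u * (C + 1)) by rewrite mulr_gt0// subr_gt0.
have u2' := sqr_ge0 u.
have -> : (1 - q) * ((1 + S) / 2) = ((1 - q) + (1 - q) * S) / 2 by field.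
have qE : q * (1 - lam * u + Q2 / 2 * u ^+ 2) = q - k * u + q * Q2 / 2 * u ^+ 2.
  by rewrite -ql; ring.
rewrite qE.
have CE : C * u ^+ 2 = ((1 - q) * C0 / 2 + q * Q2 / 2 + 2 * k) * u ^+ 2 by [].
by rewrite /C in uu; have := hu; have := hS; have := uu; have := u2'; lra.
Qed.

End expansions.

(** * Gaps in a stopping region *)

Section gap.
Context d (Om : measurableType d) (R : realType) (P : probability Om R).
Variables (F : R -> set (set Om)) (W : R -> Om -> R) (X : R -> R -> Om -> R).
Variables mu sigma K beta : R.
Hypotheses (sigma0 : 0 < sigma) (K0 : 0 < K) (beta0 : 0 < beta).
Hypotheses (filtrationF : filtration F) (brownianW : brownian_motion P F W).
Hypothesis gbmX : forall x : R, 0 < x -> geometric_brownian_motion P F W mu sigma x (X x).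
Local Notation f := (put_payoff K).
Local Notation delta := (hyperbolic_discount beta).
Local Notation lam := (lambda mu sigma beta).
Local Notation J := (J P X f delta).
Local Notation path x w := (fun t => X x t w).
Local Notation mixture := (mixture mu sigma beta).
Local Notation a := (lower_root mu sigma beta).
Local Notation b := (upper_root mu sigma beta).
Implicit Types x l r : R.

Let U l r : set R := [set y | y < l] `|` [set y | r < y].

Let oU l r : open (U l r).
Proof. by apply: openU; [exact: open_lt|exact: open_gt]. Qed.

Let a0 : 0 < a. Proof. exact: lower_root_gt0. Qed.
Let b0 : 0 < b. Proof. exact: upper_root_gt0. Qed.

(** At the exit time the price is exactly l or r. There the combination of the two exponential
    martingales with these weights equals exp(-beta t), and each of them has expectation at most
    1. *)
Lemma exit_laplace_le x l r A B : 0 < l -> l < x -> x < r -> 0 <= A -> 0 <= B ->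
  A + B = 1 -> A * expR (- a * ln (r / l)) + B * expR (b * ln (r / l)) = 1 ->
  (\int[P]_w (at_hit (U l r) (path x w) (fun t => expR (- beta * t)))%:E <=
   (A * expR (- a * ln (x / l)) + B * expR (b * ln (x / l)))%:E)%E.
Proof.
move=> l0 lx xr A0 B0 AB AB'; have x0 := lt_trans l0 lx; have r0 := lt_trans x0 xr.
set u := ln (x / l); set D := ln (r / l) in AB'.
pose M p w := at_hit (U l r) (path x w)
  (fun t => expR (p * log_price x (X x) t w - gbm_exponent mu sigma p * t)).
have M0 p w : 0 <= M p w by apply: at_hit_ge0 => t _ _; exact: expR_ge0.
have mM p : measurable_fun setT (EFin \o M p).
  apply/measurable_EFinP; apply: (measurable_price_at_hit filtrationF (gbmX x0)
    (Z := exp_process (log_price x (X x)) (gbm_exponent mu sigma) p)) => //.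
    move=> t t0.
    exact: (measurable_exp_process (exp_process_expectation filtrationF brownianW sigma0 x0 (gbmX x0))).
  by apply: exp_process_continuous; exact: (log_price_continuous x0 (gbmX x0)).
have M1 p : (\int[P]_w (M p w)%:E <= 1)%E.
  by apply: (price_exp_at_hit_le1 filtrationF brownianW sigma0 x0 (gbmX x0) p (@oU l r)).
pose k1 := A * expR (- a * u); pose k2 := B * expR (b * u).
have k10 : 0 <= k1 by rewrite mulr_ge0 ?expR_ge0.
have k20 : 0 <= k2 by rewrite mulr_ge0 ?expR_ge0.
apply: (@le_trans _ _ (\int[P]_w (k1%:E * (EFin \o M (- a)%R) w + k2%:E * (EFin \o M b) w))%E).
  apply: ge0_ae_le_integral.
  - by move=> w; rewrite lee_fin; apply: at_hit_ge0 => t _ _; exact: expR_ge0.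
  - by move=> w; rewrite -!EFinM -EFinD lee_fin addr_ge0// mulr_ge0.
  apply: aeW => w; rewrite -!EFinM -EFinD lee_fin /M.
  case: (hit_dichotomy (U l r) (path x w)) => [e|[t t0 e]].
    by rewrite !(at_hit_oo _ e) !mulr0 addr0.
  rewrite !(at_hitE _ e) gbm_exponent_lower ?(ltW beta0)// gbm_exponent_upper ?(ltW beta0)//.
  have cX := price_continuous (gbmX x0) (w := w).
  have nU : ~ U l r (X x t w).
    apply: (hit_open_notin (@oU l r) cX _ e); rewrite (price0 (gbmX x0)) => -[] /=.
      by rewrite ltNge ltW.
    by rewrite ltNge ltW.
  have [lX Xr] : l <= X x t w /\ X x t w <= r.
    by split; rewrite leNgt; apply/negP => h; apply: nU; [left|right].
  have cU : closed ([set y | y <= l] `|` [set y | r <= y]).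
    by apply: closedU; [exact: closed_le|exact: closed_ge].
  have UcU : U l r `<=` [set y | y <= l] `|` [set y | r <= y].
    by move=> y [h|h]; [left|right]; exact: ltW.
  have Y l' : X x t w = l' -> 0 < l' -> log_price x (X x) t w = ln (l' / l) - u.
    move=> Xl l'0; rewrite /log_price Xl /u -[RHS]ln_div ?posrE ?divr_gt0//.
    by congr ln; field; rewrite !gt_eqF.
  rewrite /k1 /k2 -!mulrA -!expRD.
  have E p s t' : p * u + (p * (s - u) - beta * t') = p * s + - beta * t' by ring.
  have [Xl|rX] := hit_closed cU UcU cX e.
    have -> := Y l _ l0; last by apply/eqP; rewrite eq_le lX Xl.
    rewrite divff ?gt_eqF// ln1 !E !mulr0 !add0r -mulrDl AB mul1r.
    exact: lexx.
  have -> := Y r _ r0; last by apply/eqP; rewrite eq_le rX Xr.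
  rewrite -/D !E !expRD !mulrA -mulrDl AB' mul1r.
  exact: lexx.
have M0e p w : setT w -> (0 <= (EFin \o M p) w)%E by move=> _; rewrite lee_fin.
have k10e : (0 <= k1%:E)%E by rewrite lee_fin.
have k20e : (0 <= k2%:E)%E by rewrite lee_fin.
have p1 w : setT w -> (0 <= k1%:E * (EFin \o M (- a)%R) w)%E by move=> _; rewrite mule_ge0 ?lee_fin.
have p2 w : setT w -> (0 <= k2%:E * (EFin \o M b) w)%E by move=> _; rewrite mule_ge0 ?lee_fin.
rewrite (ge0_integralD P measurableT p1 (measurable_funeM _ (mM _)) p2 (measurable_funeM _ (mM _))).
rewrite (ge0_integralZl P measurableT (mM _) (@M0e _) k10e).
rewrite (ge0_integralZl P measurableT (mM _) (@M0e _) k20e).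
rewrite EFinD -[X in (_ <= X + _)%E]mule1 -[X in (_ <= _ + X)%E]mule1.
by apply: leeD; apply: lee_wpmul2l => //; exact: M1.
Qed.

(** With c = l in [J_beyond_le] the weight q = k / lambda is less than 1. A path started in the gap
    must leave ]l, r[ before it passes B, so its discount is bounded through [exit_laplace_le], and
    [gap_expansion] makes the total smaller than the payoff. *)
Lemma J_gap_lt (B : set R) l r : B `<=` [set y | 0 < y] -> closure B l -> 0 < l -> l < r ->
  l < K -> l / (K - l) < lam -> (forall y, l < y -> y <= r -> ~ B y) ->
  exists2 x, l < x < r & (J x B < (f x)%:E)%E.
Proof.
move=> B0 clB l0 lr lK klam gapB; have r0 := lt_trans l0 lr.
have Kl : 0 < K - l by rewrite subr_gt0.
pose k := l / (K - l); have k0 : 0 < k by exact: divr_gt0.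
have lam0 : 0 < lam by exact: lt_trans klam.
pose q := k / lam; have ql : q * lam = k by rewrite divfK// gt_eqF.
have q01 : 0 <= q < 1 by rewrite divr_ge0 ?ltW//= ltr_pdivrMr// mul1r.
have q01' : 0 <= q <= 1 by case/andP: q01 => -> /ltW ->.
have D0 : 0 < ln (r / l) by rewrite ln_gt0// ltr_pdivlMr// mul1r.
have [A [B' [A0 B'0 AB AB' ab]]] := exit_weights a0 b0 D0.
pose Q2 := \int[unit_exponential R]_s (alpha mu sigma beta s ^+ 2).
have Q20 : 0 <= Q2 by apply: Rintegral_ge0 => s _; exact: sqr_ge0.
have [u0 u00 hu] := gap_expansion a0 b0 A0 B'0 AB ab Q20 q01 ql (ltW k0).
(* Half of the minimum puts x = l exp(u) strictly inside ]l, r[ and within the range of the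
   expansion. *)
pose u := Num.min u0 (ln (r / l)) / 2.
have m0 : 0 < Num.min u0 (ln (r / l)) by rewrite lt_min u00.
have u_gt0 : 0 < u by rewrite divr_gt0.
have um : u < Num.min u0 (ln (r / l)) by rewrite /u; lra.
move: (um); rewrite lt_min => /andP[uu0 ur].
pose x := l * expR u; have lx : l < x by rewrite ltr_pMr// -expR0 ltr_expR.
have xr : x < r by rewrite /x mulrC -ltr_pdivlMr// -[ltRHS]lnK ?posrE ?divr_gt0// ltr_expR.
have x0 := lt_trans l0 lx.
have xl : ln (x / l) = u by rewrite /x mulrAC divff ?gt_eqF// mul1r expRK.
exists x; first by rewrite lx xr.
have nB : ~ closure B x.
  move=> clx; have [y By /andP[ly yr]] := closure_between clx lx xr.
  exact: (gapB y ly (ltW yr) By).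
pose E := (1 + (A * expR (- a * u) + B' * expR (b * u))) / 2.
pose N w := at_hit (U l r) (path x w) (fun t => expR (- beta * t)).
have N01 w : 0 <= N w <= 1 := at_hit_exp01 (U l r) (path x w) (ltW beta0).
have mN : measurable_fun setT N.
  apply: (measurable_price_at_hit filtrationF (gbmX x0) (Z := fun t _ => expR (- beta * t)) (@oU l r)) => //.
  move=> w; apply: continuous_subspaceT => t.
  apply: (@cvg_comp _ _ _ _ (@expR R)); last exact: continuous_expR.
  by apply: (@cvgM R R); [exact: cvg_cst|exact: cvg_id].
have iN : P.-integrable setT (EFin \o N).
  apply: integrable_dom (probability_integrable_cst P 1) => //.
  by move=> w; have /andP[h0 h1] := N01 w; rewrite ger0_norm.
have i1N : P.-integrable setT (EFin \o (fun w => 1 + N w)).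
  by apply: integrableDr => //; exact: probability_integrable_cst.
have beyondU : beyond B x `<=` U l r.
  move=> y [c Bc /orP[/andP[yc cx]|/andP[xc cy]]].
    left; apply: (lt_le_trans yc); rewrite leNgt; apply/negP => lc.
    exact: (gapB c lc (ltW (lt_trans cx xr)) Bc).
  right; apply: le_lt_trans cy; rewrite leNgt; apply/negP => cr.
  exact: (gapB c (lt_trans lx xc) (ltW cr) Bc).
have dE : (\int[P]_w (at_hit (beyond B x) (path x w) delta)%:E <= E%:E)%E.
  apply: (@le_trans _ _ (\int[P]_w (2^-1 * (1 + N w))%:E)%E).
    apply: ge0_ae_le_integral.
    - by move=> w; rewrite lee_fin; apply: at_hit_ge0 => t t0 _; exact/ltW/discount_gt0.
    - by move=> w; rewrite lee_fin mulr_ge0// addr_ge0//; case/andP: (N01 w).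
    apply: aeW => w; rewrite lee_fin.
    apply: (@le_trans _ _ (2^-1 * (1 + at_hit (beyond B x) (path x w) (fun t => expR (- beta * t))))).
      case: (hit_dichotomy (beyond B x) (path x w)) => [e|[t t0 e]].
        by rewrite !(at_hit_oo _ e) addr0 mulr1.
      by rewrite !(at_hitE _ e) mulrC; exact: discount_le_expR.
    rewrite ler_wpM2l// lerD2l; apply: at_hit_exp_le; first exact: ltW.
    by apply: hit_subset => t _; exact: beyondU.
  rewrite Rintegral_EFin; last exact: integrableZr_.
  rewrite RintegralZl// RintegralD//; last exact: probability_integrable_cst.
  rewrite probability_Rintegral_cst lee_fin /E mulrC ler_pM2r// lerD2l -lee_fin.
  rewrite -Rintegral_EFin// -xl; exact: exit_laplace_le.
have := J_beyond_le (K := K) sigma0 K0 beta0 filtrationF brownianW gbmX x0 B0 nB l0 (ltW lx) lK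
  (fun w t => closure_le_hit gbmX x0 clB lx (w := w) (t := t)) q01' ql dE.
move=> /le_lt_trans; apply; rewrite lte_fin.
apply: (@lt_le_trans _ _ (K - x)); last by rewrite /put_payoff le_max lexx.
have -> : K - x = (K - l) * (1 - k * (expR u - 1)).
  by rewrite /k /x; field; rewrite gt_eqF.
rewrite ltr_pM2l// xl; apply: le_lt_trans (hu u u_gt0 uu0).
by rewrite lerD2l ler_wpM2l; [|case/andP: q01|rewrite mixture0_le// ltW].
Qed.

End gap.

(** * Equilibria, the intersection of the closed ones, and optimality *)

Section closed_equilibria.
Context d (Om : measurableType d) (R : realType) (P : probability Om R).
Variables (F : R -> set (set Om)) (W : R -> Om -> R) (X : R -> R -> Om -> R).
Variables mu sigma K beta : R.
Hypotheses (sigma0 : 0 < sigma) (K0 : 0 < K) (beta0 : 0 < beta).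
Hypotheses (filtrationF : filtration F) (brownianW : brownian_motion P F W).
Hypothesis gbmX : forall x : R, 0 < x -> geometric_brownian_motion P F W mu sigma x (X x).
Local Notation f := (put_payoff K).
Local Notation delta := (hyperbolic_discount beta).
Local Notation lam := (lambda mu sigma beta).
Local Notation J := (J P X f delta).
Local Notation V := (V P X f delta).
Local Notation XX := (`]0, +oo[%classic : set R).
Local Notation path x w := (fun t => X x t w).
Local Notation mixture := (mixture mu sigma beta).
Local Notation equilibrium := (equilibrium P X XX f delta).
Implicit Types (B : set R) (x : R).

Let lam0 : 0 < lam. Proof. exact: lambda_gt0. Qed.

Definition threshold : R := lam / (1 + lam) * K.
Local Notation b := threshold.

Let lam1 : 0 < 1 + lam. Proof. exact: addr_gt0. Qed.

Lemma threshold_gt0 : 0 < b.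
Proof. by rewrite mulr_gt0// divr_gt0. Qed.

Lemma threshold_ltK : b < K.
Proof. by rewrite gtr_pMl// ltr_pdivrMr// mul1r ltrDr. Qed.

Let b0 := threshold_gt0.
Let bK := threshold_ltK.

Lemma threshold_ratio : b / (K - b) = lam.
Proof.
have -> : K - b = K / (1 + lam) by rewrite /threshold; field; rewrite gt_eqF.
by rewrite /threshold; field; rewrite !gt_eqF.
Qed.

Lemma threshold_ratio_lt l : l < b -> l / (K - l) < lam.
Proof.
move=> lb; have Kl : 0 < K - l by have := lb; have := bK; lra.
have E : lam * (K - b) = b by rewrite -{1}threshold_ratio divfK// gt_eqF// subr_gt0.
rewrite ltr_pdivrMr//.
have : lam * (K - b) < lam * (K - l) by rewrite ltr_pM2l//; have := lb; lra.
by rewrite E; apply: lt_trans.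
Qed.

Lemma mem_XX x : XX x <-> 0 < x.
Proof. by rewrite /= in_itv/= andbT. Qed.

Let star : set R := `]0, b]%classic.

Let mem_star x : star x <-> 0 < x /\ x <= b.
Proof. by rewrite /star/= in_itv/=; split=> [/andP[]//|[-> ->]]. Qed.

Lemma equilibrium_pos B : equilibrium B -> B `<=` [set y | 0 < y].
Proof. by move=> [[_ BX] _] y /BX /mem_XX. Qed.

Lemma equilibrium_J_le B x : equilibrium B -> B x -> (J x B <= (f x)%:E)%E.
Proof.
move=> [_ eB] Bx; have : Theta P X XX f delta B x by rewrite eB.
by move=> [[_ /ltW]|[[_ ->] _]].
Qed.

Lemma equilibrium_mem B x : equilibrium B -> 0 < x -> (J x B < (f x)%:E)%E -> B x.
Proof.
move=> [_ eB] x0 h; suff : Theta P X XX f delta B x by rewrite eB.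
by left; split=> //; exact/mem_XX.
Qed.

(** The interval is reached no later than the open half-line below b, with a payoff of at least K -
    b; the expected discount at the half-line is bounded below by the mixture. *)
Lemma J_star_lower x : b < x -> (((K - b) * mixture 0 (ln (x / b)))%:E <= J x star)%E.
Proof.
move=> bx; have x0 := lt_trans b0 bx; have Kb : 0 < K - b by rewrite subr_gt0.
have mD : measurable_fun setT (EFin \o
    (fun w => at_hit [set y | y < b] (path x w) delta)).
  apply/measurable_EFinP; apply: (measurable_at_hit_discount beta0 filtrationF gbmX x0).
  exact: open_lt.
have D0 w : 0 <= at_hit [set y | y < b] (path x w) delta.
  by apply: at_hit_ge0 => t t0 _; exact/ltW/discount_gt0.
apply: (@le_trans _ _ ((K - b)%:E * \int[P]_w
    (at_hit [set y | (y < b)%R] (path x w) delta)%:E)%E).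
  rewrite EFinM lee_wpmul2l ?lee_fin ?(ltW Kb)//.
  exact: (hit_below_discount filtrationF brownianW sigma0 beta0 x0 (gbmX x0) b0 (ltW bx)).
have D0e w : setT w -> (0 <= (EFin \o
    (fun w => at_hit [set y | (y < b)%R] (path x w) delta)) w)%E.
  by move=> _; rewrite lee_fin.
have Kb0 : (0 <= (K - b)%:E)%E by rewrite lee_fin ltW.
rewrite -(ge0_integralZl P measurableT mD D0e Kb0) (J_at_hit K0 beta0 gbmX star x0).
apply: ge0_ae_le_integral.
- by move=> w; rewrite mule_ge0// D0e.
- by move=> w; rewrite lee_fin; exact: (at_hit_payoff_ge0 K beta0).
apply: aeW => w; rewrite /= -EFinM lee_fin.
case: (hit_dichotomy [set y | y < b] (path x w)) => [e|[t t0 e]].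
  by rewrite at_hit_oo// mulr0; exact: (at_hit_payoff_ge0 K beta0).
have : (hit star (path x w) <= t%:E)%E.
  rewrite -e; apply: hit_subset => s s0 /= sb; apply/mem_star.
  by split; [exact: (price_gt0 (gbmX x0) w (ltW s0))|exact: ltW].
rewrite (at_hitE _ e).
case: (hit_dichotomy star (path x w)) => [->//|[s s0 es]]; rewrite es lee_fin => st.
rewrite (at_hitE _ es) mulrC.
have Xb : X x s w <= b.
  have sb : star `<=` [set y | y <= b] by move=> y /mem_star[].
  exact: (hit_closed (@closed_le R b) sb (price_continuous (gbmX x0) (w := w)) es).
rewrite ler_pM ?(ltW Kb) ?(ltW (discount_gt0 _ _))// ?discount_le//.
by rewrite -(put_payoffE (ltW bK)) put_payoff_le.
Qed.

(** Strictness comes from ln z < z - 1 for z = x/b > 1, inserted between the Jensen bound and the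
    linear form of K - x. *)
Lemma J_star_gt x : b < x -> ((f x)%:E < J x star)%E.
Proof.
move=> bx; have x0 := lt_trans b0 bx; have Kb : 0 < K - b by rewrite subr_gt0.
apply: lt_le_trans (J_star_lower bx); rewrite lte_fin.
have u0 : 0 < ln (x / b) by rewrite ln_gt0// ltr_pdivlMr// mul1r.
apply: (@lt_le_trans _ _ ((K - b) * expR (- lam * ln (x / b)))); last first.
  by rewrite (ler_wpM2l (ltW Kb))// mixture0_ge// ltW.
rewrite /put_payoff gt_max mulr_gt0 ?expR_gt0// andbT.
have h1 : 1 - lam * ln (x / b) <= expR (- lam * ln (x / b)).
  by have := expR_ge1Dx (- lam * ln (x / b)); lra.
have h2 : 1 + ln (x / b) < x / b.
  by have := @expR_gt1Dx _ (ln (x / b)) (lt0r_neq0 u0); rewrite lnK ?posrE ?divr_gt0.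
have h3 : 1 - lam * (x / b - 1) < 1 - lam * ln (x / b).
  by rewrite ltrD2l ltrN2 ltr_pM2l//; lra.
have -> : K - x = (K - b) * (1 - lam * (x / b - 1)).
  rewrite -threshold_ratio; field; rewrite !gt_eqF//.
by rewrite ltr_pM2l//; exact: lt_le_trans h3 h1.
Qed.

(** Above b continuation is strictly better. On the interval J is at most f since its points are hit
    at once, and equality is allowed there because the point already belongs to the region. *)
Lemma star_equilibrium : equilibrium star.
Proof.
split.
  by split; [exact: measurable_itv|move=> y /mem_star[y0 _]; exact/mem_XX].
apply/seteqP; split=> x.
  have le_b : 0 < x -> (J x star <= (f x)%:E)%E -> star x.
    move=> x0 h; apply/mem_star; split=> //; rewrite leNgt; apply/negP => bx.
    by have := lt_le_trans (J_star_gt bx) h; rewrite ltxx.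
  by move=> [[/mem_XX x0 /ltW h]|[_ //]]; exact: le_b.
move=> sx; have [x0 xb] := (mem_star x).1 sx.
have : (J x star <= (f x)%:E)%E.
  by apply: (J_closure sigma0 K0 beta0 filtrationF brownianW gbmX x0); exact: subset_closure.
rewrite le_eqVlt => /predU1P[e|h]; last by left; split=> //; exact/mem_XX.
by right; split=> //; split; [exact/mem_XX|rewrite e].
Qed.

Lemma star_closed : closed_in XX star.
Proof.
exists [set y | y <= b]; first exact: closed_le.
by apply/seteqP; split=> x; rewrite mem_star => -[h1 h2]; split=> //; [exact/mem_XX|exact/mem_XX].
Qed.

(** If B has no point below x, stopping at x/2 is strictly better than waiting, so x/2 would belong
    to B. Otherwise the supremum of B below x is the lower end of a gap, and [J_gap_lt] produces a
    point of the gap that must belong to B. *)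
Lemma equilibrium_dense_below B x : equilibrium B -> 0 < x -> x < b -> closure B x.
Proof.
move=> eB x0 xb; apply: contrapT => nB; have B0 := equilibrium_pos eB.
have xK : x < K := lt_trans xb bK.
have [e e0 eb] := not_closure_dist nB.
have gap y : B y -> y <= x - e \/ x + e <= y.
  move=> By; have := eb y By; have [xy|xy] := leP y x.
    by rewrite ger0_norm ?subr_ge0//; left; lra.
  by rewrite ltr0_norm ?subr_lt0//; right; lra.
pose L := [set y | B y /\ y < x].
have [[y0 Ly0]|L0] := pselect (L !=set0); last first.
  have x2 : 0 < x / 2 by rewrite divr_gt0.
  have xx2 : x / 2 < x by lra.
  have Bx : B `<=` [set y | x <= y].
    by move=> y By /=; rewrite leNgt; apply/negP => yx; apply: L0; exists y.
  have := J_lower_bound K0 beta0 gbmX x2 xx2 xK Bx.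
  move/(equilibrium_mem eB x2) => /Bx /=; lra.
have Lx : ubound L (x - e) by move=> y [By yx]; case: (gap y By) => //; have := e0; lra.
have hsL : has_sup L by split; [exists y0|exists (x - e)].
have lx : sup L <= x - e by apply: ge_sup => //; exists y0.
have l0 : 0 < sup L by apply: lt_le_trans (ub_le_sup hsL.2 Ly0); exact: B0 Ly0.1.
have clL : closure B (sup L).
  apply: (@closure_subset _ L); first by move=> y [].
  by apply: closure_sup; [exists y0|exists (x - e)].
have lr : sup L < x + e / 2 by have := lx; have := e0; lra.
have lb : sup L < b by have := lx; have := e0; have := xb; lra.
have gapL y : sup L < y -> y <= x + e / 2 -> ~ B y.
  move=> ly yr By; case: (gap y By) => h; last by have := e0; lra.
  have : y <= sup L by apply: (ub_le_sup hsL.2); split=> //; have := e0; lra.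
  by rewrite leNgt ly.
have [z /andP[lz zr] Jz] := J_gap_lt sigma0 K0 beta0 filtrationF brownianW gbmX B0 clL l0 lr
  (lt_trans lb bK) (threshold_ratio_lt lb) gapL.
exact: (gapL z lz (ltW zr) (equilibrium_mem eB (lt_trans l0 lz) Jz)).
Qed.

Lemma equilibrium_closure B : equilibrium B -> star `<=` closure B.
Proof.
move=> eB x /mem_star[x0]; rewrite le_eqVlt => /predU1P[->|xb]; last first.
  exact: equilibrium_dense_below.
move=> N /nbhs_ballP[e /= e0 eN].
pose y := Num.max (b / 2) (b - e / 2).
have y_ge : b / 2 <= y /\ b - e / 2 <= y by rewrite /y; split; rewrite le_max lexx ?orbT.
have yb : y < b by rewrite /y gt_max; apply/andP; split; have := e0; have := b0; lra.
have y0 : 0 < y by have := y_ge.1; have := b0; lra.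
apply: (equilibrium_dense_below eB y0 yb).
apply: (@filterS _ (nbhs y) _ (ball b e)) => //.
apply: open_nbhs_nbhs; split; first exact: ball_open.
by rewrite /ball/= ltr_norml; have := y_ge.2; have := yb; have := e0; lra.
Qed.

Lemma closed_equilibrium_star A : closed_in XX A -> equilibrium A -> star `<=` A.
Proof.
move=> [C cC AE] eA x sx; have [x0 _] := (mem_star x).1 sx.
have : C x.
  rewrite (closure_id C).1 //; apply: (@closure_subset _ A); first by rewrite AE => y [].
  exact: equilibrium_closure sx.
by rewrite AE => Cx; split=> //; exact/mem_XX.
Qed.

Lemma Rstar_star : Rstar P X XX f delta = star.
Proof.
apply/seteqP; split=> x.
  by apply; split; [exact: star_equilibrium|exact: star_closed].
by move=> sx A [eA cA]; exact: closed_equilibrium_star sx.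
Qed.

(** The threshold lies in the closure of B, so a path from x has not passed below it when it is
    stopped. With c = b the ratio is lambda itself, hence q = 1: the discount term has weight 0, and
    the trivial bound 1 on it is enough. *)
Lemma equilibrium_J_le_star B x : equilibrium B -> 0 < x -> ~ closure B x ->
  (J x B <= J x star)%E.
Proof.
move=> eB x0 nB.
have bx : b < x.
  rewrite ltNge; apply/negP => xb; apply: nB; apply: (equilibrium_closure eB).
  by apply/mem_star.
apply: le_trans (J_star_lower bx).
have clb : closure B b by apply: (equilibrium_closure eB); apply/mem_star.
have h := J_beyond_le sigma0 K0 beta0 filtrationF brownianW gbmX x0 (equilibrium_pos eB)
  nB b0 (ltW bx) bK (fun w t => closure_le_hit gbmX x0 clb bx (w := w) (t := t))
  (q := 1) (E := 1).
have := h _ _ _; rewrite ler01 lexx mul1r threshold_ratio subrr mul0r add0r mul1r.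
apply=> //.
have -> : 1%:E = (\int[P]_w 1%:E)%E by rewrite integral_cst//= probability_setT mule1.
apply: ge0_ae_le_integral => //.
- by move=> w; rewrite lee_fin; apply: at_hit_ge0 => t t0 _; exact/ltW/discount_gt0.
apply: aeW => w; rewrite lee_fin.
case: (hit_dichotomy (beyond B x) (path x w)) => [e|[t t0 e]]; first by rewrite at_hit_oo.
by rewrite (at_hitE _ e); exact: discount_le1.
Qed.

Lemma star_optimal : optimal_equilibrium P X XX f delta star.
Proof.
split; first exact: star_equilibrium.
move=> x B /mem_XX x0 eB; rewrite /Defs.V ge_max le_max lexx/=.
have [clB|nB] := pselect (closure B x).
  by rewrite le_max (J_closure sigma0 K0 beta0 filtrationF brownianW gbmX x0 clB).
by rewrite le_max (equilibrium_J_le_star eB x0 nB) orbT.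
Qed.

(** At a point x > b of A the value is only f(x), whereas the interval gives strictly more by
    [J_star_gt]; this contradicts the optimality of A. *)
Lemma closed_optimal_star A : closed_in XX A ->
  optimal_equilibrium P X XX f delta A -> A = star.
Proof.
move=> cA [eA oA]; apply/seteqP; split; last exact: closed_equilibrium_star.
move=> x Ax; have x0 := equilibrium_pos eA Ax.
apply/mem_star; split=> //; rewrite leNgt; apply/negP => bx.
have := oA x star ((mem_XX x).2 x0) star_equilibrium.
rewrite /Defs.V (max_l (equilibrium_J_le eA Ax)) ge_max => /andP[_ h].
by have := lt_le_trans (J_star_gt bx) h; rewrite ltxx.
Qed.

End closed_equilibria.

Theorem proposition6p5 (R : realType) (d : measure_display)
    (Om : measurableType d) (P : probability Om R)
    (F : R -> set (set Om)) (W : R -> Om -> R) (X : R -> R -> Om -> R)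
    (mu sigma K beta : R)
    (sigma_gt0 : 0 < sigma) (K_gt0 : 0 < K) (beta_gt0 : 0 < beta)
    (filtrationF : filtration F)
    (brownianW : brownian_motion P F W)
    (gbmX : forall x : R, 0 < x ->
       geometric_brownian_motion P F W mu sigma x (X x)) :
  let XX : set R := `]0, +oo[%classic in
  let f := put_payoff K in
  let delta := hyperbolic_discount beta in
  let lam := lambda mu sigma beta in
  [/\ 0 < lam,
      Rstar P X XX f delta = `]0, lam / (1 + lam) * K]%classic,
      closed_in XX (Rstar P X XX f delta),
      optimal_equilibrium P X XX f delta (Rstar P X XX f delta)
    & forall A : set R, closed_in XX A ->
        optimal_equilibrium P X XX f delta A -> A = Rstar P X XX f delta].
Proof.
move=> XX f delta lam.
have RE := Rstar_star sigma_gt0 K_gt0 beta_gt0 filtrationF brownianW gbmX.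
rewrite RE; split=> //.
- exact: lambda_gt0.
- exact: star_closed.
- exact: (star_optimal sigma_gt0 K_gt0 beta_gt0 filtrationF brownianW gbmX).
- by move=> A; exact: (closed_optimal_star sigma_gt0 K_gt0 beta_gt0 filtrationF brownianW gbmX).
Qed.
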